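(* Let $m,d,p\in\mathbb{N}$, $q\in\mathbb{N}_0$, and let $(Z_t)_{t\in\mathbb{Z}}$ be an i.i.d. sequence of $\mathbb{C}^d$-valued random vectors. Let $\Psi_1,\ldots,\Psi_p\in\mathbb{C}^{m\times m}$ and $\Theta_0,\ldots,\Theta_q\in\mathbb{C}^{m\times d}$, and define $$P(z):=\mathrm{Id}_m-\sum_{k=1}^p\Psi_kz^k,\qquad Q(z):=\sum_{k=0}^q\Theta_kz^k,\qquad z\in\mathbb{C}.$$ Let $K:=\{a\in\mathbb{C}^d:\text{the distribution of }a^*Z_0\text{ is degenerate to a Dirac measure}\}$, let $K^\perp$ be its orthogonal complement in $\mathbb{C}^d$, let $s:=\dim K^\perp$, and let $U\in\mathbb{C}^{d\times d}$ be unitary such that $U\,K^\perp=\mathbb{C}^s\times\{0_{d-s}\}$ and $U\,K=\{0_s\}\times\mathbb{C}^{d-s}$. Define $$\widetilde Q(z):=Q(z)U^*\begin{pmatrix}\mathrm{Id}_s&0_{s,d-s}\\0_{d-s,s}&0_{d-s,d-s}\end{pmatrix},\qquad M(z):=P^{-1}(z)\widetilde Q(z).$$ Assume that the matrix polynomials $P(z)$ and $\widetilde Q(z)$ are left-coprime. Consider the ARMA$(p,q)$ equation $$Y_t-\Psi_1Y_{t-1}-\ldots-\Psi_pY_{t-p}=\Theta_0Z_t+\ldots+\Theta_qZ_{t-q},\quad t\in\mathbb{Z}.\qquad( * )$$ Then the following are equivalent: (i) There exists a non-anticipative strictly stationary solution of $( * )$. (ii) There exists a causal strictly stationary solution of $(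 * )$. (iii) $\det P(z)\neq0$ for all $z\in\mathbb{C}$ such that $|z|\leq1$, and if $M(z)=\sum_{j=0}^\infty M_jz^j$ denotes the Taylor expansion of $M(z)=P^{-1}(z)\widetilde Q(z)$, then $$\mathbb{E}\log^+\|M_jUZ_0\|<\infty\quad\forall\,j\in\{mp+q-p+1,\ldots,mp+q\}.$$
   Context: $\mathbb{N}=\{1,2,\ldots\}$, $\mathbb{N}_0=\mathbb{N}\cup\{0\}$; $\log^+(x)=\log\max\{1,x\}$; $\|\cdot\|$ is a fixed vector norm on $\mathbb{C}^r$ (for each $r$). Vectors are column vectors; $A^*=\overline{A}^T$; $\mathrm{Id}_r$ is the $r\times r$ identity matrix, $0_{r,l}$ the zero matrix in $\mathbb{C}^{r\times l}$, $0_r$ the zero vector in $\mathbb{C}^r$. A solution of $( * )$ is any $\mathbb{C}^m$-valued process $(Y_t)_{t\in\mathbb{Z}}$, defined on the same probability space as $(Z_t)_{t\in\mathbb{Z}}$, satisfying $( * )$ almost surely. A process is strictly stationary if all its finite dimensional distributions are shift invariant. A strictly stationary solution $(Y_t)_{t\in\mathbb{Z}}$ is non-anticipative if for every $t\in\mathbb{Z}$, $Y_t$ is independent of the sigma algebra generated by $(Z_r)_{r>t}$; it is causal if for every $t\in\mathbb{Z}$, $Y_t$ is measurable with respect to the sigma algebra generated by $(Z_r)_{r\leq t}$ (up to null sets). A $\mathbb{C}^{m\times m}$ matrix polynomial $R(z)$ is a left-divisor of a matrix polynomial $A(z)$ with $m$ rows if there is a matrix polynomial $A_1(z)$ with $A(z)=R(z)A_1(z)$.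 The matrix polynomials $P(z)$ and $\widetilde Q(z)$ are left-coprime if every common left-divisor $R(z)$ of $P(z)$ and $\widetilde Q(z)$ is unimodular, i.e. $\det R(z)$ is (a nonzero) constant in $z$. *)

(* Defs.v *)
From HB Require Import structures.
From mathcomp Require Import all_boot all_order all_algebra.
From mathcomp Require Import complex.
From mathcomp Require Import all_classical all_reals all_analysis.

Set Implicit Arguments.
Unset Strict Implicit.
Unset Printing Implicit Defensive.

Import Order.TTheory GRing.Theory Num.Theory.
Import numFieldNormedType.Exports.

Local Open Scope classical_set_scope.
Local Open Scope ring_scope.
Local Open Scope complex_scope.
Local Open Scope sesquilinear_scope.

(* The field of complex numbers over the reals [R], with the sort [R[i]]. It is
   bundled as a [numClosedFieldType] because the normed and topological
   instances of [numFieldNormedType] are attached to the sorts of such structures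
   and are not found for the bare type [R[i]]. *)
Definition cplx (R : realType) : numClosedFieldType := R[i].

(* Borel sigma-algebras; the topology on matrices is the entrywise one. *)
Definition borel_cplx (R : realType) := g_sigma_algebraType (@open (cplx R)).
HB.instance Definition _ (R : realType) := Measurable.on (borel_cplx R).

HB.instance Definition _ (K : numClosedFieldType) (m n : nat) :=
  Measurable.copy 'M[K]_(m, n) (g_sigma_algebraType (@open 'M[K]_(m, n))).

Section VectorsAndNorms.
Context {R : realType}.
Local Notation C := (cplx R).

Definition logplus (x : R) : R := ln (Num.max 1 x).

Definition is_norm (n : nat) (N : 'cV[C]_n -> R) : Prop :=
  [/\ forall x, 0 <= N x,
      forall x, N x = 0 -> x = 0,
      forall (a : C) x, (N (a *: x))%:C = `|a| * (N x)%:C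
    & forall x y, N (x + y) <= N x + N y].

Definition orthocompl (n : nat) (A : set 'cV[C]_n) : set 'cV[C]_n :=
  [set b | forall a, A a -> (a ^t* *m b) 0 0 = 0].

Definition has_dim (n : nat) (A : set 'cV[C]_n) (s : nat) : Prop :=
  exists2 W : {vspace 'cV[C]_n}, A = [set b | b \in W] & \dim W = s.

End VectorsAndNorms.

(* A matrix polynomial is a matrix with polynomial entries. *)
Section MatrixPolynomials.
Context {R : realType}.
Local Notation C := (cplx R).

Definition constmxp (m n : nat) (A : 'M[C]_(m, n)) : 'M[{poly C}]_(m, n) :=
  map_mx polyC A.

Definition evalmxp (m n : nat) (A : 'M[{poly C}]_(m, n)) (z : C) :
    'M[C]_(m, n) :=
  map_mx (fun a : {poly C} => a.[z]) A.

Definition left_divisor (m n : nat) (D : 'M[{poly C}]_m)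
    (A : 'M[{poly C}]_(m, n)) : Prop :=
  exists A1 : 'M[{poly C}]_(m, n), A = D *m A1.

Definition unimodular (m : nat) (D : 'M[{poly C}]_m) : Prop :=
  exists2 c : C, c != 0 & \det D = c%:P.

Definition left_coprime (m n1 n2 : nat) (A : 'M[{poly C}]_(m, n1))
    (B : 'M[{poly C}]_(m, n2)) : Prop :=
  forall D : 'M[{poly C}]_m, left_divisor D A -> left_divisor D B -> unimodular D.

Definition taylor_expansion0 (m n : nat) (f : C -> 'M[C]_(m, n))
    (a : nat -> 'M[C]_(m, n)) : Prop :=
  \forall z \near (0 : C), series (fun j => z ^+ j *: a j) @ \oo --> f z.

(* [Psi] is only used at indices 1, ..., p and [Theta] at 0, ..., q. *)
Definition ar_poly (m p : nat) (Psi : nat -> 'M[C]_m) : 'M[{poly C}]_m :=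
  1%:M - \sum_(1 <= k < p.+1) 'X^k *: constmxp (Psi k).

Definition ma_poly (m d q : nat) (Theta : nat -> 'M[C]_(m, d)) :
    'M[{poly C}]_(m, d) :=
  \sum_(0 <= k < q.+1) 'X^k *: constmxp (Theta k).

Definition reduced_ma_poly (m d q : nat) (Theta : nat -> 'M[C]_(m, d))
    (U : 'M[C]_d) (s : nat) : 'M[{poly C}]_(m, d) :=
  ma_poly q Theta *m constmxp (U ^t* *m pid_mx s).

Definition transfer_fun (m d : nat) (A : 'M[{poly C}]_m)
    (B : 'M[{poly C}]_(m, d)) (z : C) : 'M[C]_(m, d) :=
  invmx (evalmxp A z) *m evalmxp B z.

End MatrixPolynomials.

Section Processes.
Context {R : realType} {disp : measure_display} {T : measurableType disp}.
Variable P : probability T R.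
Local Notation C := (cplx R).

Definition iid (d : nat) (Z : int -> {RV P >-> 'cV[C]_d}) : Prop :=
  (forall (J : seq int) (B : int -> set 'cV[C]_d),
      uniq J -> (forall t, measurable (B t)) ->
      P (\bigcap_(t in [set t | t \in J]) (Z t @^-1` B t)) =
        (\prod_(t <- J) P (Z t @^-1` B t))%E) /\
  (forall (t u : int) (B : set 'cV[C]_d), measurable B ->
      distribution P (Z t) B = distribution P (Z u) B).

(* The vectors Y_(t_1), ..., Y_(t_n) are stacked as the columns of a matrix. *)
Definition joint (m n : nat) (Y : int -> {RV P >-> 'cV[C]_m})
    (t : 'I_n -> int) (w : T) : 'M[C]_(m, n) :=
  \matrix_(i, j) Y (t j) w i 0.

Definition strictly_stationary (m : nat) (Y : int -> {RV P >-> 'cV[C]_m}) :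
    Prop :=
  forall (n : nat) (t : 'I_n -> int) (h : int) (B : set 'M[C]_(m, n)),
    measurable B ->
    P (joint Y (fun j => t j + h) @^-1` B) = P (joint Y t @^-1` B).

Definition sigma_of (d : nat) (Z : int -> {RV P >-> 'cV[C]_d}) (J : set int) :
    set (set T) :=
  <<s \bigcup_(r in J) preimage_set_system setT (Z r) measurable >>.

Definition non_anticipative (d m : nat) (Z : int -> {RV P >-> 'cV[C]_d})
    (Y : int -> {RV P >-> 'cV[C]_m}) : Prop :=
  forall (t : int) (B : set 'cV[C]_m) (E : set T), measurable B ->
    sigma_of Z [set r | t < r] E ->
    P (Y t @^-1` B `&` E) = (P (Y t @^-1` B) * P E)%E.

Definition causal (d m : nat) (Z : int -> {RV P >-> 'cV[C]_d})
    (Y : int -> {RV P >-> 'cV[C]_m}) : Prop :=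
  forall (t : int) (B : set 'cV[C]_m), measurable B ->
    <<s sigma_of Z [set r | r <= t] `|` [set N | P.-negligible N] >>
      (Y t @^-1` B).

Definition arma_solution (m d p q : nat) (Psi : nat -> 'M[C]_m)
    (Theta : nat -> 'M[C]_(m, d)) (Z : int -> {RV P >-> 'cV[C]_d})
    (Y : int -> {RV P >-> 'cV[C]_m}) : Prop :=
  forall t : int, {ae P, forall w,
    Y t w - \sum_(1 <= k < p.+1) Psi k *m Y (t - k%:Z) w =
    \sum_(0 <= k < q.+1) Theta k *m Z (t - k%:Z) w}.

Definition degenerate_directions (d : nat) (Z0 : {RV P >-> 'cV[C]_d}) :
    set 'cV[C]_d :=
  [set a | exists c : borel_cplx R, forall B : set (borel_cplx R), measurable B ->
     pushforward P (fun w => (a ^t* *m Z0 w) 0 0 : borel_cplx R) B = \d_c B].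

End Processes.

(* Main.v *)
Require Import Defs.
From HB Require Import structures.
From mathcomp Require Import all_boot all_order all_algebra.
From mathcomp Require Import complex.
From mathcomp Require Import all_classical all_reals all_analysis.
From mathcomp Require Import measurable_realfun.
From mathcomp Require Import ring lra zify.

(** The three conditions are related in the order non-anticipative, stable with
    moments, causal, non-anticipative.

    Write [zeta t = U Z t]. Only its first [s] coordinates are random, so that
    up to a constant vector the equation is [P(B) Y = Qt(B) zeta], where [B] is
    the backward shift and a polynomial acts on a two-sided sequence by [pact].
    Left-coprimeness enters through a rank criterion ([left_coprime_kernel]): a
    row vector annihilating [P(z)] does not annihilate [Qt(z)].

    Let [Y] be a non-anticipative strictly stationary solution. By stationarity
    each [Y t] is tight, and by non-anticipation it stays so, uniformly, under
    conditioning on the noise after [t]; this property ([rtight]) survives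
    polynomial filters. Whenever [Y 0 = S n + R n], with [S n] a sum over the
    noise at times [- n < t <= 0] and [R n] a filter of what happens up to
    [- n], the maximal inequality of Ottaviani bounds the largest of
    [S 0, ..., S n] in probability, although nothing is known about the
    dependence between [Y] and the noise of the past.

    - A root of [\det P] on the unit circle would give such a decomposition
      with independent steps that are rotations of one nondegenerate variable;
      each long block of steps then makes a large excursion with the same
      positive probability, which contradicts the bound ([no_unit_root]).
    - Roots inside the unit disc are split off as a factor [u] and the remaining
      factor is inverted as a power series. Expanding [1 / u] at infinity writes
      [Y 0], up to an error that is small in probability, as a combination of
      past and future noise. Since [Y 0] is independent of the future noise, the
      coefficients of the latter vanish, for a variable with a nondegenerate
      independent summand cannot be independent of that summand
      ([independent_summand_degenerate]). Hence [u] divides [\adj P *m Qt],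
      which the rank criterion allows only if [u] is constant
      ([no_small_root]).
    - With all the roots outside the closed disc, the maximal inequality applied
      to the truncated series bounds all of its terms simultaneously, so the
      probabilities that the terms are large are summable. The Taylor
      coefficients satisfy a linear recursion once their index exceeds the
      degree of [\adj P *m Qt]; running it backwards, a large value of one term
      forces a large term far away, and the summable tails become logarithmic
      moments ([coefficient_log_moment]).

    Conversely, let [\det P] have no root in the closed disc. Past the degree of
    [Qt] the Taylor coefficients satisfy the homogeneous recursion of [P], so
    each term of the series is bounded by a geometric factor times the terms of
    a window of [p] consecutive indices ([stable_recursion_decay]). By the first
    Borel-Cantelli lemma logarithmic moments make that window grow slower than
    any exponential; the series converges almost surely and solves the equation
    ([solution_entry_equation]). It is a measurable functional of the past,
    which gives causality, and commutes with shifts, which gives stationarity.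

    Finally, a causal process is non-anticipative because disjoint blocks of an
    i.i.d. sequence generate independent sigma-algebras ([sigma_of_indep]). *)

Set Implicit Arguments.
Unset Strict Implicit.
Unset Printing Implicit Defensive.

Import Order.TTheory GRing.Theory Num.Theory.
Import numFieldNormedType.Exports.

Local Open Scope classical_set_scope.
Local Open Scope ring_scope.
Local Open Scope complex_scope.

(** * Complex modulus and measurability *)

Section Modulus.
Context {R : realType}.
Local Notation C := (cplx R).
Implicit Types z u : C.

Definition rep z : R := complex.Re z.
Definition imp z : R := complex.Im z.

(** The real-valued modulus; the norm of [C] itself takes its values in [C]. *)
Definition nm z : R := rep `|z|.

Lemma nmE z : (nm z)%:C = `|z| :> C.
Proof. by rewrite /nm /rep; apply: (@RRe_real R); apply: normr_real. Qed.

Lemma nm_ge0 z : 0 <= nm z.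
Proof. by rewrite -(@ler0c R) nmE. Qed.

Lemma nm_lt z (e : R) : (nm z < e) = (`|z| < e%:C :> C).
Proof. by rewrite -nmE (@ltcR R). Qed.

Lemma nm_le z (e : R) : (nm z <= e) = (`|z| <= e%:C :> C).
Proof. by rewrite -nmE (@lecR R). Qed.

Lemma nm0 : nm 0 = 0.
Proof. by rewrite /nm normr0. Qed.

Lemma nm1 : nm 1 = 1.
Proof. by rewrite /nm normr1. Qed.

Lemma nmD z u : nm (z + u) <= nm z + nm u.
Proof. by rewrite nm_le rmorphD /= !nmE ler_normD. Qed.

Lemma nmM z u : nm (z * u) = nm z * nm u.
Proof. by apply: (@complexI R); rewrite nmE rmorphM /= !nmE normrM. Qed.

Lemma nmN z : nm (- z) = nm z.
Proof. by rewrite /nm normrN. Qed.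

Lemma nmB z u : nm (z - u) <= nm z + nm u.
Proof. by rewrite -[nm u]nmN; exact: nmD. Qed.

Lemma nm_distC z u : nm (z - u) = nm (u - z).
Proof. by rewrite -nmN opprB. Qed.

Lemma nmX z n : nm (z ^+ n) = nm z ^+ n.
Proof. by elim: n => [|n ih]; rewrite ?expr0 ?nm1// !exprS nmM ih. Qed.

Lemma nmV z : nm (z^-1) = (nm z)^-1.
Proof.
have [->|z0] := eqVneq z 0; first by rewrite invr0 nm0 invr0.
have nz : nm z != 0.
  by apply: contra z0 => /eqP h; rewrite -normr_eq0 -nmE h.
by apply: (mulfI nz); rewrite -nmM !divff// nm1.
Qed.

Lemma nm_eq0 z : (nm z == 0) = (z == 0).
Proof.
apply/eqP/eqP => [h|->]; last exact: nm0.
by apply/eqP; rewrite -normr_eq0 -nmE h.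
Qed.

Lemma nm_gt0 z : (0 < nm z) = (z != 0).
Proof. by rewrite lt_neqAle nm_ge0 andbT eq_sym nm_eq0. Qed.

Lemma nm_sum (I : Type) (r : seq I) (Q : pred I) (F : I -> C) :
  nm (\sum_(i <- r | Q i) F i) <= \sum_(i <- r | Q i) nm (F i).
Proof.
elim/big_ind2 : _ => //; first by rewrite nm0.
by move=> x a y b xa yb; apply: le_trans (nmD _ _) _; apply: lerD.
Qed.

Lemma nm_real (x : R) : nm x%:C = `|x|.
Proof. by apply: (@complexI R); rewrite nmE (@normc_def R) /= expr0n addr0 sqrtr_sqr. Qed.

Lemma nm_sqr z : nm z ^+ 2 = rep z ^+ 2 + imp z ^+ 2.
Proof.
apply: (@complexI R).
by rewrite rmorphXn /= nmE (@add_Re2_Im2 R).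
Qed.

Lemma rep_le_nm z : `|rep z| <= nm z.
Proof.
rewrite -(@ler_sqr R) ?nnegrE ?nm_ge0//.
by rewrite nm_sqr real_normK ?num_real// lerDl sqr_ge0.
Qed.

Lemma imp_le_nm z : `|imp z| <= nm z.
Proof.
rewrite -(@ler_sqr R) ?nnegrE ?nm_ge0//.
by rewrite nm_sqr real_normK ?num_real// lerDr sqr_ge0.
Qed.

Lemma nm_le_rep_imp z : nm z <= `|rep z| + `|imp z|.
Proof.
rewrite -(@ler_sqr R) ?nnegrE ?nm_ge0 ?addr_ge0//.
rewrite nm_sqr sqrrD !real_normK ?num_real//.
by rewrite lerD2r lerDl mulrn_wge0// mulr_ge0.
Qed.

Lemma repD z u : rep (z + u) = rep z + rep u.
Proof. by case: z => a b; try case: u => c d. Qed.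
Lemma impD z u : imp (z + u) = imp z + imp u.
Proof. by case: z => a b; try case: u => c d. Qed.
Lemma repN z : rep (- z) = - rep z.
Proof. by case: z => a b; try case: u => c d. Qed.
Lemma impN z : imp (- z) = - imp z.
Proof. by case: z => a b; try case: u => c d. Qed.
Lemma repB z u : rep (z - u) = rep z - rep u.
Proof. by rewrite repD repN. Qed.
Lemma impB z u : imp (z - u) = imp z - imp u.
Proof. by rewrite impD impN. Qed.
Lemma repM z u : rep (z * u) = rep z * rep u - imp z * imp u.
Proof. by case: z => a b; case: u => c d. Qed.
Lemma impM z u : imp (z * u) = rep z * imp u + imp z * rep u.
Proof. by case: z => a b; case: u => c d. Qed.
Lemma rep_real (x : R) : rep x%:C = x. Proof. by []. Qed.
Lemma imp_real (x : R) : imp x%:C = 0. Proof. by []. Qed.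

Lemma cplx_eqP z u : rep z = rep u -> imp z = imp u -> z = u.
Proof. by case: z => a b; case: u => c d; rewrite /rep /imp /= => -> ->. Qed.

End Modulus.

Arguments cplx : simpl never.

Section Measurability.
Context {R : realType}.
Local Notation C := (cplx R).

Lemma mx_openP (m n : nat) (O : set 'M[C]_(m, n)) :
  open O <-> forall M, O M -> exists2 e : R, 0 < e &
    forall N : 'M[C]_(m, n), (forall i j, nm (M i j - N i j) < e) -> O N.
Proof.
rewrite openE; split => [oO M OM|h M OM].
  have /nbhs_ballP[e e0 eO] := oO M OM.
  have er : (e : C) \is Num.real by apply: gtr0_real.
  have eE : e = (complex.Re e)%:C by rewrite (RRe_real er).
  exists (complex.Re e); first by rewrite -(@ltcR R) -eE.
  move=> N MN; apply: eO; split => // i j; rewrite /ball /= eE -nm_lt.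
  exact: MN.
have [e e0 eO] := h M OM.
apply/nbhs_ballP; exists e%:C; first by rewrite /= (@ltcR R).
move=> N [_ MN]; apply: eO => i j.
by have := MN i j; rewrite /ball /= -nm_lt.
Qed.

Section fixed_space.
Context {d : measure_display} {W : measurableType d}.
Implicit Types f g : W -> C.

(** Stated on the real and imaginary parts, where the calculus of measurable
    real functions applies. *)
Definition cmeas f :=
  measurable_fun setT (rep \o f) /\ measurable_fun setT (imp \o f).

Lemma cmeas_cst (c : C) : cmeas (fun=> c).
Proof. by split; exact: measurable_cst. Qed.

Lemma cmeasD f g : cmeas f -> cmeas g -> cmeas (fun w => f w + g w).
Proof.
move=> [f1 f2] [g1 g2]; split.
  rewrite (_ : _ \o _ = (rep \o f) \+ (rep \o g)); first exact: measurable_funD.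
  by apply/funext => w; rewrite /= repD.
rewrite (_ : _ \o _ = (imp \o f) \+ (imp \o g)); first exact: measurable_funD.
by apply/funext => w; rewrite /= impD.
Qed.

Lemma cmeasM f g : cmeas f -> cmeas g -> cmeas (fun w => f w * g w).
Proof.
move=> [f1 f2] [g1 g2]; split.
  rewrite (_ : _ \o _ = ((rep \o f) \* (rep \o g)) \- ((imp \o f) \* (imp \o g))).
    by apply: measurable_funB; exact: measurable_funM.
  by apply/funext => w; rewrite /= repM.
rewrite (_ : _ \o _ = ((rep \o f) \* (imp \o g)) \+ ((imp \o f) \* (rep \o g))).
  by apply: measurable_funD; exact: measurable_funM.
by apply/funext => w; rewrite /= impM.
Qed.

Lemma cmeasZ (c : C) f : cmeas f -> cmeas (fun w => c * f w).
Proof. by move=> mf; apply: cmeasM => //; exact: cmeas_cst. Qed.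

Lemma cmeasB f g : cmeas f -> cmeas g -> cmeas (fun w => f w - g w).
Proof.
move=> mf mg; have := cmeasD mf (cmeasZ (-1) mg).
by under [X in cmeas X]eq_fun do rewrite mulN1r.
Qed.

Lemma cmeas_sum (I : Type) (r : seq I) (Q : pred I) (F : I -> W -> C) :
  (forall i, cmeas (F i)) -> cmeas (fun w => \sum_(i <- r | Q i) F i w).
Proof.
move=> mF; elim: r => [|i r ih].
  by under [X in cmeas X]eq_fun do rewrite big_nil; exact: cmeas_cst.
under [X in cmeas X]eq_fun do rewrite big_cons.
by case: (Q i) => //; exact: cmeasD.
Qed.

Lemma cmeas_nm f : cmeas f -> measurable_fun setT (nm \o f).
Proof.
move=> [f1 f2].
have -> : nm \o f = (@Num.sqrt R) \o (((rep \o f) \* (rep \o f)) \+ ((imp \o f) \* (imp \o f))).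
  apply/funext => w /=.
  by rewrite -!expr2 -nm_sqr sqrtr_sqr ger0_norm ?nm_ge0.
apply: measurableT_comp.
  by apply: continuous_measurable_fun; exact: sqrt_continuous.
by apply: measurable_funD; exact: measurable_funM.
Qed.

End fixed_space.

Lemma entry_measurable (m n : nat) (i : 'I_m) (j : 'I_n) :
  cmeas (fun M : 'M[C]_(m, n) => M i j).
Proof.
have key (h : C -> R) : (forall z u, `|h z - h u| <= nm (z - u)) ->
    measurable_fun setT (fun M : 'M[C]_(m, n) => h (M i j)).
  move=> hlip; apply: (measurability _ (RGenOInfty.measurableE R)) => //.
  move=> _ [_ [r ->] <-]; rewrite setTI.
  apply: sub_sigma_algebra; apply/mx_openP => M.
  rewrite /= in_itv /= andbT => rM; exists (h (M i j) - r).
    by rewrite subr_gt0.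
  move=> N /(_ i j) h1; rewrite /= in_itv /= andbT.
  have := le_lt_trans (hlip (M i j) (N i j)) h1.
  by rewrite ltr_norml => /andP[_]; lra.
split.
  by apply: (key rep) => z u; rewrite -repB rep_le_nm.
by apply: (key imp) => z u; rewrite -impB imp_le_nm.
Qed.

Lemma cmeas_entry d (W : measurableType d) (m n : nat) (X : W -> 'M[C]_(m, n)) i j :
  measurable_fun setT X -> cmeas (fun w => X w i j).
Proof.
move=> mX; have [h1 h2] := entry_measurable i j.
by split; [exact: (measurableT_comp h1 mX)|exact: (measurableT_comp h2 mX)].
Qed.

(** Every open set of matrices is the union of the countably many boxes with
    rational centers and radii [k.+1^-1] that it contains. *)
Lemma mx_measurable d (W : measurableType d) (m n : nat) (X : W -> 'M[C]_(m, n)) :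
  (forall i j, cmeas (fun w => X w i j)) -> measurable_fun setT X.
Proof.
move=> mX.
apply: (@measurability _ _ _ _ setT X (@open 'M[C]_(m, n))) => //.
move=> _ [V oV <-]; rewrite setTI.
pose I := ({ffun 'I_m * 'I_n -> rat * rat} * nat)%type.
pose box (q : I) : set 'M[C]_(m, n) := [set M | forall i j,
  `|rep (M i j) - ratr (q.1 (i, j)).1| < q.2.+1%:R^-1 /\
  `|imp (M i j) - ratr (q.1 (i, j)).2| < q.2.+1%:R^-1].
pose F (k : nat) : set W := if unpickle k is Some q then
  (if `[< box q `<=` V >] then X @^-1` box q else set0) else set0.
have -> : X @^-1` V = \bigcup_k F k.
  apply/seteqP; split => w /=.
    move=> VXw; have [ee ee0 eV] := (mx_openP V).1 oV _ VXw.
    have ee4 : 0 < ee / 4 by rewrite divr_gt0.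
    have [k _ /(_ k (leqnn k)) /= kee] := near_infty_natSinv_lt (PosNum ee4).
    have ratx (x : R) : exists q : rat, `|x - ratr q| < k.+1%:R^-1.
      have ek0 : 0 < k.+1%:R^-1 :> R by rewrite invr_gt0.
      move: (k.+1%:R^-1) ek0 => ek ek0.
      have [|q] := @rat_in_itvoo R (x - ek) (x + ek); first by lra.
      rewrite in_itv /= => /andP[q1 q2]; exists q.
      by rewrite ltr_norml; apply/andP; split; lra.
    have /choice[q1 q1P] : forall ij, exists q : rat, `|rep (X w ij.1 ij.2) - ratr q| < k.+1%:R^-1.
      by move=> ij; apply: ratx.
    have /choice[q2 q2P] : forall ij, exists q : rat, `|imp (X w ij.1 ij.2) - ratr q| < k.+1%:R^-1.
      by move=> ij; apply: ratx.
    pose q : I := ([ffun ij => (q1 ij, q2 ij)], k).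
    have bXw : box q (X w).
      by move=> i j; rewrite ffunE /=; split; [exact: (q1P (i, j))|exact: (q2P (i, j))].
    have bV : box q `<=` V.
      move=> N bN; apply: eV => i j.

      have [] := bN i j; have [] := bXw i j; rewrite ffunE /=.
      move: (k.+1%:R^-1) kee => ek kee.

      rewrite !ltr_norml => /andP[a1 a2] /andP[a3 a4] /andP[a5 a6] /andP[a7 a8].
      apply: le_lt_trans (nm_le_rep_imp _) _; rewrite repB impB.
      have : `|rep (X w i j) - rep (N i j)| < ee / 2 by rewrite ltr_norml; apply/andP; split; lra.
      have : `|imp (X w i j) - imp (N i j)| < ee / 2 by rewrite ltr_norml; apply/andP; split; lra.
      by lra.
    exists (pickle q) => //; rewrite /F pickleK.
    by case: asboolP.
  move=> [k _]; rewrite /F; case: (unpickle k) => // q.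
  by case: asboolP => // bV; exact: bV.
apply: bigcupT_measurable => k; rewrite /F.
case: (unpickle k) => // q; case: asboolP => // _.
have -> : X @^-1` box q = \bigcap_(ij in [set: 'I_m * 'I_n])
   ([set w | `|rep (X w ij.1 ij.2) - ratr (q.1 ij).1| < q.2.+1%:R^-1] `&`
    [set w | `|imp (X w ij.1 ij.2) - ratr (q.1 ij).2| < q.2.+1%:R^-1]).
  apply/seteqP; split => w /=.
    by move=> h [i j] _; exact: h.
  by move=> h i j; exact: (h (i, j) Logic.I).
apply: fin_bigcap_measurable => [|[i j] _] /=; first exact: finite_finset.

have [h1 h2] := mX i j.
have aux (h : W -> R) (c e : R) : measurable_fun setT h ->
    measurable [set w | `|h w - c| < e].
  move=> mh.
  have -> : [set w | `|h w - c| < e] = setT `&` (fun w => `|h w - c|) @^-1` `]-oo, e[%classic.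
    by rewrite setTI; apply/seteqP; split => w /=; rewrite in_itv.
  suff : measurable_fun setT (fun w => `|h w - c|) by apply.
  apply: measurableT_comp => //; apply: measurable_funB => //.
by apply: measurableI; apply: aux.
Qed.

End Measurability.

(** * Sigma-algebras of an i.i.d. sequence *)

Section Cylinders.
Context {d : measure_display} {V : measurableType d} {W : pointedType}.
Implicit Types (X : int -> W -> V) (J : set int).

Definition sig X J : set (set W) :=
  <<s \bigcup_(r in J) preimage_set_system setT (X r) measurable >>.

Definition cyl X J : set (set W) := [set E | exists s : seq int,
  exists B : int -> set V, [/\ uniq s, (forall t, t \in s -> J t),
    (forall t, measurable (B t))
    & E = \bigcap_(t in [set t | t \in s]) X t @^-1` B t]].

(** Cylinders over finitely many coordinates form a pi-system, which makes them
    the starting point of Dynkin's argument for [sig]. *)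
Lemma cyl_setI X J : setI_closed (cyl X J).
Proof.
move=> E1 E2 [s1 [B1 [u1 J1 m1 ->]]] [s2 [B2 [u2 J2 m2 ->]]].
exists (undup (s1 ++ s2)).
exists (fun t => (if t \in s1 then B1 t else setT) `&` (if t \in s2 then B2 t else setT)).
split => [||t|].
- exact: undup_uniq.
- by move=> t; rewrite mem_undup mem_cat => /orP[/J1|/J2].
- by apply: measurableI; case: ifP.
apply/seteqP; split => w /=.
  move=> [h1 h2] t _ /=; split; case: ifP => // ts; [exact: h1|exact: h2].
move=> h; split => t /= ts.
  by have := h t; rewrite /= mem_undup mem_cat ts /= => /(_ isT) [].
by have := h t; rewrite /= mem_undup mem_cat ts /= orbT => /(_ isT) [].
Qed.

Lemma sig_preimage X J r B : J r -> measurable B -> sig X J (X r @^-1` B).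
Proof.
move=> Jr mB; apply: sub_sigma_algebra; exists r => //.
by exists B => //; rewrite setTI.
Qed.

Lemma sigI X J A B : sig X J A -> sig X J B -> sig X J (A `&` B).
Proof.
move=> hA hB.
exact: (@measurableI _ (g_sigma_algebraType
  (\bigcup_(r in J) preimage_set_system setT (X r) measurable))).
Qed.

Lemma sig_cyl X J : sig X J = <<s cyl X J >>.
Proof.
apply/seteqP; split.
  apply: smallest_sub; first exact: smallest_sigma_algebra.
  move=> _ [r Jr [B mB <-]]; apply: sub_sigma_algebra.
  exists [:: r], (fun=> B); split => //.
    by move=> t; rewrite inE => /eqP ->.
  rewrite setTI; apply/seteqP; split => w /=.
    by move=> h t /=; rewrite inE => /eqP ->.
  by move=> /(_ r); rewrite /= inE eqxx; apply.
apply: smallest_sub; first exact: smallest_sigma_algebra.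
move=> _ [s [B [_ sJ mB ->]]].
elim: s sJ => [|t s ih] sJ.
  rewrite (_ : \bigcap_(t in _) _ = setT).
    exact: (@measurableT _ (g_sigma_algebraType _)).
  by apply/seteqP; split => w //= _ t.
rewrite (_ : \bigcap_(t in _) _ = X t @^-1` B t `&`
   \bigcap_(t in [set t | t \in s]) X t @^-1` B t).
  apply: sigI; last by apply: ih => u us; apply: sJ; rewrite inE us orbT.
  by apply: sig_preimage => //; apply: sJ; rewrite inE eqxx.
apply/seteqP; split => w /=.
  move=> h; split; first by apply: h; rewrite /= inE eqxx.
  by move=> u /= us; apply: h; rewrite /= inE us orbT.
by move=> [h1 h2] u /=; rewrite inE => /orP[/eqP ->//|]; exact: h2.
Qed.

Lemma sig_sub X J J' : J `<=` J' -> sig X J `<=` sig X J'.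
Proof.
move=> JJ'; apply: sub_sigma_algebra2 => E [r Jr h]; exists r => //.
exact: JJ'.
Qed.

End Cylinders.

Lemma dynkin_sub (W : Type) (G Q : set (set W)) :
  setI_closed G -> dynkin Q -> G `<=` Q -> <<s G >> `<=` Q.
Proof.
move=> GI dQ GQ; apply: lambda_system_subset => //.
exact/dynkin_lambda_system.
Qed.

Section Prob.
Context {R : realType} {disp : measure_display} {T : measurableType disp}.
Variable P : probability T R.

(** Real-valued, so that linear arithmetic applies to probabilities. *)
Definition pr (A : set T) : R := fine (P A).

Lemma prE A : measurable A -> (pr A)%:E = P A.
Proof. by move=> mA; rewrite /pr fineK// fin_num_measure. Qed.

Lemma pr_ge0 A : 0 <= pr A.
Proof. exact: fine_ge0. Qed.

Lemma pr_setT : pr setT = 1.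
Proof. by rewrite /pr probability_setT. Qed.

Lemma pr_set0 : pr set0 = 0.
Proof. by rewrite /pr measure0. Qed.

Lemma le_pr A B : measurable A -> measurable B -> A `<=` B -> pr A <= pr B.
Proof.
by move=> mA mB AB; rewrite -lee_fin !prE//; apply: le_measure; rewrite ?inE.
Qed.

Lemma pr_le1 A : measurable A -> pr A <= 1.
Proof. by move=> mA; rewrite -pr_setT; apply: le_pr. Qed.

Lemma prU_le A B : measurable A -> measurable B -> pr (A `|` B) <= pr A + pr B.
Proof.
move=> mA mB; rewrite -lee_fin EFinD !prE//; last exact: measurableU.
exact: measureU2.
Qed.

Lemma prDI A B : measurable A -> measurable B -> pr A = pr (A `\` B) + pr (A `&` B).
Proof.
move=> mA mB; apply: EFin_inj; rewrite EFinD !prE//.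
- exact: measureDI.
- exact: measurableI.
- exact: measurableD.
Qed.

Lemma prC A : measurable A -> pr (~` A) = 1 - pr A.
Proof.
move=> mA; have := prDI measurableT mA; rewrite pr_setT setTD setTI.
by move=> ->; ring.
Qed.

Lemma dynkin_indep (F : set T) : measurable F ->
  dynkin [set E | measurable E /\ pr (E `&` F) = pr E * pr F].
Proof.
move=> mF; split => [|E [mE hE]|E tE hE].
- by split => //; rewrite setTI pr_setT mul1r.
- split; first exact: measurableC.
  have := prDI mF mE; rewrite [F `&` E]setIC hE prC// [_ `&` F]setIC -setDE.
  by move=> h; rewrite mulrBl mul1r; lra.

have mE n : measurable (E n) by have [] := hE n.
have mEF n : measurable (E n `&` F) by apply: measurableI.
split; first exact: bigcupT_measurable.
apply: EFin_inj; rewrite EFinM !prE//; last 2 first.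
- exact: bigcupT_measurable.
- by apply: measurableI => //; exact: bigcupT_measurable.
rewrite setI_bigcupl measure_semi_bigcup//; last 2 first.
- apply/trivIsetP => i j _ _ ij; move/trivIsetP : tE => /(_ i j Logic.I Logic.I ij).
  by rewrite setIACA setIid => ->; rewrite set0I.
- by rewrite -setI_bigcupl; apply: measurableI => //; exact: bigcupT_measurable.
rewrite measure_semi_bigcup//; last exact: bigcupT_measurable.
rewrite -(prE mF) muleC -nneseriesZl//.
apply: eq_eseriesr => n _; have [_ h] := hE n.
by rewrite /= -(prE (mE n)) -(prE (mEF n)) h mulrC EFinM.
Qed.

End Prob.

Section Iid.
Context {R : realType} {disp : measure_display} {T : measurableType disp}.
Variable P : probability T R.
Local Notation C := (cplx R).
Variables (d : nat) (Z : int -> {RV P >-> 'cV[C]_d}).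
Hypothesis hZ : iid Z.
Implicit Types (J : set int).

Let Zf : int -> T -> 'cV[C]_d := fun t => Z t.

Lemma sigma_ofE J : sigma_of Z J = sig Zf J.
Proof. by []. Qed.

Lemma sigma_of_measurable J E : sigma_of Z J E -> measurable E.
Proof.
suff: sigma_of Z J `<=` @measurable _ T by apply.
apply: smallest_sub; first exact: (@sigma_algebra_measurable _ T).

move=> _ [r _ [B mB <-]]; rewrite setTI; exact: measurable_funPTI.
Qed.

Lemma iid_cylinder (s : seq int) (B : int -> set 'cV[C]_d) :
  uniq s -> (forall t, measurable (B t)) ->
  pr P (\bigcap_(t in [set t | t \in s]) Z t @^-1` B t) =
  \prod_(t <- s) pr P (Z t @^-1` B t).
Proof.
move=> us mB; rewrite /pr (proj1 hZ)//.
elim: s {us} => [|t s ih]; first by rewrite !big_nil.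
rewrite !big_cons -ih fineM//.
  by apply: fin_num_measure; exact: measurable_funPTI.
elim: s {ih} => [|u s ih]; first by rewrite big_nil.
rewrite big_cons fin_numM// fin_num_measure//.
exact: measurable_funPTI.
Qed.

(** Disjoint blocks of an i.i.d. sequence generate independent sigma-algebras:
    the product rule extends from finite cylinders, one side at a time, by
    Dynkin's theorem. *)
Lemma sigma_of_indep J1 J2 E1 E2 : J1 `&` J2 = set0 ->
  sigma_of Z J1 E1 -> sigma_of Z J2 E2 ->
  pr P (E1 `&` E2) = pr P E1 * pr P E2.
Proof.
move=> J12; rewrite !sigma_ofE.
have cyl_meas J E : cyl Zf J E -> measurable E.
  move=> h; apply: (@sigma_of_measurable J).
  by rewrite sigma_ofE sig_cyl; exact: sub_sigma_algebra.
have step F : measurable F ->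
    (forall E, cyl Zf J1 E -> pr P (E `&` F) = pr P E * pr P F) ->
    forall E, sig Zf J1 E -> pr P (E `&` F) = pr P E * pr P F.
  move=> mF hc E; rewrite sig_cyl => sE.
  have h := dynkin_sub (@cyl_setI _ _ _ Zf J1) (dynkin_indep P mF).
  have [] // := h _ E sE.
  by move=> A cA; split; [exact: cyl_meas cA|exact: hc].
move=> s1 s2; apply: step => //.
  by apply: (@sigma_of_measurable J2).
move=> E c1; rewrite setIC mulrC; move: E2 s2; rewrite sig_cyl => E2 s2.
have mE : measurable E by exact: cyl_meas c1.
have h := dynkin_sub (@cyl_setI _ _ _ Zf J2) (dynkin_indep P mE).
have [] // := h _ E2 s2.

move=> F c2; split; first exact: cyl_meas c2.
case: c1 => s [B [us sJ mB ->]]; case: c2 => u [B' [uu uJ mB' ->]].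
have dj t : t \in s -> t \in u -> False.
  by move=> /sJ h1 /uJ h2; have : (J1 `&` J2) t by []; rewrite J12.
pose D t := if t \in u then B' t else B t.
have -> : \bigcap_(t in [set t | t \in u]) Zf t @^-1` B' t =
    \bigcap_(t in [set t | t \in u]) Z t @^-1` D t.
  by apply: eq_bigcapr => t /= tu; rewrite /D tu.
have Ds t : t \in s -> D t = B t.
  by rewrite /D => ts; case: ifP => // /(dj _ ts).
have -> : \bigcap_(t in [set t | t \in s]) Zf t @^-1` B t =
    \bigcap_(t in [set t | t \in s]) Z t @^-1` D t.
  by apply: eq_bigcapr => t /= ts; rewrite Ds.
have mD t : measurable (D t) by rewrite /D; case: ifP.
rewrite (_ : _ `&` _ = \bigcap_(t in [set t | t \in u ++ s]) Z t @^-1` D t).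
  rewrite !iid_cylinder// ?big_cat// cat_uniq uu us andbT /=.
  by apply/hasPn => t ts; apply/negP => /(dj _ ts).
apply/seteqP; split => w /=.
  by move=> [h1 h2] t /=; rewrite mem_cat => /orP[]; [exact: h1|exact: h2].
by move=> h3; split => t /= tt; apply: h3; rewrite /= mem_cat tt ?orbT.
Qed.

Lemma iid_marginal t u (B : set 'cV[C]_d) : measurable B ->
  pr P (Z t @^-1` B) = pr P (Z u @^-1` B).
Proof.
by move=> mB; have := proj2 hZ t u B mB; rewrite /distribution /pushforward /pr => ->.
Qed.

(** Invariance need only be checked on cylinders, where the product formula and
    the common marginal law give it. *)
Lemma iid_shift (h : int) (E : set (int -> 'cV[C]_d)) :
  sig (fun (t : int) (x : int -> 'cV[C]_d) => x t) setT E ->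
  measurable [set w | E (fun t => Z (t + h) w)] /\
  pr P [set w | E (fun t => Z (t + h) w)] = pr P [set w | E (fun t => Z t w)].
Proof.
set X := fun (t : int) (x : int -> 'cV[C]_d) => x t.
suff: sig X setT `<=` [set E |
    [/\ measurable [set w | E (fun t => Z (t + h) w)],
        measurable [set w | E (fun t => Z t w)] &
    pr P [set w | E (fun t => Z (t + h) w)] = pr P [set w | E (fun t => Z t w)]]].
  by move=> + sE => /(_ _ sE)[].
rewrite sig_cyl; apply: dynkin_sub; first exact: cyl_setI.
- split => [|E0 [m1 m2 e]|E0 tE hE].
  + by split => //; exact: measurableT.
  + split; [exact: measurableC|exact: measurableC|].
    by rewrite (prC _ m1) (prC _ m2) e.
  + have m1 n : measurable [set w | E0 n (fun t => Z (t + h) w)] by have [] := hE n.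
    have m2 n : measurable [set w | E0 n (fun t => Z t w)] by have [] := hE n.
    split; [exact: bigcupT_measurable|exact: bigcupT_measurable|].
    have triv (g : T -> int -> 'cV[C]_d) :
        trivIset setT (fun n => [set w | E0 n (g w)]).
      apply/trivIsetP => i j _ _ ij; move/trivIsetP : tE => /(_ i j Logic.I Logic.I ij).
      move=> e; apply/seteqP; split => w //= [a b].
      by have : (E0 i `&` E0 j) (g w) by []; rewrite e.
    congr fine.
    transitivity (P (\bigcup_n [set w | E0 n (fun t => Z (t + h) w)])); first by [].
    transitivity (P (\bigcup_n [set w | E0 n (fun t => Z t w)])); last by [].
    rewrite !measure_semi_bigcup//; try exact: bigcupT_measurable; try exact: triv.
    apply: eq_eseriesr => n _; have [_ _ e] := hE n.
    by rewrite /= -!prE// e.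
- move=> _ [s [B [us _ mB ->]]].
  have e1 : [set w | (\bigcap_(t in [set t | t \in s]) X t @^-1` B t)
      (fun t => Z (t + h) w)] =
      \bigcap_(t in [set t | t \in map (fun t => t + h) s]) Z t @^-1` B (t - h).
    apply/seteqP; split => w /= hw t /=.
      by move=> /mapP[u us' ->]; rewrite addrK; apply: hw.
    by move=> ts; have := hw (t + h); rewrite /= addrK; apply; exact: map_f.
  have e2 : [set w | (\bigcap_(t in [set t | t \in s]) X t @^-1` B t)
      (fun t => Z t w)] = \bigcap_(t in [set t | t \in s]) Z t @^-1` B t by [].
  rewrite /= e1 e2.
  have mc (u : seq int) (D : int -> set 'cV[C]_d) : (forall t, measurable (D t)) ->
      measurable (\bigcap_(t in [set t | t \in u]) Z t @^-1` D t).
    move=> mD; apply: fin_bigcap_measurable; first exact: finite_seq.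
    by move=> t _; exact: measurable_funPTI.
  split; [exact: mc|exact: mc|].
  rewrite !iid_cylinder//; last by rewrite map_inj_uniq//; exact: addIr.
  rewrite big_map; apply: eq_bigr => t _.
  by rewrite addrK; exact: iid_marginal.
Qed.

End Iid.

(** * Polynomials in the backward shift *)

Section PolyAction.
Context {F : fieldType}.
Implicit Types (a b : {poly F}) (f g : int -> F) (t : int).

(** A polynomial acts on two-sided sequences through the backward shift. *)
Definition pact a f t : F := \sum_(k < size a) a`_k * f (t - k%:Z).

Lemma pact_wide N a f t : (size a <= N)%N ->
  pact a f t = \sum_(k < N) a`_k * f (t - k%:Z).
Proof.
move=> aN; rewrite /pact (big_ord_widen N (fun k => a`_k * f (t - k%:Z)) aN).
rewrite big_mkcond; apply: eq_bigr => k _; case: ltnP => // ak.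
by rewrite nth_default// mul0r.
Qed.

Lemma pactD a b f t : pact (a + b) f t = pact a f t + pact b f t.
Proof.
pose N := maxn (size a) (size b).
rewrite (@pact_wide N (a + b)) ?size_polyD// (@pact_wide N a) ?leq_maxl//.
rewrite (@pact_wide N b) ?leq_maxr// -big_split /=.
by apply: eq_bigr => k _; rewrite coefD mulrDl.
Qed.

Lemma pactC (c : F) f t : pact c%:P f t = c * f t.
Proof.
rewrite (@pact_wide 1) ?size_polyC ?leq_b1// big_ord1.
by rewrite coefC eqxx subr0.
Qed.

Lemma pact0 f t : pact 0 f t = 0.
Proof. by rewrite -polyC0 pactC mul0r. Qed.

Lemma pact1 f t : pact 1 f t = f t.
Proof. by rewrite -polyC1 pactC mul1r. Qed.

Lemma pactMX a f t : pact (a * 'X) f t = pact a f (t - 1).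
Proof.
rewrite (@pact_wide (size a).+1); last first.
  by rewrite (leq_trans (size_polyMleq _ _))// size_polyX addnC.
rewrite big_ord_recl coefMX eqxx mul0r add0r; apply: eq_bigr => k _.
rewrite coefMX /=; congr (_ * f _); rewrite /bump /=; lia.
Qed.

Lemma pactZ (c : F) a f t : pact (c *: a) f t = c * pact a f t.
Proof.
rewrite (@pact_wide (size a) (c *: a)) ?size_scale_leq// mulr_sumr.
by apply: eq_bigr => k _; rewrite coefZ mulrA.
Qed.

Lemma pactM a b f t : pact (a * b) f t = pact a (pact b f) t.
Proof.
elim/poly_ind: a t => [|a c ih] t; first by rewrite mul0r !pact0.
rewrite mulrDl !pactD [a * 'X * b]mulrAC !pactMX ih; congr (_ + _).
by rewrite mul_polyC pactZ pactC.
Qed.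

Lemma pactN a f t : pact (- a) f t = - pact a f t.
Proof. by rewrite -scaleN1r pactZ mulN1r. Qed.

Lemma pactB a b f t : pact (a - b) f t = pact a f t - pact b f t.
Proof. by rewrite pactD pactN. Qed.

Lemma pact_suml (I : Type) (r : seq I) (A : I -> {poly F}) f t :
  pact (\sum_(i <- r) A i) f t = \sum_(i <- r) pact (A i) f t.
Proof.
elim: r => [|i r ih]; first by rewrite !big_nil pact0.
by rewrite !big_cons pactD ih.
Qed.

Lemma pactXn n f t : pact 'X^n f t = f (t - n%:Z).
Proof.
elim: n t => [|n ih] t; first by rewrite expr0 pact1 subr0.
by rewrite exprSr pactMX ih; congr f; lia.
Qed.

Lemma pact_eq a f g t : (forall u, f u = g u) -> pact a f t = pact a g t.
Proof. by move=> fg; apply: eq_bigr => k _; rewrite fg. Qed.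

Lemma pactDr a f g t : pact a (fun u => f u + g u) t = pact a f t + pact a g t.
Proof. by rewrite -big_split; apply: eq_bigr => k _; rewrite mulrDr. Qed.

Lemma pact_sumr a (I : Type) (r : seq I) (G : I -> int -> F) t :
  pact a (fun u => \sum_(i <- r) G i u) t = \sum_(i <- r) pact a (G i) t.
Proof.
by rewrite exchange_big; apply: eq_bigr => k _; rewrite mulr_sumr.
Qed.

Lemma pact_cst a (c : F) t : pact a (fun=> c) t = a.[1] * c.
Proof.
rewrite horner_coef mulr_suml; apply: eq_bigr => k _.
by rewrite expr1n mulr1.
Qed.

(** Used to single out the noise at one time, which is independent of the rest. *)
Lemma pact_mask a f t u : (u <= t)%R ->
  pact a f t = a`_(`|t - u|%N) * f u +
    pact a (fun v => if v == u then 0 else f v) t.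
Proof.
move=> ut; pose N := maxn (size a) (`|t - u|%N).+1.
rewrite !(@pact_wide N) ?leq_maxl//.
have hN : (`|t - u|%N < N)%N by rewrite leq_max leqnn orbT.
rewrite (bigD1 (Ordinal hN)) //= [in RHS](bigD1 (Ordinal hN)) //=.
have -> : t - `|t - u|%N%:Z = u by lia.
rewrite eqxx mulr0 add0r; congr (_ + _); apply: eq_bigr => k kN.
case: eqP => // e; exfalso; move/eqP: kN; apply; apply: val_inj => /=; lia.
Qed.

Lemma pact_mask_lt a f t u : (t < u)%R ->
  pact a (fun v => if v == u then 0 else f v) t = pact a f t.
Proof.
move=> tu; apply: eq_bigr => k _; case: eqP => // e; exfalso; lia.
Qed.

End PolyAction.

(** * Power series and expansions at infinity *)

Section Expansions.
Context {R : realType}.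
Local Notation C := (cplx R).

Lemma geometric_sum_le (r : R) k : 0 <= r < 1 -> \sum_(l < k) r ^+ l <= (1 - r)^-1.
Proof.
move=> /andP[r0 r1]; rewrite -[leRHS]mul1r ler_pdivlMr ?subr_gt0// mulrC.
have -> : (1 - r) * (\sum_(l < k) r ^+ l) = 1 - r ^+ k.
  elim: k => [|k ih]; first by rewrite big_ord0 expr0 subrr mulr0.
  by rewrite big_ord_recr /= mulrDr ih exprS; ring.
by rewrite gerBl exprn_ge0.
Qed.

Lemma geometric_recursion (b : nat -> R) (rho0 rho K : R) :
  0 <= rho0 -> rho0 < rho -> (forall n, 0 <= b n) ->
  (forall n, b n.+1 <= rho0 * b n + K * rho ^+ n) ->
  exists2 K', 0 <= K' & forall n, b n <= K' * rho ^+ n.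
Proof.
move=> r0 r1 b0 hb; have d0 : 0 < rho - rho0 by lra.
have rp : 0 < rho by lra.
exists (b 0%N + `|K| / (rho - rho0)).
  by rewrite addr_ge0// divr_ge0// ltW.
elim=> [|n ih].
  by rewrite expr0 mulr1 lerDl divr_ge0// ltW.
apply: le_trans (hb n) _.
apply: (@le_trans _ _ (rho0 * ((b 0%N + `|K| / (rho - rho0)) * rho ^+ n) + `|K| * rho ^+ n)).
  by rewrite lerD// ?ler_wpM2l// ler_wpM2r ?ler_norm// exprn_ge0// ltW.
rewrite exprS mulrA -mulrDl mulrA [_ * rho]mulrC.
rewrite ler_wpM2r ?exprn_ge0 ?(ltW rp)//.
have hK : `|K| = (rho - rho0) * (`|K| / (rho - rho0)).
  by rewrite mulrCA divff ?mulr1// gt_eqF.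
move: (`|K| / (rho - rho0)) hK => q ->.
have := b0 0%N; nra.
Qed.

(** Power series inverses are expressed through truncations, without formal
    power series. *)
Definition series_inverse (al : {poly C}) (a : nat -> C) :=
  forall N n, (n < N)%N -> (al * \poly_(i < N) a i)`_n = (n == 0%N)%:R.

Lemma coefM_low (r p q : {poly C}) n : (forall i, (i <= n)%N -> p`_i = q`_i) ->
  (r * p)`_n = (r * q)`_n.
Proof.
by move=> pq; rewrite !coefM; apply: eq_bigr => i _; rewrite pq// leq_subr.
Qed.

(** Inverting the factors one at a time turns into the first order recursion
    [a n.+1 = l * a n + a1 n.+1], which preserves geometric decay. *)
Lemma stable_inverse_aux (rs : seq C) (rho0 rho : R) :
  0 <= rho0 -> rho0 < rho -> (forall l, l \in rs -> nm l <= rho0) ->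
  exists a : nat -> C, (exists2 K, 0 <= K & forall n, nm (a n) <= K * rho ^+ n) /\
    series_inverse (\prod_(l <- rs) (1 - l *: 'X)) a.
Proof.
move=> r0 r1; elim: rs => [|l rs ih] hrs.
  exists (fun n => (n == 0%N)%:R); split.
    exists 1 => // n; case: n => [|n] /=; first by rewrite expr0 nm1 mulr1.
    by rewrite nm0 mul1r exprn_ge0// (le_trans r0)// ltW.
  by move=> N n nN; rewrite big_nil mul1r coef_poly nN.
have [|a1 [[K1 K10 hK1] inv1]] := ih.
  by move=> z zs; apply: hrs; rewrite inE zs orbT.
pose a := fix a n := if n is k.+1 then l * a k + a1 k.+1 else a1 0%N.
exists a; split.
  apply: (@geometric_recursion (fun n => nm (a n)) rho0 rho (K1 * rho)) => // [n|n].
    exact: nm_ge0.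
  rewrite /=; apply: le_trans (nmD _ _) _; apply: lerD.
    by rewrite nmM ler_wpM2r ?nm_ge0// hrs// inE eqxx.
  by rewrite -mulrA -exprS.
move=> N n nN; rewrite big_cons [_ * \prod_(_ <- _) _]mulrC -mulrA.
rewrite (@coefM_low _ _ (\poly_(i < N) a1 i)) ?inv1// => i ni.
rewrite mulrBl mul1r -scalerAl coefB coefZ coefXM !coef_poly.
have iN : (i < N)%N by apply: leq_ltn_trans nN.
rewrite iN; case: i ni iN => [|i] ni iN /=; first by rewrite mulr0 subr0.
by rewrite (ltnW iN) addrAC subrr add0r.
Qed.

Lemma max_modulus (rs : seq C) : (forall l, l \in rs -> nm l < 1) ->
  exists rho0 : R, [/\ 0 <= rho0, rho0 < 1 & forall l, l \in rs -> nm l <= rho0].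
Proof.
elim: rs => [|l rs ih] h; first by exists 0.
have [|r [r0 r1 hr]] := ih; first by move=> z zs; apply: h; rewrite inE zs orbT.
exists (Num.max r (nm l)); split; first by rewrite le_max r0.
  by rewrite gt_max r1 h// inE eqxx.
by move=> z; rewrite inE le_max => /orP[/eqP->|/hr ->//]; rewrite lexx orbT.
Qed.

Lemma stable_inverse (rs : seq C) : (forall l, l \in rs -> nm l < 1) ->
  exists (a : nat -> C) (K rho : R), [/\ 0 <= K, 0 < rho < 1,
    (forall n, nm (a n) <= K * rho ^+ n) &
    series_inverse (\prod_(l <- rs) (1 - l *: 'X)) a].
Proof.
move=> /max_modulus[r0 [r00 r01 hr]].
have [|a [[K K0 hK] inv]] := @stable_inverse_aux rs r0 ((1 + r0) / 2) r00 _ hr.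
  by lra.
by exists a, K, ((1 + r0) / 2); split => //; apply/andP; split; lra.
Qed.

(** Adding a root [z] to the product [u1] changes the remainder of ['X^M] by
    [b M *: u1], where [b M] is the value at [z] of the former quotient. The
    numbers [b M] satisfy a first order recursion with factor [z]. *)
Lemma unstable_rem_aux (zs : seq C) (rho0 rho : R) :
  0 <= rho0 -> rho0 < rho -> (forall l, l \in zs -> nm l <= rho0) ->
  exists2 K, 0 <= K & forall M i,
    nm ('X^M %% \prod_(z <- zs) ('X - z%:P))`_i <= K * rho ^+ M.
Proof.
move=> r0 r1; elim: zs => [|z zs ih] hzs.
  exists 0 => // M i; rewrite big_nil modp1 coef0 nm0 mul0r.
  by [].
have [|K1 K10 hK1] := ih.
  by move=> l ls; apply: hzs; rewrite inE ls orbT.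
rewrite big_cons; set u1 := \prod_(_ <- _) _ in hK1 *.
have mu1 : u1 \is monic by apply: monic_prod_XsubC.
have u1n0 : u1 != 0 by apply: monic_neq0.
pose b M := ('X^M %/ u1).[z].
have bS M : b M.+1 = z * b M + ('X * ('X^M %% u1))`_(size u1).-1.
  set c := _`_ _.
  pose rm : {poly C} := 'X * ('X^M %% u1) - c *: u1.
  have sz : (size rm < size u1)%N.
    rewrite /rm -(prednK (n := size u1)) ?size_poly_gt0//.
    rewrite ltnS; apply/leq_sizeP => j.
    rewrite leq_eqVlt => /orP[/eqP<-|hj].
      by rewrite coefB coefZ -/c -[u1`_ _]/(lead_coef u1) (monicP mu1) mulr1 subrr.
    rewrite coefB coefZ coefXM (nth_default 0 (s := u1)) ?mulr0 ?subr0; last first.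
      by rewrite -(prednK (n := size u1)) ?size_poly_gt0.
    case: j hj => //= j hj; rewrite nth_default//.
    have : (size ('X^M %% u1)%R < size u1)%N by rewrite ltn_modp.
    by move: hj; case: (size u1) => //= n; rewrite !ltnS => hj hs; exact: leq_trans hs hj.

  have e : 'X^(M.+1) = ('X * ('X^M %/ u1) + c%:P) * u1 +
      ('X * ('X^M %% u1) - c *: u1) :> {poly C}.
    by rewrite exprS {1}(divp_eq 'X^M u1) -mul_polyC; ring.
  by rewrite /b -(divpP e sz) hornerD hornerM hornerX hornerC.
have remE M : 'X^M %% (('X - z%:P) * u1) = b M *: u1 + 'X^M %% u1.
  have [B hB] : exists B, 'X^M %/ u1 - (b M)%:P = B * ('X - z%:P).
    by apply/factor_theorem; rewrite /root hornerD hornerN hornerC subrr.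
  have e : 'X^M = B * (('X - z%:P) * u1) + (b M *: u1 + 'X^M %% u1).
    by rewrite mulrA -hB {1}(divp_eq 'X^M u1) -mul_polyC; ring.
  rewrite -(modpP e)// size_monicM
 ?monicXsubC// size_XsubC /=.
  rewrite ltnS (leq_trans (size_polyD _ _))// geq_max.
  by rewrite size_scale_leq ltnW// ltn_modp.

have [||Kb Kb0 hKb] := @geometric_recursion (fun n => nm (b n)) rho0 rho K1 r0 r1.
- by move=> n; exact: nm_ge0.
- move=> n; rewrite bS; apply: le_trans (nmD _ _) _; apply: lerD.
    by rewrite nmM ler_wpM2r ?nm_ge0// hzs// inE eqxx.
  rewrite coefXM; case: eqP => _; last exact: hK1.
  by rewrite nm0 mulr_ge0// exprn_ge0// (le_trans r0)// ltW.
pose S := \sum_(i < size u1) nm u1`_i.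
have S0 : 0 <= S by apply: sumr_ge0 => i _; exact: nm_ge0.
exists (Kb * S + K1); first by rewrite addr_ge0// mulr_ge0.
move=> M i; rewrite remE coefD coefZ mulrDl; apply: le_trans (nmD _ _) _.
apply: lerD => //; rewrite nmM -mulrA [S * _]mulrC mulrA.
apply: ler_pM => //; rewrite ?nm_ge0//.
have [iu|iu] := ltnP i (size u1); last by rewrite nth_default// nm0.
rewrite /S (bigD1 (Ordinal iu)) //= lerDl.
by apply: sumr_ge0 => j _; exact: nm_ge0.
Qed.

(** Division of ['X^M] by a polynomial whose roots lie in the open unit disc
    expands its inverse at infinity; the remainder vanishes geometrically. *)
Lemma unstable_rem (zs : seq C) : (forall l, l \in zs -> nm l < 1) ->
  exists (K rho : R), [/\ 0 <= K, 0 < rho < 1 & forall M i,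
    nm ('X^M %% \prod_(z <- zs) ('X - z%:P))`_i <= K * rho ^+ M].
Proof.
move=> /max_modulus[r0 [r00 r01 hr]].
have [|K K0 hK] := @unstable_rem_aux zs r0 ((1 + r0) / 2) r00 _ hr; first by lra.
by exists K, ((1 + r0) / 2); split => //; apply/andP; split; lra.
Qed.

End Expansions.

Section SeriesCoefficients.
Context {R : realType}.
Local Notation C := (cplx R).
Implicit Types (al n : {poly C}) (a : nat -> C).

Lemma sum_coef_le al N : \sum_(j < N) nm al`_j <= \sum_(j < size al) nm al`_j.
Proof.
have [h|h] := leqP N (size al).
  rewrite (big_ord_widen _ (fun j => nm al`_j) h) big_mkcond.
  by apply: ler_sum => j _; case: ifP => // _; exact: nm_ge0.
rewrite [leRHS](big_ord_widen N (fun j => nm al`_j) (ltnW h)) [leRHS]big_mkcond.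
apply: ler_sum => j _; case: ltnP => // js.
by rewrite nth_default// nm0.
Qed.

(** Taylor coefficients of [n / al], when [a] is the series inverse of [al]. *)
Definition series_coef a n j : C := (\poly_(l < j.+1) a l * n)`_j.

Lemma series_coefE a n j N : (j < N)%N -> (\poly_(l < N) a l * n)`_j = series_coef a n j.
Proof.
move=> jN; rewrite /series_coef ![_ * n]mulrC; apply: coefM_low => i ij.
by rewrite !coef_poly (leq_ltn_trans ij jN) ltnS ij.
Qed.

Lemma series_coef_mul al a n N j : series_inverse al a -> (j < N)%N ->
  (al * \poly_(l < N) series_coef a n l)`_j = n`_j.
Proof.
move=> inv jN; rewrite (@coefM_low _ _ _ (\poly_(l < N) a l * n)); last first.
  move=> i ij; rewrite coef_poly (leq_ltn_trans ij jN) series_coefE//.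
  exact: leq_ltn_trans jN.
rewrite mulrA mulrC (@coefM_low _ _ _ 1) ?mulr1// => i ij.
by rewrite inv ?coef1// (leq_ltn_trans ij jN).
Qed.

Lemma series_coef_recursion al a n j : series_inverse al a -> (size n <= j)%N ->
  ((size al).-1 <= j)%N -> \sum_(k < size al) al`_k * series_coef a n (j - k) = 0.
Proof.
move=> inv nj aj; have := series_coef_mul n inv (ltnSn j).
rewrite [n`_j]nth_default// coefM => h; rewrite -[RHS]h.
have hj : (size al <= j.+1)%N by move: aj; case: (size al).
rewrite (big_ord_widen j.+1 (fun k => al`_k * series_coef a n (j - k)) hj).
rewrite big_mkcond; apply: eq_bigr => k _.
rewrite coef_poly ltnS leq_subr; case: ltnP => // ak.
by rewrite nth_default// mul0r.
Qed.

Lemma coef_mul_bound a n (K rho : R) N j : 0 <= K -> 0 < rho <= 1 ->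
  (forall l, nm (a l) <= K * rho ^+ l) ->
  nm (\poly_(l < N) a l * n)`_j <=
    (\sum_(l < size n) nm n`_l) * (K / rho ^+ size n) * rho ^+ j.
Proof.
move=> K0 /andP[r0 r1] ha.
have pos : 0 <= K / rho ^+ size n * rho ^+ j.
  by rewrite mulr_ge0 ?divr_ge0 ?exprn_ge0 ?(ltW r0).
rewrite mulrC coefM; apply: le_trans (nm_sum _ _ _) _.
apply: (@le_trans _ _ (\sum_(l < j.+1) nm n`_l * (K / rho ^+ size n * rho ^+ j))).
  apply: ler_sum => l _; rewrite nmM.
  have [ls|ls] := ltnP l (size n); last by rewrite nth_default// nm0 !mul0r.
  apply: ler_wpM2l; first exact: nm_ge0.
  rewrite coef_poly; case: ltnP => h; last by rewrite nm0.
  apply: le_trans (ha _) _; rewrite -mulrA ler_wpM2l//.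
  rewrite mulrC ler_pdivlMr ?exprn_gt0// -exprD ler_wiXn2l//; first exact: ltW.
  by move: ls; move: (size n) => x; have := ltn_ord l; clear; lia.
rewrite -mulr_suml -[_ * (K / _) * _]mulrA.
by apply: ler_wpM2r => //; exact: sum_coef_le.
Qed.

Lemma series_coef_decay a n (K rho : R) : 0 <= K -> 0 < rho < 1 ->
  (forall l, nm (a l) <= K * rho ^+ l) ->
  exists2 K', 0 <= K' & forall j, nm (series_coef a n j) <= K' * rho ^+ j.
Proof.
move=> K0 /andP[r0 r1] ha; exists ((\sum_(l < size n) nm n`_l) * (K / rho ^+ size n)).
  rewrite mulr_ge0 ?divr_ge0 ?exprn_ge0 ?(ltW r0)//.
  by apply: sumr_ge0 => l _; exact: nm_ge0.
by move=> j; apply: coef_mul_bound => //; rewrite r0 ltW.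
Qed.

(** Each step backwards costs a factor [c + 1] on the sum over a sliding window
    of length [D]. *)
Lemma backward_window (u : nat -> R) (c B : R) (D J : nat) : 0 <= c -> 0 <= B ->
  (forall j, 0 <= u j) ->
  (forall j, (J <= j)%N -> u j <= c * \sum_(1 <= l < D.+1) u (j + l)%N) ->
  forall (n j : nat), (J <= j)%N -> (forall l, (1 <= l <= D)%N -> u (j + n + l)%N <= B) ->
    u j <= (c + 1) ^+ n.+1 * (D%:R * B).
Proof.
move=> c0 B0 u0 hu; pose V j := \sum_(1 <= l < D.+1) u (j + l)%N.
have V0 j : 0 <= V j by apply: sumr_ge0.
have VS j : (J <= j)%N -> V j <= (c + 1) * V j.+1.
  move=> Jj; have h1 := hu _ (leqW Jj).
  apply: (@le_trans _ _ (u j.+1 + V j.+1)); last by rewrite -/(V j.+1) in h1; nra.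
  rewrite /V; case: D {hu V V0 h1} => [|D]; first by rewrite !big_geq// addr0.
  rewrite big_nat_recl// addn1 lerD2l [leRHS]big_nat_recr//=.
  rewrite (eq_big_nat _ _ (F2 := fun l => u (j.+1 + l)%N)); last first.
    by move=> l _; rewrite addnS addSn.
  by rewrite lerDl.
have Vn (n : nat) : forall j, (J <= j)%N -> V j <= (c + 1) ^+ n * V (j + n)%N.
  elim: n => [|n ih] j Jj; first by rewrite expr0 mul1r addn0.
  apply: le_trans (VS j Jj) _; rewrite exprS -mulrA.
  by rewrite ler_wpM2l ?addr_ge0// (le_trans (ih _ (leqW Jj)))// addSnnS.
move=> n j Jj hB; apply: le_trans (hu j Jj) _; rewrite exprS -mulrA -/(V j).
apply: (@le_trans _ _ (c * ((c + 1) ^+ n * V (j + n)%N))).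
  by rewrite ler_wpM2l// Vn.
have VB : V (j + n)%N <= D%:R * B.
  rewrite /V mulr_natl -[D in _ *+ D]subn0 -subSS -sumr_const_nat.
  by rewrite !big_nat; apply: ler_sum => l /andP[l1 lD]; rewrite hB// l1.
have pn : 0 <= (c + 1) ^+ n by rewrite exprn_ge0// addr_ge0.
have : (c + 1) ^+ n * V (j + n)%N <= (c + 1) ^+ n * (D%:R * B) by rewrite ler_wpM2l.
have : 0 <= (c + 1) ^+ n * V (j + n)%N by rewrite mulr_ge0.
by move: ((c + 1) ^+ n * V (j + n)%N) ((c + 1) ^+ n * (D%:R * B)) => x y; nra.
Qed.

End SeriesCoefficients.

Section DivisionAtInfinity.
Context {R : realType}.
Local Notation C := (cplx R).
Implicit Types (g u al : {poly C}).

Lemma divXn_succ u M : u \is monic ->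
  exists c : C, 'X^(M.+1) %/ u = 'X * ('X^M %/ u) + c%:P.
Proof.
move=> mu; have u0 : u != 0 by apply: monic_neq0.
pose rm : {poly C} := 'X * ('X^M %% u).
have sq : (size (rm %/ u)%R <= 1)%N.
  rewrite size_divp// leq_subLR -ltnS -addSn prednK ?size_poly_gt0//.
  have : (size rm <= (size ('X^M %% u)%R).+1)%N.
    by rewrite (leq_trans (size_polyMleq _ _))// size_polyX.
  have : (size ('X^M %% u)%R < size u)%N by rewrite ltn_modp.
  by rewrite addn1 => h1 h2; rewrite ltnS (leq_trans h2)// ltnW.
have e : 'X^(M.+1) = ('X * ('X^M %/ u) + rm %/ u) * u + rm %% u :> {poly C}.
  rewrite exprS {1}(divp_eq 'X^M u) mulrDr -/rm {1}(divp_eq rm u); ring.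
exists (rm %/ u)`_0; rewrite -(size1_polyC sq).
by apply/esym/(divpP e); rewrite ltn_modp.
Qed.

(** The coefficients of [g * ('X^M %/ u)], counted from degree [M] downwards, are
    those of the expansion of [g / u] at infinity as soon as [M] is large; in
    particular they do not depend on [M]. *)
Lemma coef_at_infinity g u l M : u \is monic -> (size g <= M.+1 - l)%N -> (l <= M)%N ->
  (g * ('X^(M.+1) %/ u))`_(M.+1 - l) = (g * ('X^M %/ u))`_(M - l).
Proof.
move=> mu sg lM; have [c ->] := divXn_succ M mu.
rewrite mulrDr coefD mulrCA coefXM subSn// /= [g * c%:P]mulrC mul_polyC coefZ.
by rewrite (nth_default 0 (s := g)) ?mulr0 ?addr0// -subSn.
Qed.

Lemma coef_at_infinity_const g u l M M' : u \is monic -> (size g <= M.+1 - l)%N ->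
  (l <= M)%N -> (M <= M')%N ->
  (g * ('X^M' %/ u))`_(M' - l) = (g * ('X^M %/ u))`_(M - l).
Proof.
move=> mu sg lM; elim: M' => [|M' ih].
  by rewrite leqn0 => /eqP ->.
rewrite leq_eqVlt => /orP[/eqP<-//|]; rewrite ltnS => MM'.
rewrite coef_at_infinity ?ih//; last exact: leq_trans MM'.
by apply: (leq_trans sg); apply: leq_sub2r.
Qed.

(** The hypothesis says that the expansion of [g / u] at infinity has no
    principal part; by comparison of degrees, the part of [g * ('X^M %/ u)] of
    degree at least [M] is then the exact quotient. *)
Lemma dvdp_of_expansion g u M : u \is monic -> (size u + size g <= M)%N ->
  (forall l, (0 < l < size u)%N -> (g * ('X^M %/ u))`_(M - l) = 0) -> u %| g.
Proof.
move=> mu sM hl; have u0 : u != 0 by apply: monic_neq0.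
have su : (0 < size u)%N by rewrite size_poly_gt0.
set G := g * ('X^M %/ u) in hl.
pose lo := take_poly M G; pose hi := drop_poly M G.
have eG : G = lo + hi * 'X^M by rewrite poly_take_drop.
have slo : (size lo <= M - (size u).-1)%N.
  apply/leq_sizeP => j hj; rewrite coef_take_poly; case: ltnP => // jM.
  have -> : j = (M - (M - j))%N by rewrite subKn// ltnW.
  apply: hl; rewrite subn_gt0 jM /=; move: hj jM su.
  by move: (size u) => x; clear; lia.
have e : 'X^M * (g - u * hi) = u * lo + ('X^M %% u) * g.
  have := congr1 ( *%R g) (divp_eq ('X^M : {poly C}) u).
  rewrite mulrDr mulrA -/G eG => h.
  by rewrite mulrBr [X in X - _]mulrC h; ring.
apply: contrapT => ndv.
have n0 : g - u * hi != 0.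
  apply/eqP => /eqP; rewrite subr_eq0 => /eqP eg; apply: ndv.
  by rewrite eg dvdp_mulIl.
have : (size ('X^M * (g - u * hi))%R <= M)%N.
  rewrite e (leq_trans (size_polyD _ _))// geq_max; apply/andP; split.
    apply: (leq_trans (size_polyMleq _ _)); move: slo su sM.
    by move: (size lo) (size u) (size g) => x y z; clear; lia.
  apply: (leq_trans (size_polyMleq _ _)).
  have : (size ('X^M %% u)%R < size u)%N by rewrite ltn_modp.
  by move: sM; move: (size u) (size g) (size ('X^M %% u)%R) => x y z; clear; lia.
rewrite mulrC size_mulXn// leqNgt; case/negP.
by rewrite -[X in (X < _)%N]addn0 ltn_add2l size_poly_gt0.
Qed.

(** Below degree [N] the product is exact; beyond, its coefficients involve only
    the last coefficients of the truncation, which are of order [rho ^+ N]. *)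
Lemma truncated_inverse al (a : nat -> C) (K rho : R) : 0 <= K -> 0 < rho < 1 ->
  (forall n, nm (a n) <= K * rho ^+ n) -> series_inverse al a ->
  exists2 K', 0 <= K' & forall N, (0 < N)%N -> exists r : {poly C},
    [/\ al * \poly_(i < N) a i = 1 + 'X^N * r, (size r <= size al)%N &
        forall i, nm r`_i <= K' * rho ^+ N].
Proof.
move=> K0 /andP[rho0 rho1] ha inv.
pose S := \sum_(j < size al) nm al`_j.
have S0 : 0 <= S by apply: sumr_ge0 => j _; exact: nm_ge0.
exists (S * (K / rho ^+ size al)).
  by rewrite mulr_ge0// divr_ge0// exprn_ge0// ltW.
move=> N N0; set A := \poly_(i < N) a i.
exists (drop_poly N (al * A)); split.
- rewrite -{1}[al * A](poly_take_drop N) [_ * 'X^N]mulrC; congr (_ + _).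
  apply/polyP => i; rewrite coef_take_poly coef1.
  by case: ltnP => iN; [rewrite inv|rewrite eqn0Ngt (leq_trans N0 iN)].
- rewrite size_drop_poly (leq_trans (leq_sub2r _ (size_polyMleq _ _)))//.
  by have := size_poly N a; rewrite -/A; clear; lia.
move=> i; rewrite coef_drop_poly mulrC.
have rho01 : 0 < rho <= 1 by rewrite rho0 ltW.
apply: le_trans (coef_mul_bound al N (i + N)%N K0 rho01 ha) _.
rewrite ler_wpM2l//; first by rewrite mulr_ge0// divr_ge0// exprn_ge0// ltW.
by rewrite exprD ler_piMl ?exprn_ge0 ?exprn_ile1 ?(ltW rho0) ?(ltW rho1).
Qed.

End DivisionAtInfinity.

(** * Matrix polynomials *)

Section MatrixPolynomialFacts.
Context {R : realType}.
Local Notation C := (cplx R).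

Lemma det_evalmxp (m : nat) (A : 'M[{poly C}]_m) (z : C) :
  \det (evalmxp A z) = (\det A).[z].
Proof. by rewrite /evalmxp -[RHS]/(horner_eval z (\det A)) -det_map_mx. Qed.

Lemma evalmxpM (m n l : nat) (A : 'M[{poly C}]_(m, n)) (B : 'M[{poly C}]_(n, l)) z :
  evalmxp (A *m B) z = evalmxp A z *m evalmxp B z.
Proof. exact: (map_mxM (horner_eval z)). Qed.

Lemma constmxpK (m n : nat) (A : 'M[C]_(m, n)) z : evalmxp (constmxp A) z = A.
Proof. by apply/matrixP => i j; rewrite !mxE hornerC. Qed.

Lemma constmxpM (m n l : nat) (A : 'M[C]_(m, n)) (B : 'M[C]_(n, l)) :
  constmxp (A *m B) = constmxp A *m constmxp B.
Proof. exact: (map_mxM polyC). Qed.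

(** A nonzero vector annihilating both [A z] and [B z] yields, after a change
    of basis, a row divisible by ['X - z] in both matrices, hence a common left
    divisor whose determinant has degree one. *)
Lemma left_coprime_kernel (m n : nat) (A : 'M[{poly C}]_m)
    (B : 'M[{poly C}]_(m, n)) (z : C) (w : 'rV[C]_m) :
  left_coprime A B -> w != 0 -> w *m evalmxp A z = 0 ->
  w *m evalmxp B z != 0.
Proof.
move=> cop w0 wA; apply/eqP => wB.
case: m => [|m] in A B w cop w0 wA wB *; first by rewrite thinmx0 eqxx in w0.
pose G := row_ebase w.
have Gu : G \in unitmx by apply: row_ebase_unit.
have [c c0 rG] : exists2 c : C, c != 0 & row 0 G = c *: w.
  have := mulmx_ebase w; rewrite rank_rV w0 -/G (mx11_scalar (col_ebase w)).
  rewrite -mulmxA mul_scalar_mx; set a := col_ebase w 0 0 => e.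
  have a0 : a != 0.
    by apply: contra w0 => /eqP a0; rewrite -e a0 scale0r.
  exists a^-1; first by rewrite invr_eq0.
  rewrite -e scalerA mulVf// scale1r.
  by rewrite rowE; congr (_ *m _); apply/matrixP => i j; rewrite !mxE !ord1 eq_sym andbT.
have GX n' (X : 'M[{poly C}]_(m.+1, n')) : w *m evalmxp X z = 0 ->
    exists X1, X = constmxp (invmx G) *m
      diag_mx (\row_(i < m.+1) if i == 0 then 'X - z%:P else 1) *m X1.
  move=> wX.
  have dv k : 'X - z%:P %| (constmxp G *m X) 0 k.
    rewrite dvdp_XsubCl /root.
    have -> : ((constmxp G *m X) 0 k).[z] = (row 0 (evalmxp (constmxp G *m X) z)) 0 k.
      by rewrite !mxE.
    rewrite evalmxpM constmxpK row_mul rG -scalemxAl wX scaler0 mxE.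
    by [].
  exists (\matrix_(i, k) if i == 0 then (constmxp G *m X) i k %/ ('X - z%:P)
                         else (constmxp G *m X) i k).
  rewrite -mulmxA (_ : diag_mx _ *m _ = constmxp G *m X); last first.
    apply/matrixP => i k; rewrite mul_diag_mx [LHS]mxE [X in X * _]mxE [X in _ * X]mxE.
    case: eqP => [->|_]; last by rewrite mul1r.
    by rewrite mulrC divpK.
  rewrite mulmxA -constmxpM mulVmx//.
  by rewrite /constmxp map_scalar_mx mul1mx.
have [A1 eA] := GX _ A wA; have [B1 eB] := GX _ B wB.
have [c' c'0] := cop _ (ex_intro _ A1 eA) (ex_intro _ B1 eB).
rewrite det_mulmx det_diag big_ord_recl mxE eqxx big1 ?mulr1; last first.
  by move=> i _; rewrite mxE.
rewrite det_map_mx => /(congr1 (horner^~ z)); rewrite hornerM hornerXsubC subrr mulr0 hornerC.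
by move=> e; rewrite -e eqxx in c'0.
Qed.

Lemma size_det_leq (n p : nat) (A : 'M[{poly C}]_n) :
  (forall i j, (size (A i j) <= p.+1)%N) -> (size (\det A) <= (n * p).+1)%N.
Proof.
move=> hA; apply: (leq_trans (size_sum _ _ _)); apply/bigmax_leqP => s _.
rewrite mulr_sign (fun_if (fun x : {poly C} => size x)) size_polyN if_same.
apply: (leq_trans (size_prod_leq _ _)).
rewrite leq_subLR card_ord addnS ltnS.
apply: (@leq_trans (\sum_(i < n) p.+1)); first exact: leq_sum.
by rewrite sum_nat_const card_ord mulnS.
Qed.

(** The entries of the adjugate are minors of order [m.-1], hence the bound
    [(m - 1) p + q] on the degree. *)
Lemma size_adj_mul (m d p q : nat) (A : 'M[{poly C}]_m) (B : 'M[{poly C}]_(m, d)) :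
  (forall i j, (size (A i j) <= p.+1)%N) -> (forall i j, (size (B i j) <= q.+1)%N) ->
  forall i j, (size ((\adj A *m B)%R i j) <= (m * p + q - p).+1)%N.
Proof.
move=> hA hB i j; rewrite mxE; apply: (leq_trans (size_sum _ _ _)).
apply/bigmax_leqP => k _.
case: m => [|m] in A B hA hB i k *; first by case: i.
have hadj : (size ((\adj A) i k)%R <= (m * p).+1)%N.
  rewrite mxE /cofactor -signr_odd mulr_sign.
  have h : (size (\det (row' k (col' i A)))%R <= (m * p).+1)%N.
    by apply: size_det_leq => a b; rewrite !mxE.
  by case: (odd _) => //; rewrite size_polyN.
apply: (leq_trans (size_polyMleq _ _)).
have := hB k j; move: hadj; set a := size _; set b := size _.
by rewrite mulSn => ha hb; lia.
Qed.

(** The roots [r] outside the unit disc are turned into the reciprocals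
    [l = r^-1] of modulus less than one: these factors are invertible as power
    series, the others by expansion at infinity. *)
Lemma root_split (a : {poly C}) : a != 0 -> (forall z, nm z = 1 -> a.[z] != 0) ->
  exists (k : C) (ls zs : seq C), [/\ k != 0,
    (forall l, l \in ls -> nm l < 1), (forall z, z \in zs -> nm z < 1) &
    a = k *: (\prod_(l <- ls) (1 - l *: 'X) * \prod_(z <- zs) ('X - z%:P))].
Proof.
move=> a0 ha; have [rs ers] := closed_field_poly_normal a.
have k0 : lead_coef a != 0 by rewrite lead_coef_eq0.
have : forall r, r \in rs -> nm r != 1.
  move=> r rr; apply/eqP => /ha; rewrite ers hornerZ mulf_eq0 negb_or => /andP[_].
  suff /eqP -> : (\prod_(z <- rs) ('X - z%:P)).[r] == 0 by rewrite eqxx.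
  by rewrite -[_ == 0]/(root _ r) root_prod_XsubC.
move: ers; set k := lead_coef a in k0 *; move: k k0 => k k0 -> {a0 ha}.
elim: rs k k0 => [|r rs ih] k k0 hr.
  by exists k, [::], [::]; split => //; rewrite !big_nil mulr1.
have hr1 : forall z, z \in rs -> nm z != 1.
  by move=> z zs; apply: hr; rewrite inE zs orbT.
have : nm r != 1 by apply: hr; rewrite inE eqxx.
rewrite neq_lt => /orP[r1|r1].
  have [k' [ls [zs [k'0 h1 h2 e]]]] := ih k k0 hr1.
  exists k', ls, (r :: zs); split => //.
    by move=> z; rewrite inE => /orP[/eqP->|/h2].
  by rewrite !big_cons [LHS]scalerAr e -scalerAr; congr (_ *: _); ring.
have r0 : r != 0 by rewrite -nm_gt0; lra.
have [|k' [ls [zs [k'0 h1 h2 e]]]] := ih (k * - r) _ hr1.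
  by rewrite mulf_neq0// oppr_eq0.
exists k', (r^-1 :: ls), zs; split => //.
  move=> z; rewrite inE => /orP[/eqP->|/h1//].
  by rewrite nmV invf_lt1//; lra.
rewrite !big_cons -mulrA [in RHS]scalerAr -e.
rewrite (_ : 'X - r%:P = - r *: (1 - r^-1 *: 'X)).
  by rewrite -scalerAl !scalerA -scalerAr.
by rewrite scalerBr scalerA mulNr divff// scaleN1r opprK addrC scaleNr alg_polyC.
Qed.

End MatrixPolynomialFacts.

(** * Distributions of real and complex random variables *)

Section RealProb.
Context {R : realType} {disp : measure_display} {T : measurableType disp}.
Variable P : probability T R.
Local Notation C := (cplx R).
Local Notation pr := (pr P).

Lemma measurable_gtr d (W : measurableType d) (f : W -> R) K :
  measurable_fun setT f -> measurable [set w | K < f w].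
Proof.
move=> mf; rewrite (_ : [set _ | _] = setT `&` f @^-1` `]K, +oo[%classic).
  exact: mf.
by rewrite setTI; apply/seteqP; split => w /=; rewrite in_itv /= andbT.
Qed.

Lemma measurable_ler d (W : measurableType d) (f : W -> R) K :
  measurable_fun setT f -> measurable [set w | f w <= K].
Proof.
move=> mf; rewrite (_ : [set _ | _] = setT `&` f @^-1` `]-oo, K]%classic).
  exact: mf.
by rewrite setTI; apply/seteqP; split => w /=; rewrite in_itv /=.
Qed.

Lemma measurable_ger d (W : measurableType d) (f : W -> R) K :
  measurable_fun setT f -> measurable [set w | K <= f w].
Proof.
move=> mf; rewrite (_ : [set _ | _] = setT `&` f @^-1` `[K, +oo[%classic).
  exact: mf.
by rewrite setTI; apply/seteqP; split => w /=; rewrite in_itv /= andbT.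
Qed.

Lemma tight1 (f : T -> R) : measurable_fun setT f -> forall e : R, 0 < e ->
  exists2 K : R, 0 < K & pr [set w | K < f w] <= e.
Proof.
move=> mf e e0.
pose F (n : nat) : set T := [set w | n%:R < f w].
have mF n : measurable (F n) by exact: measurable_gtr.
have cv : (fun n => P (F n)) @ \oo --> P (\bigcap_n F n).
  apply: nonincreasing_cvg_mu => //.
  - by rewrite ltey_eq fin_num_measure.
  - exact: bigcapT_measurable.
  - move=> n m nm; apply/subsetPset => w; rewrite /F /=.
    by apply: le_lt_trans; rewrite ler_nat.
have F0 : \bigcap_n F n = set0.
  apply/seteqP; split => w //= h.
  have := h (Num.Def.archi_bound (f w)) Logic.I; rewrite /F /=.
  have := archi_boundP (normr_ge0 (f w)).
  have [n hn] : exists n : nat, `|f w| < n%:R.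
    by exists (Num.bound `|f w|); exact: archi_boundP.
  move=> _ _; have := h n Logic.I; rewrite /F /=; have := ler_norm (f w); lra.
rewrite F0 measure0 in cv.
have : \forall n \near \oo, (P (F n) < e%:E)%E.
  move/fine_cvgP : cv => [_ /cvgr0Pnorm_lt /(_ _ e0)].
  apply: filterS => n /=; rewrite ger0_norm ?fine_ge0//.
  by rewrite -lte_fin fineK// fin_num_measure.
move=> [n _ /(_ n.+1 (leqnSn _)) h]; exists n.+1%:R => //.
rewrite -lee_fin prE//; first exact: ltW.
exact: mF.
Qed.

Lemma pr_ae (A B N : set T) : measurable A -> measurable B ->
  P.-negligible N -> A `<=` B `|` N -> pr A <= pr B.
Proof.
move=> mA mB [N' [mN' N'0 NN']] AB.
apply: (@le_trans _ _ (pr (B `|` N'))).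
  apply: le_pr => //; first exact: measurableU.
  by move=> w /AB[Bw|/NN' Nw]; [left|right].
apply: le_trans (prU_le _ _ _) _ => //.
have N0 : fine (P N') = 0 by rewrite N'0.
by rewrite -[leRHS]addr0 -N0.
Qed.

(** A nondegenerate summand cannot be asymptotically split off from a variable
    that is itself independent of it: comparing the events [xi <= c] and
    [c' <= xi] shows that the law of [X] would be invariant under a nonzero
    translation. *)
Lemma independent_summand_degenerate (X xi : T -> R) (W : nat -> T -> R) (c c' : R) :
  measurable_fun setT X -> measurable_fun setT xi ->
  (forall n, measurable_fun setT (W n)) -> c < c' ->
  0 < pr [set w | xi w <= c] -> 0 < pr [set w | c' <= xi w] ->
  (forall y, pr ([set w | X w <= y] `&` [set w | c' <= xi w]) =
     pr [set w | X w <= y] * pr [set w | c' <= xi w]) ->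
  (forall y, pr ([set w | X w <= y] `&` [set w | xi w <= c]) =
     pr [set w | X w <= y] * pr [set w | xi w <= c]) ->
  (forall n y, pr ([set w | W n w <= y] `&` [set w | c' <= xi w]) =
     pr [set w | W n w <= y] * pr [set w | c' <= xi w]) ->
  (forall n y, pr ([set w | W n w <= y] `&` [set w | xi w <= c]) =
     pr [set w | W n w <= y] * pr [set w | xi w <= c]) ->
  (forall e del : R, 0 < e -> 0 < del ->
     exists n, pr [set w | e < `|X w - xi w - W n w|] <= del) -> False.
Proof.
move=> mX mxi mW cc'; set p := pr [set w | xi w <= c]; set p' := pr _.
move=> p0 p'0 iX iXc iW' iW small.
have m1 y : measurable [set w | X w <= y] by exact: measurable_ler.
have m2 n y : measurable [set w | W n w <= y] by exact: measurable_ler.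
have m3 : measurable [set w | xi w <= c] by exact: measurable_ler.
have m4 : measurable [set w | c' <= xi w] by exact: measurable_ger.
have m5 n e : measurable [set w | e < `|X w - xi w - W n w|].
  apply: measurable_gtr; apply: measurableT_comp => //.
  by apply: measurable_funB => //; exact: measurable_funB.
pose Fx y := pr [set w | X w <= y].
pose h := (c' - c) / 2; have h0 : 0 < h by rewrite /h; lra.
have key y : Fx y <= Fx (y - h).
  apply/ler_addgt0Pr => r r0.
  have [||n hn] := small (h / 2) (r * (p * p' / 2)).
  - by rewrite divr_gt0.
  - by rewrite mulr_gt0// divr_gt0// mulr_gt0.
  have s1 : Fx y * p' <= pr [set w | W n w <= y - c' + h / 2] * p' + r * (p * p' / 2).
    rewrite -iX -iW'; apply: le_trans (lerD (lexx _) hn).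
    apply: le_trans (prU_le _ _ _); last 2 first.
    - exact: measurableI.
    - exact: m5.
    apply: le_pr; [exact: measurableI|by apply: measurableU => //; exact: measurableI|].
    move=> w /= [a1 a2].
    have [b|b] := leP `|X w - xi w - W n w| (h / 2); last by right.
    left; split => //; move: b; rewrite ler_norml => /andP[]; lra.
  have s2 : pr [set w | W n w <= y - c' + h / 2] * p <= Fx (y - h) * p + r * (p * p' / 2).
    rewrite -iW; apply: (@le_trans _ _ (pr ([set w | X w <= y - h] `&` [set w | xi w <= c]) +
        r * (p * p' / 2))).
      apply: le_trans (lerD (lexx _) hn).
      apply: le_trans (prU_le _ _ _); last 2 first.
      - exact: measurableI.
      - exact: m5.
      apply: le_pr; [exact: measurableI|by apply: measurableU => //; exact: measurableI|].
      move=> w /= [a1 a2].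
      have [b|b] := leP `|X w - xi w - W n w| (h / 2); last by right.
      by left; split => //; move: b; rewrite ler_norml => /andP[]; rewrite /h in a1 *; lra.
    by rewrite lerD2r iXc.
  have p1 : p <= 1 by apply: pr_le1.
  have p'1 : p' <= 1 by apply: pr_le1.
  rewrite -(ler_pM2r (mulr_gt0 p0 p'0)).
  set a := Fx y in s1 *; set b := Fx _ in s2 *; set g := pr _ in s1 s2 *.
  have : a * p' * p <= (g * p' + r * (p * p' / 2)) * p by rewrite ler_wpM2r// ltW.
  have : g * p * p' <= (b * p + r * (p * p' / 2)) * p' by rewrite ler_wpM2r// ltW.
  have : r * (p * p' / 2) * p <= r * (p * p' / 2).
    by rewrite ler_piMr// ltW// mulr_gt0// divr_gt0// mulr_gt0.
  have : r * (p * p' / 2) * p' <= r * (p * p' / 2).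
    by rewrite ler_piMr// ltW// mulr_gt0// divr_gt0// mulr_gt0.
  nra.
have iter n y : Fx y <= Fx (y - n%:R * h).
  elim: n y => [|n ih] y; first by rewrite mul0r subr0.
  apply: le_trans (ih _) _; apply: le_trans (key _) _.
  by rewrite -addrA -opprD -natr1 mulrDl mul1r.
have mnX : measurable_fun setT (fun w => `|X w|) by exact: measurableT_comp.
have [|K K0 hK] := tight1 mnX (e := 1 / 4); first by lra.
have F1 : 3 / 4 <= Fx K.
  have : pr (~` [set w | K < `|X w|]) <= Fx K.
    apply: le_pr => //; first by apply: measurableC; exact: measurable_gtr.
    by move=> w /= /negP; rewrite -leNgt ler_norml => /andP[].
  rewrite prC; last exact: measurable_gtr.
  by move: hK; lra.
have [n hn] : exists n : nat, 2 * K + 1 < n%:R * h.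
  exists (Num.bound ((2 * K + 1) / h)); rewrite -ltr_pdivrMr//.
  by apply: archi_boundP; rewrite divr_ge0//; lra.
have F2 : Fx (K - n%:R * h) <= 1 / 4.
  apply: le_trans hK; apply: le_pr => //; first exact: measurable_gtr.
  by move=> w /= hw; rewrite ltr_normr; apply/orP; right; lra.
by have := iter n K; lra.
Qed.

End RealProb.

Section SignPatterns.
Context {R : realType}.
Local Notation C := (cplx R).

Lemma cmeas_comp d1 d2 (W1 : measurableType d1) (W2 : measurableType d2)
    (f : W2 -> C) (g : W1 -> W2) :
  cmeas f -> measurable_fun setT g -> cmeas (fun w => f (g w)).
Proof.
by move=> [f1 f2] mg; split; [exact: (measurableT_comp f1 mg)|exact: (measurableT_comp f2 mg)].
Qed.

Lemma expr_lt_eventually (x e : R) : 0 <= x -> x < 1 -> 0 < e ->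
  exists N, x ^+ N < e.
Proof.
move=> x0 x1 e0.
have /cvgr0Pnorm_lt /(_ _ e0) [N _ hN] : (fun n => x ^+ n) @ \oo --> (0 : R).
  by apply: cvg_expr; rewrite ger0_norm.
by exists N; apply: le_lt_trans (ler_norm _) (hN N (leqnn N)).
Qed.

(** Converts a lower bound on a product of probabilities [1 - x i] into an upper
    bound on the sum of the [x i]. *)
Lemma prod_complement_le (x : nat -> R) n : (forall i, 0 <= x i <= 1) ->
  (\prod_(i < n) (1 - x i)) * (1 + \sum_(i < n) x i) <= 1.
Proof.
move=> hx; have p0 k : 0 <= \prod_(i < k) (1 - x i).
  by apply: prodr_ge0 => i _; have := hx i; lra.
have s0 k : 0 <= \sum_(i < k) x i.
  by apply: sumr_ge0 => i _; have := hx i; lra.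
elim: n => [|n ih]; first by rewrite !big_ord0 addr0 mulr1.
rewrite !big_ord_recr /=; apply: le_trans ih.
rewrite -mulrA ler_wpM2l ?p0//; have /andP[+ _] := hx n; have := s0 n.
move: (\sum_(i < n) x i) (x n) => S y S0 y0.
have : 0 <= S * y by rewrite mulr_ge0.
have : 0 <= y * y by rewrite mulr_ge0.
nra.
Qed.

(** Choosing the signs of the real parts, or those of the imaginary parts, makes
    all the terms add up along one of the axes. *)
Lemma signed_sum_large (e : nat -> C) (L : nat) : (forall j, nm (e j) = 1) ->
  exists th : nat -> bool,
    L%:R / 2 <= nm (\sum_(j < L) (-1) ^+ th j * e j).
Proof.
move=> he.
have hsum (h : C -> R) : (forall z u, h (z + u) = h z + h u) ->
    (forall z, h (- z) = - h z) -> (forall z, `|h z| <= nm z) ->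
    exists th : nat -> bool, \sum_(j < L) `|h (e j)| <= nm (\sum_(j < L) (-1) ^+ th j * e j).
  move=> hD hN hn; exists (fun j => h (e j) < 0).
  have h0 : h 0 = 0 by have := hD 0 0; rewrite addr0; lra.
  apply: le_trans (le_trans (ler_norm _) (hn _)).
  rewrite (big_morph h hD h0); apply: ler_sum => j _.
  by case: ltP => hj; rewrite ?mul1r ?mulN1r ?hN; [rewrite ltr0_norm|rewrite ger0_norm].
have tot : L%:R <= \sum_(j < L) `|rep (e j)| + \sum_(j < L) `|imp (e j)| :> R.
  rewrite -big_split /= -[L in L%:R]card_ord -sumr_const.
  by apply: ler_sum => j _; rewrite -[1](he j) nm_le_rep_imp.
have [t1 h1] := hsum (@rep R) (@repD R) (@repN R) (@rep_le_nm R).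
have [t2 h2] := hsum (@imp R) (@impD R) (@impN R) (@imp_le_nm R).
have [b|b] := leP (L%:R / 2) (\sum_(j < L) `|rep (e j)|).
  by exists t1; lra.
by exists t2; lra.
Qed.

(** Exchanging [a] and [a'] in a pattern changes the sum by [a - a'] times a
    signed sum of the [e j]; hence one of two opposite patterns has a large sum,
    whatever the drift [c]. *)
Lemma large_pattern (e : nat -> C) (a a' c : C) (K : R) :
  (forall j, nm (e j) = 1) -> a != a' ->
  exists (L : nat) (v : nat -> C), [/\ forall j, v j = a \/ v j = a',
    K < nm (a - a') * L%:R / 8 &
    nm (a - a') * L%:R / 4 <= nm (\sum_(j < L) e j * (v j + c))].
Proof.
move=> he aa'; have D0 : 0 < nm (a - a') by rewrite nm_gt0 subr_eq0.
have [L hL] : exists L : nat, K < nm (a - a') * L%:R / 8.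
  exists (Num.bound (8 * `|K| / nm (a - a'))).
  have : 8 * `|K| / nm (a - a') < (Num.bound (8 * `|K| / nm (a - a')))%:R.
    by apply: archi_boundP; rewrite divr_ge0 ?mulr_ge0 ?nm_ge0.
  by rewrite ltr_pdivrMr//; have := ler_norm K; lra.
have [th hth] := signed_sum_large L he.
pose v1 j := if th j then a' else a.
pose v2 j := if th j then a else a'.
have dif : \sum_(j < L) e j * (v1 j + c) - \sum_(j < L) e j * (v2 j + c) =
    (a - a') * \sum_(j < L) (-1) ^+ th j * e j.
  rewrite mulr_sumr -sumrB; apply: eq_bigr => j _; rewrite /v1 /v2.
  by case: (th j); rewrite ?expr0 ?expr1; ring.
have : nm (a - a') * (L%:R / 2) <= nm (\sum_(j < L) e j * (v1 j + c)) +
    nm (\sum_(j < L) e j * (v2 j + c)).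
  by apply: le_trans (nmB _ _); rewrite dif nmM ler_wpM2l// nm_ge0.
move=> tot.
have [b|b] := leP (nm (a - a') * L%:R / 4) (nm (\sum_(j < L) e j * (v1 j + c))).
  by exists L, v1; split => // j; rewrite /v1; case: (th j); [right|left].
exists L, v2; split => //; last by lra.
by move=> j; rewrite /v2; case: (th j); [left|right].
Qed.

End SignPatterns.

Section AlmostSure.
Context {R : realType} {disp : measure_display} {T : measurableType disp}.
Variable P : probability T R.
Local Notation C := (cplx R).
Local Notation pr := (pr P).

Lemma pr0_negligible (A : set T) : measurable A -> pr A = 0 -> P.-negligible A.
Proof.
move=> mA A0; apply/(negligibleP P mA).
by have e := prE P mA; rewrite A0 in e; exact: (esym e).
Qed.

Lemma ae_forall_int (Q : int -> T -> Prop) :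
  (forall t, {ae P, forall w, Q t w}) -> {ae P, forall w, forall t, Q t w}.
Proof.
move=> h.
have h1 : {ae P, forall w, forall n : nat, Q (Posz n) w} by apply: ae_foralln => n; exact: h.
have h2 : {ae P, forall w, forall n : nat, Q (Negz n) w} by apply: ae_foralln => n; exact: h.
by apply: filterS2 h1 h2 => w a b [] n; [exact: a|exact: b].
Qed.

Lemma ae_forall_fin (I : finType) (Q : I -> T -> Prop) :
  (forall i, {ae P, forall w, Q i w}) -> {ae P, forall w, forall i, Q i w}.
Proof.
move=> h.
have h1 : {ae P, forall w, forall n : nat, forall i, enum_rank i = n :> nat -> Q i w}.
  apply: ae_foralln => n; have [nI|nI] := ltnP n #|I|.
    have := h (enum_val (Ordinal nI)); apply: filterS => w hw i e.
    suff -> : i = enum_val (Ordinal nI) by [].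
    by apply: enum_rank_inj; rewrite enum_valK; apply: val_inj.
  by apply: aeW => w i e; exfalso; have := ltn_ord (enum_rank i); rewrite e ltnNge nI.
by apply: filterS h1 => w hw i; exact: (hw (enum_rank i)).
Qed.

(** A countable dense set, to cover the plane by countably many small balls. *)
Definition grid (r : R) (n : nat) : C :=
  if unpickle n is Some (x, y) then (r * ratr x)%:C + 'i%R * (r * ratr y)%:C else 0.

Lemma rep_i (x : R) : rep ('i%R * x%:C : C) = 0 /\ imp ('i%R * x%:C : C) = x.
Proof. by rewrite -(@complexiE R) repM impM /= mul0r !mulr0 mul1r subrr add0r. Qed.

Lemma grid_dense (r : R) (z : C) : 0 < r -> exists n, nm (z - grid r n) <= r.
Proof.
move=> r0.
have ratx (x : R) : exists q : rat, `|x - r * ratr q| <= r / 2.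
  have [|q] := @rat_in_itvoo R ((x - r / 2) / r) ((x + r / 2) / r).
    by rewrite ltr_pM2r ?invr_gt0//; lra.
  rewrite in_itv /= ltr_pdivrMr// ltr_pdivlMr// [ratr q * r]mulrC => /andP[q1 q2].
  by exists q; rewrite ler_norml; apply/andP; split; lra.
have [x hx] := ratx (rep z); have [y hy] := ratx (imp z).
exists (pickle (x, y)); rewrite /grid pickleK.
apply: le_trans (nm_le_rep_imp _) _; rewrite repB impB repD impD.
have [-> ->] := rep_i (r * ratr y); rewrite rep_real imp_real addr0 add0r.
by apply: le_trans (lerD hx hy) _; lra.
Qed.

Lemma ball_of_positive (f : T -> C) (A : set T) (r : R) : cmeas f -> measurable A ->
  0 < r -> 0 < pr A -> exists a : C, 0 < pr (A `&` [set w | nm (f w - a) <= r]).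
Proof.
move=> mf mA r0 A0.
have mB a : measurable [set w | nm (f w - a) <= r].
  by apply: measurable_ler; apply: cmeas_nm; apply: cmeasB => //; exact: cmeas_cst.
apply: contrapT => h.
suff : P A = 0 by move=> PA; rewrite /pr PA ltxx in A0.
apply/(negligibleP P mA).
apply: (negligibleS (A := \bigcup_n (A `&` [set w | nm (f w - grid r n) <= r]))).
  by move=> w Aw; have [n hn] := grid_dense (f w) r0; exists n.
apply: negligible_bigcup => n; apply: pr0_negligible; first exact: measurableI.
apply/eqP; rewrite eq_le pr_ge0 andbT leNgt; apply/negP => hp.
by apply: h; exists (grid r n).
Qed.

(** One ball is found in each of the two half-planes [rep (v * f) <= c] and
    [c' <= rep (v * f)]; the constant 100 is a margin for the accumulated errors
    of long sums of values in such balls. *)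
Lemma two_balls (f : T -> C) (v : C) (c c' : R) : cmeas f -> nm v = 1 -> c < c' ->
  0 < pr [set w | rep (v * f w) <= c] -> 0 < pr [set w | c' <= rep (v * f w)] ->
  exists (a a' : C) (r : R), [/\ 0 < r, 100 * r <= nm (a - a'),
    0 < pr [set w | nm (f w - a) <= r] & 0 < pr [set w | nm (f w - a') <= r]].
Proof.
move=> mf v1 cc' p p'.
have [mvf _] := cmeasZ v mf.
pose r := (c' - c) / 200; have r0 : 0 < r by rewrite /r; lra.
have mA : measurable [set w | rep (v * f w) <= c] by exact: measurable_ler.
have mA' : measurable [set w | c' <= rep (v * f w)] by exact: measurable_ger.
have mB a : measurable [set w | nm (f w - a) <= r].
  by apply: measurable_ler; apply: cmeas_nm; apply: cmeasB => //; exact: cmeas_cst.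
have ex (A : set T) : 0 < pr A -> exists w, A w.
  move=> A0; apply: contrapT => h; rewrite (_ : A = set0) ?pr_set0 ?ltxx// in A0.
  by apply/seteqP; split => // w Aw; apply: h; exists w.
have [a ha] := ball_of_positive mf mA r0 p.
have [a' ha'] := ball_of_positive mf mA' r0 p'.
exists a, a', r; split => //.
- have [w /= [w1 w2]] := ex _ ha; have [w' /= [w1' w2']] := ex _ ha'.
  have b1 : `|rep (v * (f w - a))| <= r by apply: le_trans (rep_le_nm _) _; rewrite nmM v1 mul1r.
  have b2 : `|rep (v * (f w' - a'))| <= r by apply: le_trans (rep_le_nm _) _; rewrite nmM v1 mul1r.
  have b3 : `|rep (v * (a - a'))| <= nm (a - a').
    by apply: le_trans (rep_le_nm _) _; rewrite nmM v1 mul1r.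
  move: b1 b2 b3; rewrite !mulrBr !repB !ler_norml /r.
  by move=> /andP[? ?] /andP[? ?] /andP[? ?]; lra.
- by apply: lt_le_trans ha _; apply: le_pr => //; exact: measurableI.
- by apply: lt_le_trans ha' _; apply: le_pr => //; exact: measurableI.
Qed.

(** The constant is the supremum of the [x] with [X <= x] of probability zero. *)
Lemma real_degenerate (X : T -> R) : measurable_fun setT X ->
  (forall c c' : R, c < c' -> 0 < pr [set w | X w <= c] ->
     0 < pr [set w | c' <= X w] -> False) ->
  exists c : R, {ae P, forall w, X w = c}.
Proof.
move=> mX h.
have mL c : measurable [set w | X w <= c] by exact: measurable_ler.
have mG c : measurable [set w | c <= X w] by exact: measurable_ger.
pose S := [set x : R | pr [set w | X w <= x] = 0].

have mN : measurable_fun setT (fun w => `|X w|) by exact: measurableT_comp.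
have [|K K0 hK] := tight1 P mN (e := 1 / 2); first by lra.
have mK : measurable [set w | K < `|X w|].
  exact: measurable_gtr.
have Sub : ubound S (K + 1).
  move=> x /= Sx; rewrite leNgt; apply/negP => xK.
  have : pr (~` [set w | K < `|X w|]) <= pr [set w | X w <= x].
    apply: le_pr => //; first exact: measurableC.
    by move=> w /= /negP; rewrite -leNgt ler_norml => /andP[]; lra.
  by rewrite prC// Sx; lra.
have Sx : S (- K - 1).
  apply: contrapT => /eqP; rewrite /S /= => hx.
  have p1 : 0 < pr [set w | X w <= - K - 1] by rewrite lt_neqAle eq_sym hx pr_ge0.
  apply: (h (- K - 1) (- K)) => //; first by lra.
  have : pr (~` [set w | K < `|X w|]) <= pr [set w | - K <= X w].
    apply: le_pr => //; first exact: measurableC.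
    by move=> w /= /negP; rewrite -leNgt ler_norml => /andP[].
  by rewrite prC//; lra.
have hS : has_sup S by split; [exists (- K - 1)|exists (K + 1)].
exists (sup S).
have low n : P.-negligible [set w | X w <= sup S - n.+1%:R^-1].
  apply: pr0_negligible => //.
  have n0 : 0 < n.+1%:R^-1 :> R by rewrite invr_gt0.
  have [x Ssx hx] := sup_adherent n0 hS.
  apply/eqP; rewrite eq_le pr_ge0 andbT -Ssx; apply: le_pr => // w /= hw.
  by apply: le_trans hw (ltW hx).
have high n : P.-negligible [set w | sup S + n.+1%:R^-1 <= X w].
  apply: pr0_negligible => //; apply/eqP; rewrite eq_le pr_ge0 andbT leNgt; apply/negP => hp.
  have n0 : 0 < n.+1%:R^-1 :> R by rewrite invr_gt0.
  move: (n.+1%:R^-1) n0 hp => e e0 hp.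
  apply: (h (sup S + e / 2) (sup S + e)) => //; first by lra.
  rewrite lt_neqAle pr_ge0 andbT eq_sym; apply/negP => /eqP hz.
  have : sup S + e / 2 <= sup S by apply: sup_ubound => //; exists (K + 1).
  by lra.
apply: (negligibleS (A := (\bigcup_n [set w | X w <= sup S - n.+1%:R^-1]) `|`
   (\bigcup_n [set w | sup S + n.+1%:R^-1 <= X w]))); last first.
  by apply: negligibleU; apply: negligible_bigcup.
move=> w /= /eqP; rewrite neq_lt => /orP[hw|hw]; [left|right].
  have d0 : 0 < sup S - X w by lra.
  have [n _ /(_ n (leqnn n)) /= hn] := near_infty_natSinv_lt (PosNum d0).
  by exists n => //=; move: hn; move: (n.+1%:R^-1) => e; lra.
have d0 : 0 < X w - sup S by lra.
have [n _ /(_ n (leqnn n)) /= hn] := near_infty_natSinv_lt (PosNum d0).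
by exists n => //=; move: hn; move: (n.+1%:R^-1) => e; lra.
Qed.

End AlmostSure.

(** * Conditional tightness and a maximal inequality *)

Section Tightness.
Context {R : realType} {disp : measure_display} {T : measurableType disp}.
Variable P : probability T R.
Local Notation C := (cplx R).
Local Notation pr := (pr P).
Variables (d : nat) (Z : int -> {RV P >-> 'cV[C]_d}).

(** As a type, so that measurability with respect to the noise on [J] is an
    instance of [measurable_fun]. *)
Definition sspace (J : set int) : Type :=
  g_sigma_algebraType (\bigcup_(r in J) preimage_set_system setT (Z r : T -> _) measurable).
HB.instance Definition _ J := Measurable.on (sspace J).

Lemma sspace_measurable J (E : set T) :
  measurable (E : set (sspace J)) -> sigma_of Z J E.
Proof. by []. Qed.

(** Tightness of a family [x], uniformly under conditioning on the events that
    the noise on [J i] generates. *)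
Definition rtight (I : Type) (J : I -> set int) (x : I -> T -> C) :=
  forall e : R, 0 < e -> exists2 K : R, 0 < K & forall i E, sigma_of Z (J i) E ->
    pr ([set w | K < nm (x i w)] `&` E) <= e * pr E.

Variables (I : Type) (J : I -> set int).
Implicit Types x y : I -> T -> C.

Lemma gt_nm_measurable (f : T -> C) K : cmeas f -> measurable [set w | K < nm (f w)].
Proof. by move=> mf; apply: measurable_gtr; exact: cmeas_nm. Qed.

Lemma rtightD x y : (forall i, cmeas (x i)) -> (forall i, cmeas (y i)) ->
  rtight J x -> rtight J y -> rtight J (fun i w => x i w + y i w).
Proof.
move=> mx my tx ty e e0.
have e2 : 0 < e / 2 by rewrite divr_gt0.
have [K1 K10 h1] := tx _ e2; have [K2 K20 h2] := ty _ e2.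
exists (K1 + K2); first by rewrite addr_gt0.
move=> i E sE; have mE := sigma_of_measurable sE.
have mm1 := gt_nm_measurable K1 (mx i); have mm2 := gt_nm_measurable K2 (my i).
have mm3 := gt_nm_measurable (K1 + K2) (cmeasD (mx i) (my i)).
apply: (@le_trans _ _ (pr ([set w | K1 < nm (x i w)] `&` E) +
   pr ([set w | K2 < nm (y i w)] `&` E))).
  apply: le_trans (prU_le _ _ _); [|exact: measurableI|exact: measurableI].
  apply: le_pr; [exact: measurableI|by apply: measurableU; exact: measurableI|].
  move=> w /= [hw Ew].
  have [a|a] := ltP K1 (nm (x i w)); first by left.
  right; split => //; have := nmD (x i w) (y i w); lra.
by have := h1 i E sE; have := h2 i E sE; lra.
Qed.

Lemma rtightZ (c : I -> C) (B : R) x : (forall i, cmeas (x i)) ->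
  (forall i, nm (c i) <= B) ->
  rtight J x -> rtight J (fun i w => c i * x i w).
Proof.
move=> mx cB tx e e0; have [K K0 h] := tx _ e0.
exists ((`|B| + 1) * K); first by rewrite mulr_gt0// ltr_wpDl.
move=> i E sE; have mE := sigma_of_measurable sE.
apply: le_trans (h i E sE); apply: le_pr.
- by apply: measurableI => //; apply: gt_nm_measurable; exact: cmeasZ.
- by apply: measurableI => //; exact: gt_nm_measurable.
move=> w /= [hw Ew]; split => //; move: hw; rewrite nmM.
have := cB i; have := nm_ge0 (c i); have := nm_ge0 (x i w); have := ler_norm B.
case: (ltP K (nm (x i w))) => // b4 b1 b2 b3 b5.
have : nm (c i) * nm (x i w) <= (`|B| + 1) * K by apply: ler_pM => //; lra.
lra.
Qed.

Lemma rtight_cst (c : I -> C) (B : R) : (forall i, nm (c i) <= B) ->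
  rtight J (fun i _ => c i).
Proof.
move=> cB e e0; exists (`|B| + 1); first by rewrite ltr_wpDl.
move=> i E sE; rewrite (_ : [set w | _] = set0).
  by rewrite set0I pr_set0 mulr_ge0// ?pr_ge0// ltW.
apply/seteqP; split => w //=; have := cB i; have := ler_norm B; lra.
Qed.

Lemma rtight_sum (L : Type) (s : seq L) (x : L -> I -> T -> C) :
  (forall l i, cmeas (x l i)) -> (forall l, rtight J (x l)) ->
  rtight J (fun i w => \sum_(l <- s) x l i w).
Proof.
move=> mx tx; elim: s => [|l s ih].
  have := @rtight_cst (fun=> 0) 0 (fun=> _).
  under [in X in _ -> X]eq_fun do (under eq_fun do rewrite big_nil).
  by apply => _; rewrite nm0.
under eq_fun do (under eq_fun do rewrite big_cons).
apply: rtightD => // i; exact: cmeas_sum.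
Qed.

Lemma rtight_ae x y : (forall i, cmeas (x i)) -> (forall i, cmeas (y i)) ->
  (forall i, {ae P, forall w, x i w = y i w}) -> rtight J x -> rtight J y.
Proof.
move=> mx my xy tx e e0; have [K K0 h] := tx _ e0.
exists K => // i E sE; have mE := sigma_of_measurable sE.
apply: le_trans (h i E sE).
apply: (pr_ae _ _ (xy i)).
- by apply: measurableI => //; exact: gt_nm_measurable.
- by apply: measurableI => //; exact: gt_nm_measurable.
move=> w /= [a b]; case: (pselect (x i w = y i w)) => [->|]; first by left.
by right.
Qed.

End Tightness.

Section MaximalInequality.
Context {R : realType} {disp : measure_display} {T : measurableType disp}.
Variable P : probability T R.
Local Notation C := (cplx R).
Local Notation pr := (pr P).
Variables (d : nat) (Z : int -> {RV P >-> 'cV[C]_d}).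

Lemma sigma_of_sub (J J' : set int) E : J `<=` J' -> sigma_of Z J E -> sigma_of Z J' E.
Proof. by move=> JJ'; apply: sig_sub. Qed.

Lemma rtight_reindex (I I' : Type) (J : I -> set int) (J' : I' -> set int)
    (phi : I' -> I) (x : I -> T -> C) : (forall i, J' i `<=` J (phi i)) ->
  rtight Z J x -> rtight Z J' (fun i => x (phi i)).
Proof.
move=> JJ' tx e e0; have [K K0 h] := tx _ e0; exists K => // i E sE.
by apply: h; apply: sigma_of_sub sE.
Qed.

Definition future (t : int) : set int := [set r | (t < r)%R].

Lemma rtight_pact (a : {poly C}) (x : int -> T -> C) : (forall t, cmeas (x t)) ->
  rtight Z future x -> rtight Z future (fun t w => pact a (x^~ w) t).
Proof.
move=> mx tx; rewrite /pact.
have := @rtight_sum _ _ _ _ _ Z _ future _ (index_enum 'I_(size a))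
  (fun (k : 'I_(size a)) t w => a`_k * x (t - k%:Z) w).
apply => [k t|k]; first exact: cmeasZ.
apply: (@rtightZ _ _ _ _ _ _ _ _ _ (nm a`_k)) => //.
apply: rtight_reindex tx => t r; rewrite /future /=; lia.
Qed.

(** Ottaviani's argument: at the first time [n] when [S n] is large, the
    remainder [y - S n] is unlikely to compensate it, whatever the noise that
    determines [S 0, ..., S n]; hence [y] itself is large with a comparable
    probability. *)
Lemma ottaviani_inequality (J : nat -> set int) (y : T -> C) (S : nat -> T -> C) :
  cmeas y -> (forall n i, (i <= n)%N -> cmeas (S i : sspace Z (J n) -> C)) ->
  (forall n, cmeas (S n)) ->
  rtight Z J (fun n w => y w - S n w) ->
  exists2 K : R, 0 < K & forall N,
    1 / 2 <= pr [set w | forall n, (n <= N)%N -> nm (S n w) <= K].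
Proof.
move=> my mSJ mS tR.
have [|K1 K10 hK1] := tR (1 / 2); first by lra.
have [|K2 K20 hK2] := tight1 P (cmeas_nm my) (e := 1 / 4); first by lra.
pose K := Num.max K1 K2.
have K0 : 0 < K by rewrite lt_max K10.
exists (2 * K); first by rewrite mulr_gt0.
pose B n : set T := [set w | forall i, (i < n)%N -> nm (S i w) <= 2 * K].
pose big n : set T := [set w | 2 * K < nm (S n w)].
have le_big n : ~` big n = [set w | nm (S n w) <= 2 * K].
  by apply/seteqP; split => w /=; [move=> /negP; rewrite -leNgt|rewrite leNgt => /negP].
have BS n : B n.+1 = B n `&` ~` big n.
  rewrite le_big; apply/seteqP; split => w /=.
    by move=> h; split => [i ni|]; apply: h => //; rewrite ltnW.
  by move=> [h1 h2] i; rewrite ltnS leq_eqVlt => /orP[/eqP->//|]; exact: h1.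
have sbig n i : (i <= n)%N -> sigma_of Z (J n) (big i).
  by move=> ni; apply: sspace_measurable; apply: measurable_gtr; apply: cmeas_nm; exact: mSJ.
have sB n k : (k <= n.+1)%N -> sigma_of Z (J n) (B k).
  elim: k => [|k ih] kn.
    rewrite (_ : B 0%N = setT); first by apply: sspace_measurable; exact: measurableT.
    by apply/seteqP; split => // w _ i.
  rewrite BS; apply: sspace_measurable; apply: measurableI; first exact: (ih (ltnW kn)).
  by apply: measurableC; apply: sbig.
have mbig n : measurable (big n) by apply: sigma_of_measurable (sbig n n _).
have mB n : measurable (B n) by apply: sigma_of_measurable (sB n n _).
pose Y : set T := [set w | K < nm (y w)].
have mY : measurable Y by apply: gt_nm_measurable.
have claim n : pr (~` B n) <= 2 * pr (~` B n `&` Y).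
  elim: n => [|n ih].
    rewrite (_ : ~` B 0%N = set0); first by rewrite set0I pr_set0; lra.
    by apply/seteqP; split => w //= h; exfalso; apply: h.
  have -> : ~` B n.+1 = ~` B n `|` (B n `&` big n).
    rewrite BS setCI setCK; apply/seteqP; split => w /=.
      by case=> h; [left|case: (pselect (B n w)); [right|left]].
    by case=> [h|[]]; [left|right].
  have mA : measurable (B n `&` big n) by apply: measurableI.
  have sA : sigma_of Z (J n) (B n `&` big n).
    by apply: sspace_measurable; apply: measurableI; [apply: sB|apply: sbig].
  have e1 := hK1 n _ sA.
  have mRn : measurable [set w | K1 < nm (y w - S n w)].
    by apply: gt_nm_measurable; exact: cmeasB.
  have e2 : pr (B n `&` big n) <= pr ([set w | K1 < nm (y w - S n w)] `&` (B n `&` big n)) +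
       pr ((B n `&` big n) `&` Y).
    apply: le_trans (prU_le _ _ _); [|exact: measurableI|exact: measurableI].
    apply: le_pr => //; first by apply: measurableU; apply: measurableI.
    move=> w [b1 b2]; case: (ltP K1 (nm (y w - S n w))) => b3; first by left.
    right; split => //; rewrite /Y /=.
    have := nmB (y w) (y w - S n w); rewrite opprB addrC subrK.
    have : K1 <= K by rewrite le_max lexx.
    by move: b2; rewrite /big /=; lra.
  have e3 : pr (~` B n `|` (B n `&` big n)) <= pr (~` B n) + pr (B n `&` big n).
    by apply: prU_le => //; exact: measurableC.
  have e4 : pr ((~` B n `|` (B n `&` big n)) `&` Y) =
      pr (~` B n `&` Y) + pr ((B n `&` big n) `&` Y).
    rewrite (@prDI _ _ _ P _ (B n))//; last first.
      by apply: measurableI => //; apply: measurableU => //; exact: measurableC.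
    congr (pr _ + pr _); apply/seteqP; split => w /=; tauto.
  by rewrite e4; lra.
move=> N.
have e5 : pr (~` B N.+1 `&` Y) <= 1 / 4.
  apply: (@le_trans _ _ (pr [set w | K2 < nm (y w)])) => //.
  apply: le_pr; [by apply: measurableI => //; exact: measurableC|exact: gt_nm_measurable|].
  move=> w [_]; rewrite /Y /=; apply: le_lt_trans.
  by rewrite le_max lexx orbT.
have := claim N.+1; rewrite prC// => e6.
rewrite (_ : [set w | _] = B N.+1); first by lra.
by apply/seteqP; split.
Qed.

End MaximalInequality.

(** * The noise and its linear combinations *)

Section Noise.
Local Open Scope sesquilinear_scope.
Context {R : realType} {disp : measure_display} {T : measurableType disp}.
Variable P : probability T R.
Local Notation C := (cplx R).
Local Notation pr := (pr P).
Variables (d : nat) (Z : int -> {RV P >-> 'cV[C]_d}).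
Variable U : 'M[C]_d.

Definition noise (k : 'I_d) (t : int) (w : T) : C := (U *m Z t w) k 0.
Definition comb (b : 'I_d -> C) (t : int) (w : T) : C := \sum_k b k * noise k t w.

Definition combv (b : 'I_d -> C) (x : 'cV[C]_d) : C := \sum_k b k * (U *m x) k 0.

Lemma combvE b t w : comb b t w = combv b (Z t w).
Proof. by []. Qed.

Lemma mulmx_entry_cmeas k : cmeas (fun x : 'cV[C]_d => (U *m x) k 0).
Proof.
under [X in cmeas X]eq_fun do rewrite mxE.
by apply: cmeas_sum => j; apply: cmeasZ; exact: entry_measurable.
Qed.

Lemma combv_cmeas b : cmeas (combv b).
Proof. by apply: cmeas_sum => k; apply: cmeasZ; exact: mulmx_entry_cmeas. Qed.

Lemma Z_measurable_in (J : set int) t : J t -> measurable_fun setT (Z t : sspace Z J -> _).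
Proof.
move=> Jt _ B mB; rewrite setTI.
by apply: sub_sigma_algebra; exists t => //; exists B => //; rewrite setTI.
Qed.

Lemma noise_cmeas_in (J : set int) k t : J t -> cmeas (noise k t : sspace Z J -> C).
Proof. by move=> Jt; exact: (cmeas_comp (mulmx_entry_cmeas k) (Z_measurable_in Jt)). Qed.

Lemma noise_cmeas k t : cmeas (noise k t).
Proof. by apply: (cmeas_comp (mulmx_entry_cmeas k)); exact: measurable_funPT. Qed.

Lemma comb_cmeas_in (J : set int) b t : J t -> cmeas (comb b t : sspace Z J -> C).
Proof. by move=> Jt; apply: cmeas_sum => k; apply: cmeasZ; exact: noise_cmeas_in. Qed.

Lemma comb_cmeas b t : cmeas (comb b t).
Proof. by apply: cmeas_sum => k; apply: cmeasZ; exact: noise_cmeas. Qed.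

Hypothesis hZ : iid Z.

Lemma rtight_noise k : rtight Z future (noise k).
Proof.
move=> e e0.
have [K K0 hK] := tight1 P (cmeas_nm (noise_cmeas k 0)) e0.
exists K => // t E sE.
rewrite (sigma_of_indep (J1 := [set t]) (J2 := future t) hZ)//.
- apply: ler_wpM2r; first exact: pr_ge0.
  apply: le_trans hK; rewrite le_eqVlt; apply/orP; left; apply/eqP.
  apply: (iid_marginal hZ t 0 (B := [set x | K < nm ((U *m x) k 0)])).
  by apply: measurable_gtr; apply: cmeas_nm; exact: mulmx_entry_cmeas.
- by apply/seteqP; split => // r [/= ->]; rewrite /future /= ltxx.
- by apply: sspace_measurable; apply: measurable_gtr; apply: cmeas_nm; exact: noise_cmeas_in.
Qed.

Variable s : nat.
Variable K : set 'cV[C]_d.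
Hypothesis hK : K = degenerate_directions (Z 0).
Hypothesis hU : U \is unitarymx.
Hypothesis hUK : [set U *m v | v in K] =
           [set v : 'cV[C]_d | forall i : 'I_d, (i < s)%N -> v i 0 = 0].

Lemma unitary_adjoint : U ^t* *m U = 1%:M.
Proof. by apply: mulmx1C; exact/unitarymxP. Qed.

Lemma adjoint_comb (b : 'cV[C]_d) (x : 'cV[C]_d) :
  ((U ^t* *m b) ^t* *m x) 0 0 = combv (fun k => Num.conj (b k 0)) x.
Proof.
rewrite mxE /combv.
under eq_bigr do rewrite !mxE rmorph_sum mulr_suml.
rewrite exchange_big; apply: eq_bigr => j _.
rewrite mxE mulr_sumr; apply: eq_bigr => k _.
rewrite !mxE rmorphM /= conjCK; ring.
Qed.

Lemma borel_set1 (c : C) : measurable ([set c] : set (borel_cplx R)).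
Proof.
have : measurable (~` [set c] : set (borel_cplx R)).
  apply: sub_sigma_algebra; apply: closed_openC.
  exact: accessible_closed_set1 (hausdorff_accessible (@norm_hausdorff _ _)) c.
by move=> /measurableC; rewrite setCK.
Qed.

(** The [k]-th coordinate of [U Z t] is the inner product of [Z t] with the
    vector that [U] maps to the [k]-th unit vector, which lies in [K] for
    [s <= k]. *)
Lemma noise_constant (k : 'I_d) : (s <= k)%N ->
  exists c : C, forall t, {ae P, forall w, noise k t w = c}.
Proof.
move=> sk.
have : [set v : 'cV[C]_d | forall i : 'I_d, (i < s)%N -> v i 0 = 0] (delta_mx k 0).
  by move=> i si; rewrite mxE; case: eqP => // ik; move: si; rewrite ik ltnNge sk.
rewrite -hUK => -[v Kv Uv].
have vE : v = U ^t* *m delta_mx k 0 by rewrite -Uv mulmxA unitary_adjoint mul1mx.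
move: Kv; rewrite hK vE => -[c hc]; exists c => t.
have nE (x : 'cV[C]_d) : ((U ^t* *m (delta_mx k 0 : 'cV[C]_d)) ^t* *m x) 0 0 = (U *m x) k 0.
  rewrite adjoint_comb /combv (bigD1 k)//= [delta_mx _ _ _ _]mxE !eqxx conjC1 mul1r.
  rewrite big1 ?addr0// => i ik.
  by rewrite [delta_mx _ _ _ _]mxE (negbTE ik) conjC0 mul0r.
have mS : measurable [set x : 'cV[C]_d | nm ((U *m x) k 0 - c) <= 0].
  apply: measurable_ler; apply: cmeas_nm; apply: cmeasB; last exact: cmeas_cst.
  exact: mulmx_entry_cmeas.
have p0 : pr (Z 0 @^-1` [set x : 'cV[C]_d | nm ((U *m x) k 0 - c) <= 0]) = 1.
  have := hc _ (borel_set1 c); rewrite diracE /pushforward mem_set//= /pr => h.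
  have e : Z 0 @^-1` [set x : 'cV[C]_d | nm ((U *m x) k 0 - c) <= 0] =
    (fun w => ((U ^t* *m (delta_mx k 0 : 'cV[C]_d)) ^t* *m Z 0 w) 0 0 : borel_cplx R)
      @^-1` [set c].
    apply/seteqP; split => w /=; rewrite nE.
      by rewrite le_eqVlt ltNge nm_ge0 orbF nm_eq0 subr_eq0 => /eqP.
    by move=> ->; rewrite subrr nm0.
  by rewrite e h.
have mt : measurable (Z t @^-1` [set x : 'cV[C]_d | nm ((U *m x) k 0 - c) <= 0]).
  exact: measurable_funPTI.
apply: (negligibleS (A := ~` (Z t @^-1` [set x : 'cV[C]_d | nm ((U *m x) k 0 - c) <= 0]))).
  move=> w /= h1 h2; apply: h1; apply/eqP; rewrite -subr_eq0 -nm_eq0.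
  by rewrite eq_le nm_ge0 andbT.
apply: pr0_negligible; first exact: measurableC.
by rewrite prC// (iid_marginal hZ t 0)// p0 subrr.
Qed.

(** If all real projections of [comb b] were degenerate, the vector that [U] maps
    to the conjugate of [b] would belong to [K], so the first [s] coordinates of
    [b] would vanish. *)
Lemma comb_nondegenerate (b : 'I_d -> C) : (forall k : 'I_d, (s <= k)%N -> b k = 0) ->
  (exists k, b k != 0) ->
  exists (v : C) (c c' : R), [/\ nm v = 1, c < c' & forall t,
    0 < pr [set w | rep (v * comb b t w) <= c] /\
    0 < pr [set w | c' <= rep (v * comb b t w)]].
Proof.
move=> bs [k0 bk0]; apply: contrapT => H.
pose vi : C := Complex 0 (-1).
have repvi z : rep (vi * z) = imp z.
  by rewrite repM /vi /rep /imp /= mul0r sub0r mulN1r opprK.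
have nvi : nm vi = 1.
  have : nm vi ^+ 2 = 1 by rewrite nm_sqr /vi /rep /imp /= expr0n add0r sqrrN expr1n.
  by move/eqP; rewrite sqrf_eq1 => /orP[/eqP//|/eqP h]; have := nm_ge0 vi; rewrite h; lra.
have degen v : nm v = 1 -> exists c : R, {ae P, forall w, rep (v * comb b 0 w) = c}.
  move=> v1; have [mv _] := cmeasZ v (comb_cmeas b 0).
  apply: real_degenerate => // c c' cc' p1 p2.
  apply: H; exists v, c, c'; split; [exact: v1|exact: cc'|move=> t].
  have [mvv _] := cmeasZ v (combv_cmeas b).
  split.
    rewrite [pr _](iid_marginal hZ t 0 (B := [set x | rep (v * combv b x) <= c]))//.
    exact: measurable_ler.
  rewrite [pr _](iid_marginal hZ t 0 (B := [set x | c' <= rep (v * combv b x)]))//.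
  exact: measurable_ger.
have [x hx] := degen 1 nm1; have [y hy] := degen vi nvi.
pose c : C := Complex x y.
have hc : {ae P, forall w, comb b 0 w = c}.
  apply: filterS2 hx hy => w; rewrite mul1r repvi => e1 e2.
  exact: cplx_eqP.
pose bv : 'cV[C]_d := \col_k Num.conj (b k).
have Kb : K (U ^t* *m bv).
  rewrite hK; exists c => B mB; rewrite /pushforward.
  have fE : (fun w => ((U ^t* *m bv) ^t* *m Z 0 w) 0 0 : borel_cplx R) = comb b 0.
    apply/funext => w; rewrite adjoint_comb combvE; congr combv.
    by apply/funext => k; rewrite mxE conjCK.
  rewrite fE.
  have mf : measurable (comb b 0 @^-1` B).
    have : <<s (@open C) >> B by exact: mB.
    suff : <<s (@open C) >> `<=` [set B | measurable (comb b 0 @^-1` B)] by apply.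
    apply: smallest_sub.
      split => /=.
      - by rewrite preimage_set0.
      - by move=> A mA; rewrite setTD preimage_setC; exact: measurableC.
      - by move=> A mA; rewrite preimage_bigcup; exact: bigcupT_measurable.
    move=> V oV /=.
    pose F w : 'M[C]_1 := \matrix_(i, j) comb b 0 w.
    have mF : measurable_fun setT F.
      apply: mx_measurable => i j.
      by under [X in cmeas X]eq_fun do rewrite mxE; exact: comb_cmeas.
    have oV1 : open [set M : 'M[C]_1 | V (M 0 0)].
      apply/mx_openP => M VM.
      move: oV; rewrite openE => /(_ _ VM) /nbhs_ballP[e e0 eV].
      have er : (e : C) \is Num.real by apply: gtr0_real.
      have eE : e = (complex.Re e)%:C by rewrite (RRe_real er).
      exists (complex.Re e); first by rewrite -(@ltcR R) -eE.
      by move=> N /(_ 0 0) MN; apply: eV; rewrite /ball /= eE -nm_lt.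
    have mV1 : measurable [set M : 'M[C]_1 | V (M 0 0)] by exact: sub_sigma_algebra.
    have := mF measurableT _ mV1.
    rewrite setTI (_ : F @^-1` _ = comb b 0 @^-1` V)//.
    by apply/seteqP; split => w /=; rewrite mxE.
  rewrite diracE; case: (pselect (B c)) => Bc.
    rewrite mem_set//=; have := @prE _ _ _ P _ mf => <-; congr EFin.
    apply/eqP; rewrite eq_le pr_le1//= -(pr_setT P).
    by apply: (pr_ae _ _ hc) => // w _; case: (pselect (comb b 0 w = c)) => e; [left; rewrite /= e|right].
  rewrite memNset//= mulr0n; have := @prE _ _ _ P _ mf => <-; congr EFin.
  apply/eqP; rewrite eq_le pr_ge0 andbT -(pr_set0 P).
  by apply: (pr_ae _ _ hc) => // w /= Bw; right => e; apply: Bc; rewrite -e.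
have : [set U *m v | v in K] bv.
  exists (U ^t* *m bv) => //; rewrite mulmxA.
  by have /unitarymxP -> := hU; rewrite mul1mx.
rewrite hUK => /= hb.
have [k0s|k0s] := ltnP k0 s; last by rewrite bs// eqxx in bk0.
have := hb k0 k0s; rewrite mxE => /eqP; rewrite conjC_eq0 => h.
by rewrite h in bk0.
Qed.

End Noise.

(** * The ARMA equation in scalar form *)

Section Rows.
Local Open Scope sesquilinear_scope.
Context {R : realType}.
Local Notation C := (cplx R).

Lemma pact_matrix_sum (n l : nat) (r : seq nat) (A : nat -> 'M[C]_(n, l))
    (f : int -> 'cV[C]_l) i t :
  \sum_j pact ((\sum_(k <- r) 'X^k *: constmxp (A k)) i j) (fun t => f t j 0) t =
  (\sum_(k <- r) A k *m f (t - k%:Z)) i 0.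
Proof.
under eq_bigr do rewrite summxE pact_suml.
rewrite exchange_big summxE; apply: eq_bigr => k _; rewrite mxE.
by apply: eq_bigr => j _; rewrite !mxE pactM pactXn pactC.
Qed.

Lemma ar_polyE (m p : nat) (Psi : nat -> 'M[C]_m) (f : int -> 'cV[C]_m) i t :
  \sum_j pact (ar_poly p Psi i j) (fun t => f t j 0) t =
  (f t - \sum_(1 <= k < p.+1) Psi k *m f (t - k%:Z)) i 0.
Proof.
rewrite /ar_poly; under eq_bigr do rewrite !mxE pactD pactN.
rewrite big_split /= sumrN pact_matrix_sum !mxE; congr (_ - _).
rewrite (bigD1 i)//= eqxx pact1 big1 ?addr0// => j ji.
by rewrite eq_sym (negbTE ji) pact0.
Qed.

Lemma ma_polyE (m d q : nat) (Theta : nat -> 'M[C]_(m, d)) (f : int -> 'cV[C]_d) i t :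
  \sum_j pact (ma_poly q Theta i j) (fun t => f t j 0) t =
  (\sum_(0 <= k < q.+1) Theta k *m f (t - k%:Z)) i 0.
Proof. exact: pact_matrix_sum. Qed.

Lemma pact_change_basis (m d : nat) (A : 'M[{poly C}]_(m, d)) (V U : 'M[C]_d)
    (f : int -> 'cV[C]_d) i t : V *m U = 1%:M ->
  \sum_j pact (A i j) (fun t => f t j 0) t =
  \sum_k pact ((A *m constmxp V) i k) (fun t => (U *m f t) k 0) t.
Proof.
move=> VU; under [RHS]eq_bigr do rewrite mxE pact_suml.
rewrite exchange_big; apply: eq_bigr => j _.
under eq_bigr do rewrite mxE pactM.
rewrite -pact_sumr; apply: pact_eq => u.
rewrite -[f u in LHS]mul1mx -VU -mulmxA mxE; apply: eq_bigr => k _.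
by rewrite pactC.
Qed.

Variables (m d q s : nat) (Theta : nat -> 'M[C]_(m, d)) (U : 'M[C]_d).
Hypothesis hU : U \is unitarymx.

Lemma reduced_ma_polyE i k : reduced_ma_poly q Theta U s i k =
  if (k < s)%N then (ma_poly q Theta *m constmxp (U ^t*)) i k else 0.
Proof.
rewrite /reduced_ma_poly constmxpM mulmxA.
set B := ma_poly q Theta *m _; rewrite mxE.
rewrite (bigD1 k)//= big1 ?addr0; last first.
  by move=> j jk; rewrite !mxE (_ : (val j == val k) = false) ?mulr0//; apply/negbTE.
by rewrite !mxE eqxx /=; case: ifP; rewrite ?mulr1 ?mulr0.
Qed.

Lemma ma_split (f : int -> 'cV[C]_d) i t :
  (\sum_(0 <= k < q.+1) Theta k *m f (t - k%:Z)) i 0 =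
  \sum_k pact (reduced_ma_poly q Theta U s i k) (fun t => (U *m f t) k 0) t +
  \sum_(k < d | (s <= k)%N)
     pact ((ma_poly q Theta *m constmxp (U ^t*)) i k) (fun t => (U *m f t) k 0) t.
Proof.
rewrite -ma_polyE (pact_change_basis _ _ _ _ (unitary_adjoint hU)).
rewrite [X in _ = _ + X]big_mkcond -big_split /=; apply: eq_bigr => k _.
by rewrite reduced_ma_polyE; case: ltnP => _; rewrite ?addr0 ?pact0 ?add0r.
Qed.

Lemma size_ma_poly i k : (size (ma_poly q Theta i k) <= q.+1)%N.
Proof.
rewrite /ma_poly summxE big_mkord; apply: (leq_trans (size_sum _ _ _)).
apply/bigmax_leqP => j _; rewrite !mxE.
by rewrite mulrC mul_polyC (leq_trans (size_scale_leq _ _))// size_polyXn ltn_ord.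
Qed.

Lemma size_reduced_ma_poly i k : (size (reduced_ma_poly q Theta U s i k) <= q.+1)%N.
Proof.
rewrite reduced_ma_polyE; case: ifP => _; last by rewrite size_poly0.
rewrite mxE; apply: (leq_trans (size_sum _ _ _)); apply/bigmax_leqP => j _.
rewrite [constmxp _ _ _]mxE mulrC mul_polyC (leq_trans (size_scale_leq _ _))//.
exact: size_ma_poly.
Qed.

Lemma size_ar_poly (p : nat) (Psi : nat -> 'M[C]_m) i k :
  (size (ar_poly p Psi i k) <= p.+1)%N.
Proof.
rewrite /ar_poly !mxE (leq_trans (size_polyD _ _))// geq_max size_polyN.
apply/andP; split.
  by rewrite -polyC_natr (leq_trans (size_polyC_leq1 _)).
rewrite summxE; apply: (leq_trans (size_sum _ _ _)).
apply/bigmax_leqP_seq => j.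
rewrite mem_index_iota => /andP[_ jp] _; rewrite !mxE.
by rewrite mulrC mul_polyC (leq_trans (size_scale_leq _ _))// size_polyXn.
Qed.

Lemma ar_poly_det0 (p : nat) (Psi : nat -> 'M[C]_m) : (\det (ar_poly p Psi)).[0] = 1.
Proof.
rewrite -det_evalmxp (_ : evalmxp _ _ = 1%:M) ?det1//.
apply/matrixP => i j; rewrite !mxE summxE hornerD hornerN -polyC_natr hornerC.
rewrite horner_sum big_seq big1 ?subr0// => k.
rewrite mem_index_iota => /andP[k0 _]; rewrite !mxE hornerM hornerXn expr0n.
by rewrite eqn0Ngt k0 mul0r.
Qed.

End Rows.

Section ScalarEquations.
Local Open Scope sesquilinear_scope.
Context {R : realType} {disp : measure_display} {T : measurableType disp}.
Variable P : probability T R.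
Local Notation C := (cplx R).
Variables (m d p q s : nat) (Z : int -> {RV P >-> 'cV[C]_d}).
Variables (Psi : nat -> 'M[C]_m) (Theta : nat -> 'M[C]_(m, d)) (U : 'M[C]_d).
Hypothesis hU : U \is unitarymx.
Hypothesis hconst : forall k : 'I_d, (s <= k)%N ->
  exists c : C, forall t, {ae P, forall w, noise Z U k t w = c}.

Local Notation Pz := (ar_poly p Psi).
Local Notation Qt := (reduced_ma_poly q Theta U s).

(** The coordinates of [U Z] from [s] on are constant, and a filter multiplies a
    constant by its value at 1; together they make up [cst]. *)
Lemma arma_rows : exists cst : 'I_m -> C, {ae P, forall w, forall (f : int -> 'cV[C]_m) t i,
  ((f t - \sum_(1 <= k < p.+1) Psi k *m f (t - k%:Z)) i 0 =
   (\sum_(0 <= k < q.+1) Theta k *m Z (t - k%:Z) w) i 0) <->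
  (\sum_j pact (Pz i j) (fun t => f t j 0) t =
   \sum_k pact (Qt i k) (fun t => noise Z U k t w) t + cst i)}.
Proof.
have /choice[kap hkap] : forall k : 'I_d, exists c : C, (s <= k)%N ->
    forall t, {ae P, forall w, noise Z U k t w = c}.
  move=> k; have [sk|sk] := leqP s k.
    by have [c hc] := hconst sk; exists c.
  by exists 0.
pose B := ma_poly q Theta *m constmxp (U ^t*).
exists (fun i => \sum_(k < d | (s <= k)%N) (B i k).[1] * kap k).
have : {ae P, forall w, forall k : 'I_d, (s <= k)%N -> forall t, noise Z U k t w = kap k}.
  apply: ae_forall_fin => k; have [sk|sk] := leqP s k.
    have := ae_forall_int (hkap k sk).
    by apply: filterS => w hw _; exact: hw.
  exact: aeW.
apply: filterS => w hw f t i.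
rewrite (ma_split q s Theta hU (fun t => Z t w)) ar_polyE.
have -> : \sum_(k < d | (s <= k)%N) pact (B i k) (fun t => (U *m Z t w) k 0) t =
    \sum_(k < d | (s <= k)%N) (B i k).[1] * kap k.
  apply: eq_bigr => k sk; rewrite -(pact_cst _ _ t); apply: pact_eq => u.
  exact: hw.
by split.
Qed.

End ScalarEquations.

(** * Logarithmic moments *)

Section LayerCake.
Context {R : realType} {disp : measure_display} {T : measurableType disp}.
Variable P : probability T R.
Local Notation C := (cplx R).
Local Notation pr := (pr P).

Lemma nneseries_pr_le (A : nat -> set T) (B : R) : (forall n, measurable (A n)) ->
  (forall N, \sum_(n < N) pr (A n) <= B) -> (\sum_(n <oo) P (A n) <= B%:E)%E.
Proof.
move=> mA hB; apply: lime_le; first exact: is_cvg_nneseries.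
apply: nearW => N; rewrite big_mkord.
rewrite (eq_bigr (fun n : 'I_N => (pr (A n))%:E)) => [|n _]; last by rewrite prE.
by rewrite sumEFin lee_fin hB.
Qed.

(** Layer-cake bounds: an integral is controlled by, and controls, the sum of
    the probabilities of exceeding the levels of an arithmetic progression. *)
Lemma expectation_lt_pinfty_layers (L : T -> R) (A : nat -> set T) (a b B : R) :
  measurable_fun setT L -> (forall w, 0 <= L w) -> 0 <= a -> 0 <= b ->
  (forall n, measurable (A n)) ->
  (forall w, exists2 n0 : nat, (forall n, (n < n0)%N -> A n w) & L w <= a + b * n0%:R) ->
  (forall N, \sum_(n < N) pr (A n) <= B) -> ('E_P[L] < +oo)%E.
Proof.
move=> mL L0 a0 b0 mA hL hB; rewrite unlock.
pose f n w : \bar R := (b * \1_(A n) w)%:E.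
have f0 n w : (0 <= f n w)%E by rewrite lee_fin mulr_ge0.
have mf n : measurable_fun setT (f n).
  apply/measurable_EFinP; apply: measurable_funM => //.
apply: (@le_lt_trans _ _ (\int[P]_w (a%:E + \sum_(n <oo) f n w))%E).
  have mS : measurable_fun setT (fun w => \sum_(n <oo) f n w)%E.
    by apply: ge0_emeasurable_sum.
  apply: ge0_le_integral => //.
  - by move=> w _; rewrite lee_fin.
  - exact/measurable_EFinP.
  - exact: (emeasurable_funD (measurable_cst _) mS).
  move=> w _; have [n0 An0 hw] := hL w.
  apply: (@le_trans _ _ (a%:E + \sum_(0 <= n < n0) f n w)%E); last first.
    by rewrite leeD2l// nneseries_lim_ge.
  rewrite (eq_big_nat _ _ (F2 := fun=> b%:E)); last first.
    by move=> n /andP[_ nn0]; rewrite /f indicE mem_set ?mulr1//; exact: An0.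
  rewrite sumEFin -EFinD lee_fin big_mkord sumr_const card_ord.
  by rewrite -[b *+ n0]mulr_natr.
rewrite ge0_integralD//; last 2 first.
- by move=> w _; rewrite nneseries_ge0.
- by apply: ge0_emeasurable_sum.
have -> : (\int[P]_w a%:E)%E = a%:E by have := expectation_cst P a; rewrite unlock.
rewrite integral_nneseries//.
apply: (@le_lt_trans _ _ (a%:E + (b * B)%:E)%E); last by rewrite -EFinD ltry.
rewrite leeD2l//.
rewrite (eq_eseriesr (g := fun n => (b%:E * P (A n))%E)); last first.
  move=> n _; rewrite /f; under eq_integral do rewrite EFinM.
  rewrite ge0_integralZl// ?integral_indic// ?setIT//.
  exact/measurable_EFinP.
rewrite nneseriesZl// EFinM; apply: lee_wpmul2l; first by rewrite lee_fin.
exact: nneseries_pr_le.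
Qed.

Lemma layers_le_expectation (L : T -> R) (b : R) :
  measurable_fun setT L -> (forall w, 0 <= L w) -> 0 < b -> ('E_P[L] < +oo)%E ->
  exists B : R, forall N, \sum_(n < N) pr [set w | b * n.+1%:R < L w] <= B.
Proof.
move=> mL L0 b0 fin.
have mA n : measurable [set w | b * n.+1%:R < L w] by exact: measurable_gtr.
have fn : ('E_P[L])%E \is a fin_num.
  by rewrite ge0_fin_numE// expectation_ge0.
exists (fine ('E_P[L])%E / b) => N; rewrite ler_pdivlMr// -lee_fin fineK//.
have eE : ('E_P[L] = \int[P]_w (L w)%:E)%E by rewrite unlock.
rewrite eE.
pose f n w : \bar R := (b * \1_[set w | b * n.+1%:R < L w] w)%:E.
have mf n : measurable_fun setT (f n).
  apply/measurable_EFinP; apply: measurable_funM => //.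
have e : (\int[P]_w (\sum_(n < N) f n w))%E = ((\sum_(n < N) pr [set w | b * n.+1%:R < L w]) * b)%:E.
  rewrite ge0_integral_sum//; last by move=> n w _; rewrite lee_fin mulr_ge0// ltW.
  rewrite mulr_suml -sumEFin; apply: eq_bigr => n _.
  rewrite /f; under eq_integral do rewrite EFinM.
  rewrite ge0_integralZl//; [|exact/measurable_EFinP|by rewrite lee_fin ltW].
  by rewrite integral_indic// setIT EFinM prE// muleC.
rewrite -e; apply: ge0_le_integral => //.
- by move=> w _; apply: sume_ge0 => n _; rewrite lee_fin mulr_ge0// ltW.
- by apply: emeasurable_sum.
- exact/measurable_EFinP.
move=> w _; rewrite sumEFin lee_fin.
have key k : (k <= N)%N -> \sum_(n < k) b * \1_[set w | b * n.+1%:R < L w] w <= L w /\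
    \sum_(n < k) b * \1_[set w | b * n.+1%:R < L w] w <= b * k%:R.
  elim: k => [|k ih] kN; first by rewrite big_ord0 mulr0.
  have [i1 i2] := ih (ltnW kN); rewrite !big_ord_recr /= indicE.
  have [h|h] := ltP (b * k.+1%:R) (L w).
    rewrite mem_set//= mulr1 -[k.+1]addn1 natrD mulrDr mulr1.
    by move: h; rewrite -[k.+1]addn1 natrD mulrDr mulr1; split; lra.
  rewrite memNset/= ?mulr0 ?addr0; last by apply/negP; rewrite -leNgt.
  by split => //; rewrite -[k.+1]addn1 natrD mulrDr mulr1; lra.
by have [] := key N (leqnn N).
Qed.

Lemma logplus_ge0 (x : R) : 0 <= logplus x.
Proof. by rewrite /logplus ln_ge0// le_max lexx. Qed.

Lemma logplus_measurable (f : T -> R) : measurable_fun setT f ->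
  measurable_fun setT (fun w => logplus (f w)).
Proof.
move=> mf; apply: (measurableT_comp (@measurable_ln R)).
by apply: measurable_maxr.
Qed.

Lemma logplus_le (x y : R) : x <= y -> logplus x <= logplus y.
Proof.
move=> xy; rewrite /logplus ler_ln ?posrE ?lt_max ?ltr01//.
by rewrite ge_max !le_max lexx xy orbT.
Qed.

Lemma logplusM (x y : R) : 0 <= x -> 0 <= y -> logplus (x * y) <= logplus x + logplus y.
Proof.
move=> x0 y0; rewrite /logplus -lnM ?posrE ?lt_max ?ltr01//.
rewrite ler_ln ?posrE ?mulr_gt0 ?lt_max ?ltr01//.
rewrite ge_max; apply/andP; split.
  by rewrite mulr_ege1// le_max lexx.
by apply: ler_pM => //; rewrite le_max lexx orbT.
Qed.

Lemma logplusX (x : R) n : 1 <= x -> logplus (x ^+ n) = ln x *+ n.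
Proof.
move=> x1; rewrite /logplus max_r ?exprn_ege1// lnXn// ?posrE//.
exact: lt_le_trans x1.
Qed.

Lemma logplus1D (x y : R) : 0 <= x -> 0 <= y -> logplus (x + y) <= ln 2 + (logplus x + logplus y).
Proof.
move=> x0 y0; rewrite /logplus -!lnM ?posrE ?mulr_gt0 ?lt_max ?ltr01//.
rewrite ler_ln ?posrE ?mulr_gt0 ?lt_max ?ltr01//.
set a := Num.max 1 x; set b := Num.max 1 y.
have a1 : 1 <= a by rewrite le_max lexx.
have b1 : 1 <= b by rewrite le_max lexx.
have ax : x <= a by rewrite le_max lexx orbT.
have bx : y <= b by rewrite le_max lexx orbT.
by rewrite ge_max; apply/andP; split; nra.
Qed.

End LayerCake.

Section VectorNorms.
Context {R : realType}.
Local Notation C := (cplx R).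
Variables (m : nat) (nrm : 'cV[C]_m -> R).
Hypothesis hnrm : is_norm nrm.

Lemma nrm_ge0 x : 0 <= nrm x. Proof. by have [h _ _ _] := hnrm; exact: h. Qed.

Lemma nrmZ a x : nrm (a *: x) = nm a * nrm x.
Proof.
have [_ _ h _] := hnrm; apply: (@complexI R).
by rewrite h -nmE -rmorphM.
Qed.

Lemma nrm0 : nrm 0 = 0.
Proof. by rewrite -(scale0r (0 : 'cV[C]_m)) nrmZ nm0 mul0r. Qed.

Lemma nrmD x y : nrm (x + y) <= nrm x + nrm y.
Proof. by have [_ _ _ h] := hnrm; exact: h. Qed.

Lemma nrm_sum (I : Type) (r : seq I) (F : I -> 'cV[C]_m) :
  nrm (\sum_(i <- r) F i) <= \sum_(i <- r) nrm (F i).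
Proof.
elim: r => [|i r ih]; first by rewrite !big_nil nrm0.
by rewrite !big_cons; apply: le_trans (nrmD _ _) _; rewrite lerD2l.
Qed.

Lemma nrm_le_entries : exists2 B : R, 0 <= B &
  forall x, nrm x <= B * \sum_i nm (x i 0).
Proof.
pose B := \sum_(i < m) nrm (delta_mx i 0); have B0 i : nrm (delta_mx i 0) <= B.
  by rewrite /B (bigD1 i)//= lerDl sumr_ge0// => j _; exact: nrm_ge0.
exists B; first by apply: sumr_ge0 => i _; exact: nrm_ge0.
move=> x; have {1}-> : x = \sum_i x i 0 *: delta_mx i 0.
  by rewrite {1}(matrix_sum_delta x); apply: eq_bigr => i _; rewrite big_ord1.
apply: le_trans (nrm_sum _ _) _; rewrite mulr_sumr; apply: ler_sum => i _.
by rewrite nrmZ mulrC ler_wpM2r// nm_ge0.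
Qed.

Lemma nrm_lipschitz : exists2 B : R, 0 < B &
  forall x y, `|nrm x - nrm y| <= B * \sum_i nm (x i 0 - y i 0).
Proof.
have [B B0 hB] := nrm_le_entries; exists (B + 1); first by rewrite ltr_wpDl.
have key x y : nrm x - nrm y <= (B + 1) * \sum_i nm (x i 0 - y i 0).
  have : nrm x <= nrm (x - y) + nrm y by rewrite -{1}(subrK y x) nrmD.
  have := hB (x - y); under eq_bigr do rewrite !mxE.
  have : 0 <= \sum_i nm (x i 0 - y i 0) by apply: sumr_ge0 => i _; exact: nm_ge0.
  by move: (\sum_i _) => S; nra.
move=> x y; rewrite ler_norml key andbT.
have := key y x; under eq_bigr do rewrite nm_distC.
by move=> h; rewrite lerNl opprB.
Qed.

Lemma nrm_measurable : measurable_fun setT nrm.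
Proof.
have [B B0 hB] := nrm_lipschitz.
apply: (measurability _ (RGenOInfty.measurableE R)) => //.
move=> _ [_ [r ->] <-]; rewrite setTI.
apply: sub_sigma_algebra; apply/mx_openP => M.
rewrite /= in_itv /= andbT => rM.
have e0 : 0 < (nrm M - r) / (B * m.+1%:R).
  by rewrite divr_gt0 ?subr_gt0// mulr_gt0.
exists ((nrm M - r) / (B * m.+1%:R)) => // N hN.
rewrite /= in_itv /= andbT.
have h1 : \sum_i nm (M i 0 - N i 0) <= m%:R * ((nrm M - r) / (B * m.+1%:R)).
  rewrite mulr_natl -[m in _ *+ m]card_ord -sumr_const.
  by apply: ler_sum => i _; apply: ltW; exact: hN.
have h2 : B * (m%:R * ((nrm M - r) / (B * m.+1%:R))) < nrm M - r.
  rewrite mulrA mulrCA -[X in _ < X]mulr1 ltr_pM2l ?subr_gt0//.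
  by rewrite ltr_pdivrMr ?mulr_gt0// mul1r ltr_pM2l// ltr_nat.
have := hB M N; rewrite ler_norml => /andP[_].
have : B * \sum_i nm (M i 0 - N i 0) <= B * (m%:R * ((nrm M - r) / (B * m.+1%:R))).
  by rewrite ler_wpM2l// ltW.
by move: (B * (m%:R * _)) h2 => y; lra.
Qed.

(* Real coordinates, in which the unit sphere is closed and bounded. *)
Let phi (r : 'rV[R]_(m + m)) : 'cV[C]_m :=
  \col_i (Complex (r 0 (lshift m i)) (r 0 (rshift m i)) : C).
Let psi (x : 'cV[C]_m) : 'rV[R]_(m + m) :=
  row_mx (\row_i rep (x i 0)) (\row_i imp (x i 0)).

Let psiK x : phi (psi x) = x.
Proof.
apply/colP => i; rewrite mxE row_mxEl row_mxEr !mxE.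
by apply: cplx_eqP.
Qed.

Let phiZ (a : R) r : phi (a *: r) = a%:C *: phi r.
Proof.
apply/colP => i; rewrite !mxE; apply: cplx_eqP.
  by rewrite repM rep_real imp_real mul0r subr0.
by rewrite impM rep_real imp_real mul0r addr0.
Qed.

Let phi0 r : phi r = 0 -> r = 0.
Proof.
move=> h; apply/rowP => j; rewrite [RHS]mxE.
case: (split_ordP j) => i ->.
  by have := congr1 (fun M : 'cV[C]_m => rep (M i 0)) h; rewrite !mxE.
by have := congr1 (fun M : 'cV[C]_m => imp (M i 0)) h; rewrite !mxE.
Qed.

Let entry_le_norm (r : 'rV[R]_(m + m)) j : `|r 0 j| <= `|r|.
Proof.
rewrite [leRHS]/Num.Def.normr /= mx_normrE; apply/bigmax_geP; right => /=.
by exists (0, j).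
Qed.

(** All norms on a finite-dimensional space are equivalent; the constant comes
    from the minimum of the norm on the compact unit sphere. *)
Lemma entries_le_nrm : exists2 B : R, 0 < B &
  forall (x : 'cV[C]_m) i, nm (x i 0) <= B * nrm x.
Proof.
have [B B0 hB] := nrm_lipschitz.
pose S := [set r : 'rV[R]_(m + m) | `|r| = 1].
have cS : compact S.
  apply: bounded_closed_compact.
    by exists 1; split => // y y1 r /= ->; exact: ltW.
  rewrite (_ : S = (fun r => `|r|) @^-1` [set 1]); last by [].
  apply: closed_comp; last exact: closed_eq.
  by move=> r _; exact: norm_continuous.
have cf : {within S, continuous (fun r => nrm (phi r))}.
  apply: continuous_subspaceT => r.
  have FF : Filter (nbhs r) := nbhs_filter r.
  apply/(@cvgrPdist_lt _ _ _ _ FF) => e e0.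
  have e1 : 0 < e / (B * (2 * m.+1%:R)) by rewrite divr_gt0// mulr_gt0// mulr_gt0.
  apply/nbhs_ballP; exists (e / (B * (2 * m.+1%:R))) => // t.
  rewrite -ball_normE /= => rt.
  apply: le_lt_trans (hB _ _) _.
  have h1 : \sum_i nm (phi r i 0 - phi t i 0) <= m%:R * (2 * `|r - t|).
    rewrite mulr_natl -[m in _ *+ m]card_ord -sumr_const.
    apply: ler_sum => i _; apply: le_trans (nm_le_rep_imp _) _.
    rewrite !mxE repB impB mulr_natl mulr2n; apply: lerD.
      by have := entry_le_norm (r - t) (lshift m i); rewrite !mxE.
    by have := entry_le_norm (r - t) (rshift m i); rewrite !mxE.
  apply: (@le_lt_trans _ _ (B * (m%:R * (2 * `|r - t|)))); first by rewrite ler_wpM2l// ltW.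
  have h2 : B * (m%:R * (2 * `|r - t|)) <= B * (2 * m.+1%:R) * `|r - t|.
    rewrite -!mulrA ler_wpM2l ?(ltW B0)// mulrCA ler_wpM2l// ler_wpM2r// ler_nat.
    by [].
  by apply: le_lt_trans h2 _; rewrite mulrC -ltr_pdivlMr ?mulr_gt0.
have [[r0 Sr0]|noS] := pselect (S !=set0); last first.
  exists 1 => // x i.
  have [->|x0] := eqVneq x 0; first by rewrite mxE nm0 nrm0 mulr0.
  exfalso; apply: noS; exists (`|psi x|^-1 *: psi x).
  have p0 : psi x != 0.
    apply: contra x0 => /eqP h; rewrite -(psiK x) h.
    by apply/eqP/colP => j; rewrite !mxE.
  by rewrite /S /= normrZ ger0_norm ?invr_ge0// mulVf// normr_eq0.
have [c cS' hc] := EVT_min_rV (ex_intro _ r0 Sr0) cS cf.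
have c1 : `|c| = 1 by move: cS'; rewrite inE.
have pc : 0 < nrm (phi c).
  rewrite lt_neqAle nrm_ge0 andbT eq_sym; apply/eqP => h.
  have [_ hz _ _] := hnrm.
  have := phi0 (hz _ h) => c0; move: c1; rewrite c0 normr0 => /eqP.
  by rewrite eq_sym oner_eq0.
exists (2 / nrm (phi c)); first by rewrite divr_gt0.
move=> x i.
have [->|x0] := eqVneq x 0; first by rewrite mxE nm0 nrm0 mulr0.
have p0 : psi x != 0.
  apply: contra x0 => /eqP h; rewrite -(psiK x) h.
  by apply/eqP/colP => j; rewrite !mxE.
have n0 : 0 < `|psi x| by rewrite normr_gt0.
have h1 : nrm (phi c) <= nrm (phi (`|psi x|^-1 *: psi x)).
  by apply: hc; rewrite inE /S /= normrZ ger0_norm ?invr_ge0// mulVf// gt_eqF.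
move: h1; rewrite phiZ psiK nrmZ nm_real ger0_norm ?invr_ge0// mulrC ler_pdivlMr// => h1.
have h2 : nm (x i 0) <= 2 * `|psi x|.
  apply: le_trans (nm_le_rep_imp _) _; rewrite mulr_natl mulr2n; apply: lerD.
    by have := entry_le_norm (psi x) (lshift m i); rewrite row_mxEl mxE.
  by have := entry_le_norm (psi x) (rshift m i); rewrite row_mxEr mxE.
rewrite mulrAC ler_pdivlMr//; have := nm_ge0 (x i 0); nra.
Qed.

End VectorNorms.

(** * Non-anticipative solutions force stability and moments *)

Lemma pact_cmeas (R : realType) (a : {poly cplx R}) d (W : measurableType d)
    (x : int -> W -> cplx R) t :
  (forall t, cmeas (x t)) -> cmeas (fun w => pact a (x^~ w) t).
Proof. by move=> mx; apply: cmeas_sum => k; exact: cmeasZ. Qed.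

Lemma cmeasN (R : realType) d (W : measurableType d) (f : W -> cplx R) :
  cmeas f -> cmeas (fun w => - f w).
Proof. by move=> mf; have := cmeasZ (-1) mf; under [X in cmeas X]eq_fun do rewrite mulN1r. Qed.

Lemma block_after (a b j L : nat) : (L + a <= b)%N -> (j < L)%N ->
  (- b%:Z < - a%:Z - j%:Z)%R.
Proof. lia. Qed.

Lemma block_before (a j : nat) : (- a%:Z - j%:Z <= - a%:Z)%R.
Proof. lia. Qed.

Lemma oppz_addn (a j : nat) : - (a + j)%N%:Z = - a%:Z - j%:Z.
Proof. lia. Qed.

Lemma partial_sum_block (V : zmodType) (F : nat -> V) (a L : nat) :
  \sum_(j < a + L) F j - \sum_(j < a) F j = \sum_(j < L) F (a + j)%N.
Proof. by rewrite big_split_ord /= addrAC subrr add0r. Qed.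

Lemma future_past_disjoint t : future t `&` [set u | (u <= t)%R] = set0.
Proof. by apply/seteqP; split => // u [] /=; rewrite /future /= => h1 /(lt_le_trans h1); rewrite ltxx. Qed.

Section Necessity.
Context {R : realType} {disp : measure_display} {T : measurableType disp}.
Variable P : probability T R.
Local Notation C := (cplx R).
Local Notation pr := (pr P).
Variables (m d s : nat) (Z : int -> {RV P >-> 'cV[C]_d}).
Hypothesis hZ : iid Z.
Variable U : 'M[C]_d.
Variables (Pm : 'M[{poly C}]_m) (Qm : 'M[{poly C}]_(m, d)) (cst : 'I_m -> C).
Variable Y : int -> {RV P >-> 'cV[C]_m}.
Hypothesis hEq : {ae P, forall w, forall t i,
  \sum_j pact (Pm i j) (fun t => Y t w j 0) t =
  \sum_k pact (Qm i k) (fun t => noise Z U k t w) t + cst i}.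
Hypothesis hstat : strictly_stationary Y.
Hypothesis hna : non_anticipative Z Y.
Hypothesis hnd : forall b : 'I_d -> C, (forall k : 'I_d, (s <= k)%N -> b k = 0) ->
  (exists k, b k != 0) ->
  exists (v : C) (c c' : R), [/\ nm v = 1, c < c' & forall t,
    0 < pr [set w | rep (v * comb Z U b t w) <= c] /\
    0 < pr [set w | c' <= rep (v * comb Z U b t w)]].
Hypothesis hQ0 : forall i (k : 'I_d), (s <= k)%N -> Qm i k = 0.
Hypothesis hpbh : forall z (w : 'rV[C]_m), w != 0 -> w *m evalmxp Pm z = 0 ->
  w *m evalmxp Qm z != 0.
Hypothesis hdet : (\det Pm).[0] = 1.

Lemma Y_cmeas j t : cmeas (fun w => Y t w j 0).
Proof. by apply: cmeas_entry; exact: measurable_funPT. Qed.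

Lemma Y_marginal t (B : set 'cV[C]_m) : measurable B ->
  pr (Y t @^-1` B) = pr (Y 0 @^-1` B).
Proof.
move=> mB; have := hstat (n := 1%N) (fun=> 0) t mB.
have jE u : joint Y (fun _ : 'I_1 => u) = Y u.
  by apply/funext => w; apply/matrixP => i j; rewrite mxE !ord1.
by rewrite !jE add0r /pr => ->.
Qed.

Lemma Y_indep t (B : set 'cV[C]_m) E : measurable B -> sigma_of Z (future t) E ->
  pr (Y t @^-1` B `&` E) = pr (Y t @^-1` B) * pr E.
Proof.
move=> mB sE; have mE := sigma_of_measurable sE.
have mYB : measurable (Y t @^-1` B) by exact: measurable_funPTI.
by rewrite /pr (hna mB sE) fineM// fin_num_measure.
Qed.

(** Stationarity gives tightness uniformly in time, non-anticipation the
    conditioning on the future noise. *)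
Lemma rtight_Y j : rtight Z future (fun t w => Y t w j 0).
Proof.
move=> e e0; have [K K0 hK] := tight1 P (cmeas_nm (Y_cmeas j 0)) e0.
exists K => // t E sE.
have mB : measurable [set x : 'cV[C]_m | K < nm (x j 0)].
  by apply: measurable_gtr; apply: cmeas_nm; exact: entry_measurable.
rewrite [X in pr (X `&` _)](_ : _ = Y t @^-1` [set x : 'cV[C]_m | K < nm (x j 0)])//.
rewrite Y_indep//; apply: ler_wpM2r; first exact: pr_ge0.
by rewrite Y_marginal.
Qed.

(** Left multiplication by an eigenvector at the root [z0] reduces the system
    to a scalar autoregression of order one driven by [comb b]. *)
Lemma scalar_autoregression z0 : (\det Pm).[z0] = 0 ->
  exists (b : 'I_d -> C) (c : C) (x : int -> T -> C),
  [/\ (forall k : 'I_d, (s <= k)%N -> b k = 0), (exists k, b k != 0),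
    (forall t, cmeas (x t)), rtight Z future x &
    {ae P, forall w, forall t, x (t - 1) w - z0 * x t w = comb Z U b t w + c}].
Proof.
rewrite -det_evalmxp => /eqP /det0P[w w0 wP].
have wQ := hpbh w0 wP.
pose b k := (w *m evalmxp Qm z0) 0 k.
have /choice[r hr] : forall j, exists q : {poly C},
    \sum_i (w 0 i)%:P * Pm i j = ('X - z0%:P) * q.
  move=> j.
  have /factor_theorem[q hq] : root (\sum_i (w 0 i)%:P * Pm i j) z0.
    rewrite /root horner_sum; have := congr1 (fun M : 'rV_m => M 0 j) wP.
    rewrite !mxE => h; rewrite -[X in _ == X]h; apply/eqP; apply: eq_bigr => i _.
    by rewrite hornerM hornerC mxE.
  by exists q; rewrite mulrC.
have /choice[g hg] : forall k, exists q : {poly C},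
    \sum_i (w 0 i)%:P * Qm i k - (b k)%:P = ('X - z0%:P) * q.
  move=> k.
  have /factor_theorem[q hq] : root (\sum_i (w 0 i)%:P * Qm i k - (b k)%:P) z0.
    rewrite /root hornerD hornerN hornerC horner_sum /b mxE subr_eq0; apply/eqP.
    by apply: eq_bigr => i _; rewrite hornerM hornerC mxE.
  by exists q; rewrite mulrC.
pose x t om := \sum_j pact (r j) (fun t => Y t om j 0) t -
               \sum_k pact (g k) (fun t => noise Z U k t om) t.
have m1 j t : cmeas (fun om => pact (r j) (fun t => Y t om j 0) t).
  by apply: (@pact_cmeas _ _ _ _ (fun t om => Y t om j 0)) => u; exact: Y_cmeas.
have m2 k t : cmeas (fun om => pact (g k) (fun t => noise Z U k t om) t).
  by apply: (@pact_cmeas _ _ _ _ (noise Z U k)) => u; exact: noise_cmeas.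
exists b, (\sum_i w 0 i * cst i), x; split.
- move=> k sk; rewrite /b mxE big1// => i _.
  by rewrite [evalmxp _ _ _ _]mxE (hQ0 i sk) horner0 mulr0.
- apply: contrapT => h; move/eqP: wQ; apply; apply/rowP => k; rewrite [RHS]mxE.
  by apply/eqP; apply/negPn/negP => hk; apply: h; exists k.
- by move=> t; apply: cmeasB; apply: cmeas_sum.
- have -> : x = fun t om => \sum_j pact (r j) (fun t => Y t om j 0) t +
     -1 * \sum_k pact (g k) (fun t => noise Z U k t om) t.
    by apply/funext => t; apply/funext => om; rewrite mulN1r.
  apply: rtightD => [t|t||].
  + exact: cmeas_sum.
  + by apply: cmeasZ; exact: cmeas_sum.
  + apply: rtight_sum => // j.
    by apply: (rtight_pact (r j) _ (rtight_Y j)) => t; exact: Y_cmeas.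
  + apply: (@rtightZ _ _ _ _ _ _ _ _ (fun=> -1) 1) => [t|t|].
    * exact: cmeas_sum.
    * by rewrite nmN nm1.
    * apply: rtight_sum => // k.
      by apply: (rtight_pact (g k) _ (rtight_noise U hZ k)) => t; exact: noise_cmeas.
apply: filterS hEq => om hom t.
have -> : x (t - 1) om - z0 * x t om =
   \sum_j pact (('X - z0%:P) * r j) (fun t => Y t om j 0) t -
   \sum_k pact (('X - z0%:P) * g k) (fun t => noise Z U k t om) t.
  under eq_bigr do rewrite mulrBl mulrC pactB pactMX mul_polyC pactZ.
  under [X in _ = _ - X]eq_bigr do rewrite mulrBl mulrC pactB pactMX mul_polyC pactZ.
  rewrite !sumrB -!mulr_sumr /x; ring.
under eq_bigr do rewrite -hr pact_suml.
under [X in _ - X = _]eq_bigr do rewrite -hg pactB pact_suml pactC.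
rewrite sumrB exchange_big [X in _ - (X - _) = _]exchange_big /=.
rewrite opprB addrCA; congr (_ + _).
rewrite -sumrB; apply: eq_bigr => i _.
under eq_bigr do rewrite pactM pactC.
under [X in _ - X = _]eq_bigr do rewrite pactM pactC.
by rewrite -!mulr_sumr hom; ring.
Qed.

(** By independence and equal laws; the centers [v j] allow for prescribed
    patterns of values. *)
Lemma block_pattern_prob (b : nat -> 'I_d -> C) (v : nat -> C) (r : R) (L : nat) (t0 : int) :
  pr (\bigcap_(j in [set j | (j < L)%N]) [set w | nm (comb Z U (b j) (t0 - j%:Z) w - v j) <= r]) =
  \prod_(j < L) pr [set w | nm (comb Z U (b j) 0 w - v j) <= r].
Proof.
pose B (t : int) : set 'cV[C]_d := [set x | nm (combv U (b (absz (t0 - t))) x - v (absz (t0 - t))) <= r].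
have mB t : measurable (B t).
  by apply: measurable_ler; apply: cmeas_nm; apply: cmeasB; [exact: combv_cmeas|exact: cmeas_cst].
have e1 (j : nat) : absz (t0 - (t0 - j%:Z))%R = j by lia.
pose sq := [seq t0 - j%:Z | j <- iota 0 L].
rewrite (_ : \bigcap_(j in _) _ = \bigcap_(t in [set t | t \in sq]) Z t @^-1` B t).
  rewrite (iid_cylinder hZ)//; last first.
    rewrite map_inj_in_uniq ?iota_uniq// => i j _ _; lia.
  have -> : sq = [seq t0 - j%:Z | j <- index_iota 0 L] by rewrite /index_iota subn0.
  rewrite big_map big_mkord; apply: eq_bigr => j _.
  rewrite (iid_marginal hZ _ 0)// /B e1.
  by [].
apply/seteqP; split => w /=.
  move=> h t /= /mapP[j]; rewrite mem_iota add0n => /andP[_ jL] ->.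
  by rewrite /B /= e1; exact: h.
move=> h j /= jL; have := h (t0 - j%:Z); rewrite /B /= e1; apply.
by apply: map_f; rewrite mem_iota.
Qed.

(** A root on the unit circle would make the walk with the rotated steps
    [lam ^+ j * comb b (-j)] bounded in probability, although every block of
    steps has the same positive chance of a large excursion. *)
Lemma no_unit_root z0 : nm z0 = 1 -> (\det Pm).[z0] != 0.
Proof.
move=> z01; apply/eqP => /scalar_autoregression [b [c [x [bs b0 mx tx xE]]]].
have z0n : z0 != 0 by rewrite -nm_gt0 z01.
pose lam := z0^-1; have lam1 : nm lam = 1 by rewrite nmV z01 invr1.
have lamX n : nm (lam ^+ n) = 1 by rewrite nmX lam1 expr1n.
(* iterating the autoregression backwards, [x 0 = S n + lam ^+ n * x (- n)] *)
pose S (n : nat) w := - \sum_(j < n) lam ^+ j.+1 * (comb Z U b (- j%:Z) w + c).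
have mS (n : nat) : cmeas (S n).
  apply: cmeasN; apply: cmeas_sum => j.
  by apply: cmeasZ; apply: cmeasD; [exact: comb_cmeas|exact: cmeas_cst].
have mSJ (n i : nat) : (i <= n)%N ->
    cmeas (S i : sspace Z (future (- n%:Z)) -> C).
  move=> ni; apply: cmeasN; apply: cmeas_sum => j.
  apply: cmeasZ; apply: cmeasD; last exact: cmeas_cst.
  by apply: comb_cmeas_in; rewrite /future /=; have := ltn_ord j; lia.
have xS : {ae P, forall w, forall n : nat, x 0 w - S n w = lam ^+ n * x (- n%:Z) w}.
  apply: filterS xE => w hw; elim=> [|n ih].
    by rewrite /S big_ord0 oppr0 subr0 expr0 mul1r oppr0.
  have -> : x 0 w - S n.+1 w = x 0 w - S n w + lam ^+ n.+1 * (comb Z U b (- n%:Z) w + c).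
    by rewrite /S big_ord_recr /=; ring.
  rewrite ih -(hw (- n%:Z)) (_ : - n%:Z - 1 = - n.+1%:Z); last by lia.
  by rewrite exprS /lam; field.
have tR : rtight Z (fun n => future (- n%:Z)) (fun n w => x 0 w - S n w).
  apply: (@rtight_ae _ _ _ _ _ _ _ _ (fun n w => lam ^+ n * x (- n%:Z) w)).
  - by move=> n; exact: cmeasZ.
  - by move=> n; exact: cmeasB.
  - by move=> n; apply: filterS xS => w ->.
  - apply: (@rtightZ _ _ _ _ _ _ _ _ _ 1) => //.
      by move=> n; rewrite lamX.
    by apply: rtight_reindex tx => n.
have [K K0 hK] := ottaviani_inequality (mx 0) mSJ mS tR.
have [v0 [c1 [c1' [v01 cc' hp]]]] := hnd bs b0.
have [p1 p2] := hp 0.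
have [a [a' [r [r0 raa' pa pa']]]] := two_balls (comb_cmeas Z U b 0) v01 cc' p1 p2.
have aa' : a != a' by rewrite -subr_eq0 -nm_gt0; lra.
have [L [v [hv KL big]]] := large_pattern c (2 * K) (fun j => lamX j.+1) aa'.
(* the [k]-th block of [L] consecutive steps follows the pattern [v] *)
pose G (k : nat) : set T := \bigcap_(j in [set j | (j < L)%N])
  [set w | nm (comb Z U b (- (k * L)%N%:Z - j%:Z) w - v j) <= r].
pose eta := \prod_(j < L) pr [set w | nm (comb Z U b 0 w - v j) <= r].
have Geta k : pr (G k) = eta by exact: (block_pattern_prob (fun=> b)).
have eta0 : 0 < eta by apply: prodr_gt0 => j _; case: (hv j) => ->.
have sG k (J : set int) : (forall j : nat, (j < L)%N -> J (- (k * L)%N%:Z - j%:Z)) ->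
    sigma_of Z J (G k).
  move=> hJ; apply: sspace_measurable.
  apply: fin_bigcap_measurable; first exact: finite_II.
  move=> j jL; apply: measurable_ler; apply: cmeas_nm; apply: cmeasB; last exact: cmeas_cst.
  by apply: comb_cmeas_in; exact: hJ.
pose A N : set T := \bigcap_(k in [set k | (k < N)%N]) ~` G k.
have AS N : A N.+1 = A N `&` ~` G N.
  apply/seteqP; split => w /=.
    by move=> h; split => [k kN|]; apply: h => //=; rewrite ltnW.
  by move=> [h1 h2] k /=; rewrite ltnS leq_eqVlt => /orP[/eqP->//|]; exact: h1.
have sA N : sigma_of Z (future (- (N * L)%N%:Z)) (A N).
  apply: sspace_measurable; apply: fin_bigcap_measurable; first exact: finite_II.
  move=> k kN; apply: measurableC; apply: sG => j jL; rewrite /future /=.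
  have : (k.+1 * L <= N * L)%N by rewrite leq_mul2r kN orbT.
  by rewrite mulSn => kL; apply: block_after kL jL.
have mG k : measurable (G k).
  by apply: (sigma_of_measurable (sG k setT _)).
have pA N : pr (A N) = (1 - eta) ^+ N.
  elim: N => [|N ih].
    rewrite expr0 (_ : A 0%N = setT) ?pr_setT//.
    by apply/seteqP; split => // w _ k.
  rewrite AS exprSr -ih -(Geta N) -prC//.
  apply: (sigma_of_indep (J1 := future (- (N * L)%N%:Z)) (J2 := [set u | u <= - (N * L)%N%:Z]) hZ) => //.
    exact: future_past_disjoint.
  apply: sspace_measurable; apply: measurableC; apply: sG => j jL /=.
  exact: block_before.
have mA N : measurable (A N) by exact: (sigma_of_measurable (sA N)).
(* a block following the pattern makes the walk move by more than [2 * K] *)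
have sub N : [set w | forall n, (n <= N * L)%N -> nm (S n w) <= K] `<=` A N.
  move=> w /= hw k /= kN Gk.
  have hL1 : (k * L <= N * L)%N by rewrite leq_mul2r ltnW ?orbT.
  have hL2 : (k * L + L <= N * L)%N by rewrite addnC -mulSn leq_mul2r kN orbT.
  have d1 := hw _ hL1; have d2 := hw _ hL2.
  have e1 : S (k * L + L)%N w - S (k * L)%N w =
     - (lam ^+ (k * L)%N * \sum_(j < L) lam ^+ j.+1 * (comb Z U b (- (k * L)%N%:Z - j%:Z) w + c)).
    rewrite /S -opprD; congr (- _).
    rewrite (partial_sum_block (fun j => lam ^+ j.+1 * (comb Z U b (- j%:Z) w + c))).
    rewrite mulr_sumr; apply: eq_bigr => j _.
    by rewrite mulrA -exprD addnS oppz_addn.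
  have e2 : nm (\sum_(j < L) lam ^+ j.+1 * (comb Z U b (- (k * L)%N%:Z - j%:Z) w + c)) <= 2 * K.
    have := nmB (S (k * L + L)%N w) (S (k * L)%N w); rewrite e1 nmN nmM lamX mul1r.
    lra.
  have e3 : nm (\sum_(j < L) lam ^+ j.+1 * (v j + c)) <=
      nm (\sum_(j < L) lam ^+ j.+1 * (comb Z U b (- (k * L)%N%:Z - j%:Z) w + c)) + L%:R * r.
    rewrite -[X in nm X <= _](subrK (\sum_(j < L) lam ^+ j.+1 * (comb Z U b (- (k * L)%N%:Z - j%:Z) w + c))).
    apply: le_trans (nmD _ _) _; rewrite addrC lerD2l -sumrB.
    apply: le_trans (nm_sum _ _ _) _.
    apply: (@le_trans _ _ (\sum_(j < L) r)); last by rewrite sumr_const card_ord mulr_natl.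
    apply: ler_sum => j _; rewrite -mulrBr nmM lamX mul1r nm_distC opprD addrACA subrr addr0.
    by apply: (Gk j) => /=.
  have e4 : 100 * (r * L%:R) <= nm (a - a') * L%:R by rewrite mulrA ler_wpM2r.
  move: big KL e2 e3 e4; rewrite [L%:R * r]mulrC; lra.
have [N hN] : exists N, (1 - eta) ^+ N < 1 / 2.
  apply: expr_lt_eventually; [|lra|lra].
  rewrite subr_ge0 -(Geta 0%N); exact: pr_le1.
have := hK (N * L)%N; apply/negP; rewrite -ltNge; apply: le_lt_trans hN.
rewrite -pA; apply: le_pr (mA N) (sub N).
rewrite (_ : [set w | _] = \bigcap_(n in [set n | (n < (N * L).+1)%N]) [set w | nm (S n w) <= K]).
  apply: fin_bigcap_measurable; first exact: finite_II.
  by move=> n _; apply: measurable_ler; exact: cmeas_nm.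
by apply/seteqP; split => w h n; exact: h.
Qed.

(** Eliminating the other components by the adjugate matrix. *)
Lemma adjugate_equation i : exists c : C, {ae P, forall w, forall t,
  pact (\det Pm) (fun t => Y t w i 0) t =
  \sum_k pact ((\adj Pm *m Qm) i k) (fun t => noise Z U k t w) t + c}.
Proof.
exists (\sum_l ((\adj Pm) i l).[1] * cst l).
apply: filterS hEq => w hw t.
have : \sum_l pact ((\adj Pm) i l) (fun t => \sum_j pact (Pm l j) (fun t => Y t w j 0) t) t =
  \sum_l pact ((\adj Pm) i l) (fun t => \sum_k pact (Qm l k) (fun t => noise Z U k t w) t + cst l) t.
  by apply: eq_bigr => l _; apply: pact_eq => u; exact: hw.
under eq_bigr do rewrite pact_sumr.
rewrite exchange_big /=.
under eq_bigr do (under eq_bigr do rewrite -pactM).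
under eq_bigr do rewrite -pact_suml.
under [X in _ = X -> _]eq_bigr do rewrite pactDr pact_sumr pact_cst.
rewrite big_split /= exchange_big /=.
under [X in _ = X + _ -> _]eq_bigr do (under eq_bigr do rewrite -pactM).
under [X in _ = X + _ -> _]eq_bigr do rewrite -pact_suml.
have e1 : \sum_(j < m) pact (\sum_(l < m) (\adj Pm) i l * Pm l j) (fun t => Y t w j 0) t =
    pact (\det Pm) (fun t => Y t w i 0) t.
  have h j : \sum_(l < m) (\adj Pm) i l * Pm l j = (\det Pm)%:M i j.
    by rewrite -mul_adj_mx mxE.
  under eq_bigr do rewrite h mxE.
  rewrite (bigD1 i)//= eqxx mulr1n big1 ?addr0// => j ji.
  by rewrite eq_sym (negbTE ji) mulr0n pact0.
rewrite e1 => ->; congr (_ + _); apply: eq_bigr => k _.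
by rewrite mxE.
Qed.

Let utight (x : int -> T -> C) := rtight Z (fun _ : int => set0) x.

Lemma rtight_utight (x : int -> T -> C) : rtight Z future x -> utight x.
Proof. by move=> h; apply: (rtight_reindex (phi := id)) h => t; exact: sub0set. Qed.

(** Rescaled by [rho ^- M], the filtered process is still tight. *)
Lemma small_filter (x : int -> T -> C) (r : nat -> {poly C}) (D : nat) (K rho : R) :
  (forall t, cmeas (x t)) -> utight x -> 0 <= K -> 0 < rho < 1 ->
  (forall M, (size (r M) <= D)%N) -> (forall M i, nm (r M)`_i <= K * rho ^+ M) ->
  forall e del : R, 0 < e -> 0 < del -> exists M0 : nat, forall M t, (M0 <= M)%N ->
    pr [set w | e < nm (pact (r M) (x^~ w) t)] <= del.
Proof.
move=> mx tx K0 /andP[rho0 rho1] sr cr e del e0 del0.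
have rM M : 0 < rho ^+ M by rewrite exprn_gt0.
pose J (Mt : nat * int) : set int := set0.
pose z (Mt : nat * int) w := \sum_(k < D)
  ((rho ^- Mt.1)%:C * (r Mt.1)`_k) * x (Mt.2 - k%:Z) w.
have tz : rtight Z J z.
  apply: (@rtight_sum _ _ _ _ _ _ _ _ _ _ (fun (k : 'I_D) Mt w =>
     ((rho ^- Mt.1)%:C * (r Mt.1)`_k) * x (Mt.2 - k%:Z) w)) => [k Mt|k].
    exact: cmeasZ.
  apply: (@rtightZ _ _ _ _ _ _ _ _ _ K) => [Mt|Mt|].
  - by [].
  - rewrite nmM nm_real ger0_norm ?invr_ge0 ?(ltW (rM _))//.
    by rewrite mulrC ler_pdivrMr// cr.
  - by apply: (@rtight_reindex _ _ _ _ _ Z _ _ (fun=> set0) J (fun Mt : nat * int => Mt.2 - k%:Z) x) => // Mt r0.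
have [K1 K10 hK1] := tz del del0.
have [M0 hM0] : exists M0, rho ^+ M0 < e / K1.
  by apply: expr_lt_eventually => //; [exact: ltW|exact: divr_gt0].
exists M0 => M t MM0.
have := hK1 (M, t) setT (sspace_measurable (@measurableT _ (sspace Z set0))).
rewrite setIT pr_setT mulr1; apply: le_trans; apply: le_pr.
- by apply: gt_nm_measurable; exact: pact_cmeas.
- by apply: gt_nm_measurable; apply: cmeas_sum => k; exact: cmeasZ.
move=> w /= hw.
have zE : z (M, t) w = (rho ^- M)%:C * pact (r M) (x^~ w) t.
  by rewrite (pact_wide _ _ (sr M)) mulr_sumr; apply: eq_bigr => k _; rewrite mulrA.
rewrite zE nmM nm_real ger0_norm ?invr_ge0 ?(ltW (rM _))//.
rewrite mulrC ltr_pdivlMr//; apply: le_lt_trans hw.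
rewrite mulrC -ler_pdivlMr//; apply: le_trans (ltW hM0).
by rewrite ler_wiXn2l// ltW.
Qed.

Lemma noise_masked_cmeas_in k l t :
  cmeas ((fun w => if t == l then 0 else noise Z U k t w) : sspace Z [set r | r != l] -> C).
Proof.
case: eqP => [_|/eqP tl]; first exact: cmeas_cst.
exact: noise_cmeas_in.
Qed.

Section root_decomposition.
Variables (kap : C) (ls zs : seq C).
Hypothesis kap0 : kap != 0.
Hypothesis hls : forall l, l \in ls -> nm l < 1.
Hypothesis hzs : forall z, z \in zs -> nm z < 1.
Let al : {poly C} := \prod_(l <- ls) (1 - l *: 'X).
Let u : {poly C} := \prod_(z <- zs) ('X - z%:P).
Hypothesis detE : \det Pm = kap *: (al * u).

Let mu : u \is monic. Proof. exact: monic_prod_XsubC. Qed.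

Lemma stable_factor_nonzero z : nm z < 1 -> al.[z] != 0.
Proof.
move=> z1; rewrite /al horner_prod prodf_seq_neq0; apply/allP => l lls /=.
rewrite hornerD hornerN hornerZ hornerX hornerC subr_eq0; apply/eqP => h.
have := congr1 nm h; rewrite nm1 nmM => h1.
have := hls lls; have := nm_ge0 l; have := nm_ge0 z; nra.
Qed.

Lemma coprime_stable_unstable : coprimep al u.
Proof.
rewrite /u; have : forall z, z \in zs -> nm z < 1 by exact: hzs.
elim: zs => [|z zs' ih] h; first by rewrite big_nil coprimep1.
rewrite big_cons coprimepMr ih ?andbT; last by move=> y ys; apply: h; rewrite inE ys orbT.
rewrite coprimep_XsubC /root stable_factor_nonzero// h// inE eqxx.
by [].
Qed.

(** The expansion of [Y] along the noise: the stable factor is inverted into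
    the past, the unstable one into the future, and the error is small in
    probability. Non-anticipation then kills the coefficients of the future
    noise. *)
Lemma future_coefficient_zero (x0 y0 : {poly C}) (i : 'I_m) (l M : nat) :
  y0 * al + x0 * u = 1 -> (0 < l)%N -> (l <= M)%N ->
  (forall k, (size (y0 * (\adj Pm *m Qm) i k)%R <= M.+1 - l)%N) ->
  forall k, (y0 * (\adj Pm *m Qm) i k * ('X^M %/ u))`_(M - l) = 0.
Proof.
move=> bez l0 lM sz k1.
have [cc hcc] := adjugate_equation i.
pose y t w := Y t w i 0.
pose n k := kap^-1 *: (\adj Pm *m Qm) i k.
pose c := kap^-1 * cc.
pose e w t := \sum_k pact (n k) (fun t => noise Z U k t w) t + c.
have eE : {ae P, forall w, forall t, pact (al * u) (y^~ w) t = e w t}.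
  apply: filterS hcc => w hw t.
  have := hw t; rewrite detE pactZ => h.
  rewrite /e /c; under eq_bigr do rewrite /n pactZ.
  by rewrite -mulr_sumr -mulrDr -h mulrA mulVf// mul1r.
have [a [Ka [ra [Ka0 ra01 ha inva]]]] := stable_inverse hls.
rewrite -/al in inva.
have [K1 K10 hK1] := truncated_inverse Ka0 ra01 ha inva.
have /choice[r hr] : forall N, exists r : {poly C}, (0 < N)%N ->
    [/\ al * \poly_(i < N) a i = 1 + 'X^N * r, (size r <= size al)%N &
        forall i, nm r`_i <= K1 * ra ^+ N].
  by move=> N; case: (posnP N) => [_|/hK1[r hr]]; [exists 0|exists r].
pose r' N := r N.+1.
have [K2 [r2 [K20 r201 hK2]]] := unstable_rem hzs.
rewrite -/u in hK2.
pose A M := \poly_(i < M.+1) a i.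
pose B M : {poly C} := 'X^M %/ u.
pose sg M : {poly C} := 'X^M %% u.
pose X1 t w := pact (x0 * u) (y^~ w) t.
pose X2 t w := pact (y0 * al) (y^~ w) t.
have my t : cmeas (y t) by exact: Y_cmeas.
have mX1 t : cmeas (X1 t) by exact: (@pact_cmeas _ _ _ _ y).
have mX2 t : cmeas (X2 t) by exact: (@pact_cmeas _ _ _ _ y).
have tX1 : utight X1 by apply: rtight_utight; exact: rtight_pact my (rtight_Y i).
have tX2 : utight X2 by apply: rtight_utight; exact: rtight_pact my (rtight_Y i).
(* truncation errors: past part at order [M'.+1], future part at order [M'] *)
pose sm M' w := pact (sg M') (X2^~ w) M'%:Z - pact (r' M') (X1^~ w) (- M'.+1%:Z).
have yE : {ae P, forall w, forall M', y 0 w =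
    pact (x0 * A M') (e w) 0 + pact (y0 * B M') (e w) M'%:Z + sm M' w}.
  apply: filterS eE => w hw M'.
  have ePE q t : pact (q * (al * u)) (y^~ w) t = pact q (e w) t.
    by rewrite pactM; apply: pact_eq.
  have p1 : y 0 w = pact (x0 * u) (y^~ w) 0 + pact (y0 * al) (y^~ w) 0.
    by rewrite -pactD addrC bez pact1.
  have [hA _ _] := hr M'.+1 isT.
  have p2 : pact (x0 * u) (y^~ w) 0 = pact (x0 * A M') (e w) 0 -
      pact (r' M') (X1^~ w) (- M'.+1%:Z).
    have -> : pact (x0 * A M') (e w) 0 = pact (x0 * u * (1 + 'X^(M'.+1) * r M'.+1)) (y^~ w) 0.
      by rewrite -ePE -hA /A; congr pact; ring.
    rewrite mulrDr mulr1 pactD -addrA; apply/esym; rewrite -[RHS]addr0; congr (_ + _).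
    rewrite mulrCA pactM pactXn sub0r [x0 * u * _]mulrC pactM.
    by rewrite /r' /X1 subrr.
  have p3 : pact (y0 * al) (y^~ w) 0 = pact (y0 * B M') (e w) M'%:Z +
      pact (sg M') (X2^~ w) M'%:Z.
    have -> : pact (y0 * al) (y^~ w) 0 = pact ('X^M' * (y0 * al)) (y^~ w) M'%:Z.
      by rewrite [RHS]pactM pactXn subrr.
    rewrite (divp_eq 'X^M' u) -/(B M') -/(sg M') mulrDl pactD; congr (_ + _).
      by rewrite -ePE; congr pact; ring.
    by rewrite pactM.
  by rewrite p1 p2 p3 /sm; ring.
have smsmall : forall e del : R, 0 < e -> 0 < del -> exists M0 : nat, forall M', (M0 <= M')%N ->
    pr [set w | e < nm (sm M' w)] <= del.
  move=> ep del ep0 del0.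
  have h1 : 0 < ep / 2 by rewrite divr_gt0.
  have h2 : 0 < del / 2 by rewrite divr_gt0.
  have /andP[ra0 ra1] := ra01.
  have [||M1 hM1] := small_filter mX1 tX1 (mulr_ge0 K10 (ltW ra0)) ra01
     (r := r') (D := size al) _ _ h1 h2.
  - by move=> N; have [] := hr N.+1 isT.
  - by move=> N j; have [_ _ /(_ j)] := hr N.+1 isT; rewrite exprS mulrA.
  have [|M2 hM2] := small_filter mX2 tX2 K20 r201 (r := sg) (D := size u) _ hK2 h1 h2.
  - by move=> N; rewrite ltnW// ltn_modp monic_neq0.
  exists (maxn M1 M2) => M'; rewrite geq_max => /andP[a1 a2].
  have g1 := hM1 M' (- M'.+1%:Z) a1; have g2 := hM2 M' M'%:Z a2.
  have mm1 : cmeas (fun w => pact (r' M') (X1^~ w) (- M'.+1%:Z)) by exact: (@pact_cmeas _ _ _ _ X1).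
  have mm2 : cmeas (fun w => pact (sg M') (X2^~ w) M'%:Z) by exact: (@pact_cmeas _ _ _ _ X2).
  apply: (@le_trans _ _ (del / 2 + del / 2)); last by rewrite -splitr.
  apply: le_trans (lerD g1 g2); apply: le_trans (prU_le _ _ _); last 2 first.
  - exact: gt_nm_measurable.
  - exact: gt_nm_measurable.
  apply: le_pr.
  - by apply: gt_nm_measurable; exact: cmeasB.
  - by apply: measurableU; exact: gt_nm_measurable.
  move=> w /=; rewrite /sm => hw.
  have [b1|b1] := ltP (ep / 2) (nm (pact (r' M') (X1^~ w) (- M'.+1%:Z))); first by left.
  right; have := nmB (pact (sg M') (X2^~ w) M'%:Z) (pact (r' M') (X1^~ w) (- M'.+1%:Z)).
  by rewrite /=; lra.
pose h k := (y0 * n k * B M)`_(M - l).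
have hM' M' k : (M <= M')%N -> (y0 * n k * B M')`_(M' - l) = h k.
  move=> MM'; apply: coef_at_infinity_const => //.
  by rewrite /n -scalerAr (leq_trans (size_scale_leq _ _)).
(* [h k] is the coefficient of the noise at the future time [l] *)
suff h0 : forall k, h k = 0.
  have := h0 k1; rewrite /h /n -scalerAr -scalerAl coefZ => /eqP.
  by rewrite mulf_eq0 invr_eq0 (negbTE kap0) /= => /eqP.
apply: contrapT => /existsNP[k2 hk2].
have [||v [c1 [c2 [v1 cc12 hp]]]] := hnd (b := h).
- move=> k sk; have n0 : n k = 0.
    have e0 : (\adj Pm *m Qm) i k = 0.
      by rewrite mxE; apply: big1 => j _; rewrite (hQ0 j sk); exact: mulr0.
    by rewrite /n e0; exact: scaler0.
  by rewrite /h n0 mulr0 mul0r coef0.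
- by exists k2; apply/eqP.
have [p1 p2] := hp l%:Z.
(* [W M'] collects the noise at all times other than [l] *)
pose mk w k t := if t == l%:Z then 0 else noise Z U k t w.
pose em w t := \sum_k pact (n k) (mk w k) t + c.
pose W M' w := pact (x0 * A M') (em w) 0 + (\sum_k pact (y0 * B M' * n k) (mk w k) M'%:Z + (y0 * B M').[1] * c).
have decomp M' w : (M <= M')%N ->
   pact (x0 * A M') (e w) 0 + pact (y0 * B M') (e w) M'%:Z = comb Z U h l%:Z w + W M' w.
  move=> MM'; have lM' : (l%:Z <= M'%:Z)%R by rewrite lez_nat (leq_trans lM).
  have q1 : pact (x0 * A M') (e w) 0 = pact (x0 * A M') (em w) 0.
    rewrite /e /em !pactDr !pact_sumr; congr (_ + _); apply: eq_bigr => k _.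
    by rewrite -!pactM [in RHS]pact_mask_lt// ltz_nat.
  have q2 : pact (y0 * B M') (e w) M'%:Z = comb Z U h l%:Z w +
     (\sum_k pact (y0 * B M' * n k) (mk w k) M'%:Z + (y0 * B M').[1] * c).
    rewrite /e pactDr pact_sumr pact_cst addrA; congr (_ + _).
    rewrite -big_split /=; apply: eq_bigr => k _.
    rewrite -pactM (pact_mask _ _ lM'); congr (_ * _ + _).
    have -> : absz (M'%:Z - l%:Z)%R = (M' - l)%N by rewrite subzn// (leq_trans lM).
    by rewrite -(hM' M' k MM') mulrAC.
  by rewrite q1 q2 /W addrCA.
have mW M' : cmeas (W M' : sspace Z [set r | r != l%:Z] -> C).
  have mmk k t : cmeas ((fun w => mk w k t) : sspace Z [set r | r != l%:Z] -> C).
    exact: noise_masked_cmeas_in.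
  have mem' t : cmeas ((fun w => em w t) : sspace Z [set r | r != l%:Z] -> C).
    apply: cmeasD; last exact: cmeas_cst.
    by apply: cmeas_sum => k; exact: (@pact_cmeas _ _ _ (sspace Z [set r | r != l%:Z]) (fun t w => mk w k t)).
  apply: cmeasD; first exact: (@pact_cmeas _ _ _ (sspace Z [set r | r != l%:Z]) (fun t w => em w t)).
  apply: cmeasD; last exact: cmeas_cst.
  by apply: cmeas_sum => k; exact: (@pact_cmeas _ _ _ (sspace Z [set r | r != l%:Z]) (fun t w => mk w k t)).
have mWT M' : cmeas (W M').
  have mmk k t : cmeas (fun w => mk w k t).
    by rewrite /mk; case: eqP => _; [exact: cmeas_cst|exact: noise_cmeas].
  have mem' t : cmeas (fun w => em w t).
    apply: cmeasD; last exact: cmeas_cst.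
    by apply: cmeas_sum => k; exact: (@pact_cmeas _ _ _ _ (fun t w => mk w k t)).
  apply: cmeasD; first exact: (@pact_cmeas _ _ _ _ (fun t w => em w t)).
  apply: cmeasD; last exact: cmeas_cst.
  by apply: cmeas_sum => k; exact: (@pact_cmeas _ _ _ _ (fun t w => mk w k t)).
have mrv (f : T -> C) : cmeas f -> measurable_fun setT (fun w => rep (v * f w)).
  by move=> mf; have [] := cmeasZ v mf.
have lp : (0 < l%:Z)%R by rewrite ltz_nat.
have sxi : (forall y, sigma_of Z [set l%:Z] [set w | rep (v * comb Z U h l%:Z w) <= y]) /\
           (forall y, sigma_of Z [set l%:Z] [set w | y <= rep (v * comb Z U h l%:Z w)]).
  have [mr _] := cmeasZ v (@comb_cmeas_in _ _ _ _ _ Z U [set l%:Z] h l%:Z erefl).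
  split => y'; apply: sspace_measurable; [exact: measurable_ler|exact: measurable_ger].
have sub1 : [set l%:Z] `<=` future 0 by move=> _ ->.
have dj : [set r : int | r != l%:Z] `&` [set l%:Z] = set0.
  by apply/seteqP; split => // v' [/= /eqP].
have iY (y' : R) E : sigma_of Z [set l%:Z] E ->
    pr ([set w | rep (v * y 0 w) <= y'] `&` E) = pr [set w | rep (v * y 0 w) <= y'] * pr E.
  move=> sE; apply: (Y_indep (t := 0) (B := [set x | rep (v * x i 0) <= y'])).
    by have [mr _] := cmeasZ v (@entry_measurable R m 1 i 0); exact: measurable_ler.
  exact: sigma_of_sub sE.
have iW M' (y' : R) E : sigma_of Z [set l%:Z] E ->
    pr ([set w | rep (v * W M' w) <= y'] `&` E) = pr [set w | rep (v * W M' w) <= y'] * pr E.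
  move=> sE; apply: (sigma_of_indep hZ dj) => //.
  apply: sspace_measurable; have [mr _] := cmeasZ v (mW M').
  exact: measurable_ler.
apply: (@independent_summand_degenerate _ _ _ P (fun w => rep (v * y 0 w))
   (fun w => rep (v * comb Z U h l%:Z w)) (fun M' w => rep (v * W (M + M')%N w)) c1 c2) => //.
- exact: mrv.
- by apply: mrv; exact: comb_cmeas.
- by move=> M'; exact: mrv.
- by move=> y'; apply: iY; exact: sxi.2.
- by move=> y'; apply: iY; exact: sxi.1.
- by move=> M' y'; apply: iW; exact: sxi.2.
- by move=> M' y'; apply: iW; exact: sxi.1.
move=> ep del ep0 del0; have [M0 hM0] := smsmall ep del ep0 del0.
exists M0; apply: le_trans (hM0 (M + M0)%N (leq_addl _ _)).
apply: (pr_ae _ _ yE).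
- apply: measurable_gtr; apply: measurableT_comp => //.
  apply: measurable_funB; last exact: mrv.
  by apply: measurable_funB; apply: mrv => //; exact: comb_cmeas.
- apply: gt_nm_measurable; apply: cmeasB.
    exact: (@pact_cmeas _ _ _ _ X2).
  exact: (@pact_cmeas _ _ _ _ X1).
move=> w /= hw; case: (pselect (forall M', y 0 w =
    pact (x0 * A M') (e w) 0 + pact (y0 * B M') (e w) M'%:Z + sm M' w)) => hy; last by right.
left; apply: lt_le_trans hw _; rewrite -!repB -!mulrBr.
apply: le_trans (rep_le_nm _) _; rewrite nmM v1 mul1r.
rewrite (hy (M + M0)%N) decomp ?leq_addr//.
by rewrite le_eqVlt; apply/orP; left; apply/eqP; congr nm; ring.
Qed.

(** The unstable factor [u] divides [\adj Pm *m Qm], since the expansion of the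
    quotient at infinity has no principal part. Cancelling [u] in
    [Pm *m (\adj Pm *m Qm) = \det Pm *: Qm] shows that [Qm] is annihilated, at
    a root of [u], by the left kernel of [Pm]. *)
Lemma no_small_root : zs = [::].
Proof.
have [[b1 b2] /= bez] := Bezout_eq1_coprimepP _ _ coprime_stable_unstable.
have dvN i k : u %| (\adj Pm *m Qm) i k.
  rewrite -(@Gauss_dvdpr _ _ b1); last first.
    apply/Bezout_eq1_coprimepP; exists (b2, al) => /=.
    by rewrite -bez; ring.
  pose M := (size u + \sum_k size (b1 * (\adj Pm *m Qm) i k)%R)%N.
  have sM k' : (size (b1 * (\adj Pm *m Qm) i k')%R <=
      \sum_k size (b1 * (\adj Pm *m Qm) i k)%R)%N.
    by rewrite (bigD1 k')//= leq_addr.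
  apply: (@dvdp_of_expansion _ _ _ M) => //.
    by rewrite leq_add2l sM.
  move=> l /andP[l0 lu]; apply: (future_coefficient_zero bez) => //.
    by rewrite ltnW// (leq_trans lu)// leq_addr.
  move=> k'; apply: (leq_trans (sM k')); rewrite /M.
  by move: lu; move: (\sum_k _)%N (size u) => x y'; clear; lia.
have [//|[z zin]] : zs = [::] \/ exists z, z \in zs.
  by case: (zs) => [|z zs']; [left|right; exists z; rewrite inE eqxx].
exfalso.
have z1 : nm z < 1 by apply: hzs.
have uz : u.[z] = 0 by apply/rootP; rewrite root_prod_XsubC.
have u0 : u != 0 by exact: monic_neq0.
have : (\det Pm).[z] = 0 by rewrite detE hornerZ hornerM uz mulr0 mulr0.
rewrite -det_evalmxp => /eqP/det0P[w w0 wP].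
have := hpbh w0 wP; apply/negP; rewrite negbK.
pose N' : 'M[{poly C}]_(m, d) := \matrix_(i, k) ((\adj Pm *m Qm) i k %/ u).
have NE : \adj Pm *m Qm = u *: N'.
  apply/matrixP => i k; rewrite [RHS]mxE [N' i k]mxE mulrC divpK//.
have PN : Pm *m N' = (kap *: al) *: Qm.
  apply/matrixP => i k; apply: (mulfI u0).
  have := congr1 (fun X : 'M[{poly C}]_(m, d) => X i k) (mulmxA Pm (\adj Pm) Qm).
  rewrite NE mul_mx_adj -scalemxAr mul_scalar_mx detE.
  rewrite [in LHS]mxE [in RHS]mxE => ->; rewrite [in RHS]mxE -!mul_polyC; ring.
have := congr1 (fun X => w *m evalmxp X z) PN.
rewrite evalmxpM mulmxA wP mul0mx => /esym h.
have e : evalmxp ((kap *: al) *: Qm) z = (kap * al.[z]) *: evalmxp Qm z.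
  by apply/matrixP => i k; rewrite !mxE hornerM hornerZ.
rewrite e -scalemxAr in h; move/eqP: h; rewrite scaler_eq0 mulf_eq0 (negbTE kap0) /=.
by rewrite (negbTE (stable_factor_nonzero z1)).
Qed.

End root_decomposition.

(** Unlike [rtight_pact], the filter may vary, within a bounded degree and with
    bounded coefficients. *)
Lemma rtight_pact_family (x : int -> T -> C) (r : nat -> {poly C}) (D : nat) (B : R) :
  (forall t, cmeas (x t)) -> rtight Z future x ->
  (forall n, (size (r n) <= D)%N) -> (forall n l, nm (r n)`_l <= B) ->
  rtight Z (fun n : nat => future (- n.+1%:Z))
    (fun n w => pact (r n) (x^~ w) (- n.+1%:Z)).
Proof.
move=> mx tx sr br.
rewrite (_ : (fun n w => _) = fun (n : nat) w =>
    \sum_(l < D) (r n)`_l * x (- n.+1%:Z - l%:Z) w); last first.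
  by apply/funext => n; apply/funext => w; rewrite (pact_wide _ _ (sr n)).
apply: (@rtight_sum _ _ _ _ _ _ _ _ _ _ (fun (l : 'I_D) (n : nat) w =>
     (r n)`_l * x (- n.+1%:Z - l%:Z) w)) => [l n|l].
  exact: cmeasZ.
apply: (@rtightZ _ _ _ _ _ _ _ _ _ B) => [n|n|] //.
apply: (@rtight_reindex _ _ _ _ _ Z _ _ future _ (fun n : nat => - n.+1%:Z - l%:Z) x) => //.
move=> n v; rewrite /future /=; apply: le_lt_trans.
by rewrite gerBl.
Qed.

Section stable.
Variables (a : nat -> C) (Ka rho : R).
Hypothesis Ka0 : 0 <= Ka.
Hypothesis rho01 : 0 < rho < 1.
Hypothesis ha : forall n, nm (a n) <= Ka * rho ^+ n.
Hypothesis inva : series_inverse (\det Pm) a.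

Variable i : 'I_m.
Let Nk k := (\adj Pm *m Qm) i k.
Let mu j k := series_coef a (Nk k) j.

Lemma truncated_sum_bounded : exists B : R, forall N, nm (\poly_(l < N) a l).[1] <= B.
Proof.
have /andP[r0 r1] := rho01; exists (Ka / (1 - rho)) => N.
rewrite horner_poly; apply: le_trans (nm_sum _ _ _) _.
apply: (@le_trans _ _ (\sum_(l < N) Ka * rho ^+ l)).
  by apply: ler_sum => l _; rewrite expr1n mulr1.
rewrite -mulr_sumr ler_wpM2l// geometric_sum_le//.
by rewrite (ltW r0).
Qed.

(** The partial sums differ from [Y 0] by terms that only involve the past of
    the noise they use, so the maximal inequality applies; each term of the
    series is the difference of two consecutive sums. *)
Lemma causal_sums_bounded : exists2 K : R, 0 < K & forall N,
  1 / 2 <= pr (\bigcap_(j in [set j | (j < N.+1)%N])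
    [set w | nm (comb Z U (mu j) (- j%:Z) w) <= K]).
Proof.
have [c hc] := adjugate_equation i.
have /andP[r0 r1] := rho01.
have [K1 K10 hK1] := truncated_inverse Ka0 rho01 ha inva.
have /choice[r hr] : forall N, exists r : {poly C}, (0 < N)%N ->
    [/\ \det Pm * \poly_(i < N) a i = 1 + 'X^N * r, (size r <= size (\det Pm))%N &
        forall i, nm r`_i <= K1 * rho ^+ N].
  by move=> N; case: (posnP N) => [_|/hK1[r hr]]; [exists 0|exists r].
pose A N := \poly_(l < N.+1) a l.
pose y t w := Y t w i 0.
pose S N w := \sum_(j < N.+1) comb Z U (mu j) (- j%:Z) w.
pose E N k : {poly C} := drop_poly N.+1 (A N * Nk k).
have my t : cmeas (y t) by exact: Y_cmeas.
have mS N : cmeas (S N) by apply: cmeas_sum => j; exact: comb_cmeas.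
pose Rem N w := \sum_k pact (E N k) (fun t => noise Z U k t w) (- N.+1%:Z) + (A N).[1] * c
   + -1 * pact (r N.+1) (y^~ w) (- N.+1%:Z).
have RE : {ae P, forall w, forall N, y 0 w - S N w = Rem N w}.
  apply: filterS hc => w hw N.
  have [hA _ _] := hr N.+1 isT.
  have e1 : y 0 w = pact (A N) (fun t => pact (\det Pm) (y^~ w) t) 0 -
      pact (r N.+1) (y^~ w) (- N.+1%:Z).
    rewrite -pactM mulrC hA pactD pact1 pactM pactXn sub0r addrK.
    by [].
  rewrite e1 (pact_eq _ _ hw) pactDr pact_sumr pact_cst.
  have e2 k : pact (A N) (pact (Nk k) (fun t => noise Z U k t w)) 0 =
      \sum_(j < N.+1) mu j k * noise Z U k (- j%:Z) w +
      pact (E N k) (fun t => noise Z U k t w) (- N.+1%:Z).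
    rewrite -pactM -(poly_take_drop N.+1 (A N * Nk k)) pactD [_ * 'X^_]mulrC.
    rewrite (pactM 'X^_) pactXn sub0r; congr (_ + _).
    rewrite (pact_wide _ _ (size_take_poly _ _)); apply: eq_bigr => j _.
    by rewrite coef_take_poly ltn_ord (series_coefE _ _ (ltn_ord j)) sub0r.
  under eq_bigr do rewrite e2.
  rewrite big_split /= exchange_big /= /Rem /S /comb.
  ring.
have tE k : rtight Z (fun n : nat => future (- n.+1%:Z))
    (fun N w => pact (E N k) (fun t => noise Z U k t w) (- N.+1%:Z)).
  apply: (@rtight_pact_family _ (fun N => E N k) (size (Nk k))
     ((\sum_(l < size (Nk k)) nm (Nk k)`_l) * (Ka / rho ^+ size (Nk k)))).
  - by move=> t; exact: noise_cmeas.
  - exact: rtight_noise.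
  - move=> N; rewrite size_drop_poly (leq_trans (leq_sub2r _ (size_polyMleq _ _)))//.
    have := size_poly N.+1 a; rewrite -/(A N).
    by move: (size (A N)) (size (Nk k)) => x1 x2; clear; lia.
  - move=> N l; rewrite coef_drop_poly.
    apply: le_trans (coef_mul_bound _ _ _ Ka0 _ ha) _; first by rewrite r0 ltW.
    rewrite ler_piMr//; last by rewrite exprn_ile1// ltW.
    rewrite mulr_ge0 ?divr_ge0 ?exprn_ge0 ?(ltW r0)//.
    by apply: sumr_ge0 => l' _; exact: nm_ge0.
have [B1 hB1] := truncated_sum_bounded.
have tR : rtight Z (fun n : nat => future (- n.+1%:Z)) Rem.
  have mk k N : cmeas (fun w => pact (E N k) (fun t => noise Z U k t w) (- N.+1%:Z)).
    by apply: (@pact_cmeas _ _ _ _ (noise Z U k)) => t; exact: noise_cmeas.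
  have m1 N : cmeas (fun w => \sum_k pact (E N k) (fun t => noise Z U k t w) (- N.+1%:Z)).
    exact: cmeas_sum.
  have m2 N : cmeas (fun w => pact (r N.+1) (y^~ w) (- N.+1%:Z)).
    exact: (@pact_cmeas _ _ _ _ y).
  apply: (@rtightD _ _ _ _ _ _ _ _ (fun N w => \sum_k pact (E N k) (fun t => noise Z U k t w)
    (- N.+1%:Z) + (A N).[1] * c)).
  - by move=> N; apply: cmeasD => //; exact: cmeas_cst.
  - by move=> N; exact: cmeasZ.
  - apply: rtightD => [N|N||].
    + exact: m1.
    + exact: cmeas_cst.
    + exact: rtight_sum.
    + apply: (@rtight_cst _ _ _ _ _ _ _ _ _ (B1 * nm c)) => N.
      by rewrite nmM ler_wpM2r ?nm_ge0//; exact: hB1.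
  - apply: (@rtightZ _ _ _ _ _ _ _ _ (fun=> -1) 1) => [N|N|] //.
      by rewrite nmN nm1.
    apply: (@rtight_pact_family y (fun N => r N.+1) (size (\det Pm)) K1) => //.
    + exact: rtight_Y.
    + by move=> N; have [] := hr N.+1 isT.
    + move=> N l; have [_ _ /(_ l)] := hr N.+1 isT; move=> h; apply: le_trans h _.
      by rewrite ler_piMr// exprn_ile1// ltW.
have tyS : rtight Z (fun n : nat => future (- n.+1%:Z)) (fun N w => y 0 w - S N w).
  apply: (rtight_ae _ _ _ tR).
  - move=> N; rewrite /Rem; apply: cmeasD; first apply: cmeasD; last first.
    + by apply: cmeasZ; exact: (@pact_cmeas _ _ _ _ y).
    + exact: cmeas_cst.
    + apply: cmeas_sum => k; apply: (@pact_cmeas _ _ _ _ (noise Z U k)) => t.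
      exact: noise_cmeas.
  - by move=> N; exact: cmeasB.
  - by move=> N; apply: filterS RE => w ->.
have mSJ (n l : nat) : (l <= n)%N -> cmeas (S l : sspace Z (future (- n.+1%:Z)) -> C).
  move=> ln; apply: cmeas_sum => j; apply: comb_cmeas_in.
  rewrite /future /= ltrN2 ltz_nat.
  exact: (leq_trans (ltn_ord j)).
have [K K0 hK] := ottaviani_inequality (my 0) mSJ mS tyS.
exists (2 * K); first by rewrite mulr_gt0.
move=> N; apply: le_trans (hK N) _; apply: le_pr.
- rewrite (_ : [set w | _] = \bigcap_(n in [set n | (n < N.+1)%N]) [set w | nm (S n w) <= K]).
    apply: fin_bigcap_measurable; first exact: finite_II.
    by move=> n _; apply: measurable_ler; exact: cmeas_nm.
  by apply/seteqP; split => w h n; exact: h.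
- apply: fin_bigcap_measurable; first exact: finite_II.
  by move=> j _; apply: measurable_ler; apply: cmeas_nm; exact: comb_cmeas.
move=> w /= hw [_|j jN] /=.
  by have := hw 0%N (leq0n _); rewrite /S big_ord1; lra.
have h1 := hw j (ltnW jN); have h2 := hw j.+1 jN.
have -> : comb Z U (mu j.+1) (- j.+1%:Z) w = S j.+1 w - S j w.
  by rewrite /S [X in X - _]big_ord_recr /= addrAC subrr add0r.
by apply: le_trans (nmB _ _) _; lra.
Qed.

(** The terms are independent, and the probability that all of them are bounded
    by [K] is a product that does not tend to zero. *)
Lemma coefficient_tails : exists2 K : R, 0 < K & forall N,
  \sum_(j < N) pr [set w | K < nm (comb Z U (mu j) 0 w)] <= 1.
Proof.
have [K K0 hK] := causal_sums_bounded; exists K => // N.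
have mC j t : measurable [set w | K < nm (comb Z U (mu j) t w)].
  by apply: gt_nm_measurable; exact: comb_cmeas.
have := hK N.
have -> : \bigcap_(j in [set j | (j < N.+1)%N])
    [set w | nm (comb Z U (mu j) (- j%:Z) w) <= K] =
    \bigcap_(j in [set j | (j < N.+1)%N])
    [set w | nm (comb Z U (mu j) (0 - j%:Z) w - 0) <= K].
  by apply: eq_bigcapr => j _; apply/seteqP; split => w /=; rewrite sub0r subr0.
rewrite (block_pattern_prob mu (fun=> 0)).
have e (j : nat) : pr [set w | nm (comb Z U (mu j) 0 w - 0) <= K] =
    1 - pr [set w | K < nm (comb Z U (mu j) 0 w)].
  rewrite -prC//; congr pr; apply/seteqP; split => w /=; rewrite subr0.
    by move=> h1 h2; move: h1; rewrite leNgt h2.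
  by move=> /negP; rewrite -leNgt.
under eq_bigr do rewrite e.
pose x j := pr [set w | K < nm (comb Z U (mu j) 0 w)].
have hx j : 0 <= x j <= 1 by rewrite pr_ge0 pr_le1.
have := prod_complement_le N.+1 hx; rewrite -/x.
have -> : \prod_(j < N.+1) (1 - pr [set w | K < nm (comb Z U (mu j) 0 w)]) =
  \prod_(j < N.+1) (1 - x j) by [].
have : \sum_(j < N) x j <= \sum_(j < N.+1) x j.
  by rewrite big_ord_recr /= lerDl; have /andP[] := hx N.
have : 0 <= \sum_(j < N) x j by apply: sumr_ge0 => j _; have /andP[] := hx j.
rewrite -/(\sum_(j < N) x j).
move: (\sum_(j < N) x j) (\sum_(j < N.+1) x j) (\prod_(j < N.+1) (1 - x j)) => x1 x2 x3.
nra.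
Qed.

(** Running the recursion of the coefficients backwards, a large value of the
    [j]-th term forces one of the terms of each later window to exceed a fixed
    level, at a geometric rate. *)
Lemma coefficient_log_moment (j : nat) : (forall k, (size (Nk k) <= j)%N) ->
  ('E_P[fun w => logplus (nm (comb Z U (mu j) 0 w))] < +oo)%E.
Proof.
move=> sj; have [K K0 hK] := coefficient_tails.
pose al := \det Pm; pose D := (size al).-1.
have al0 : al != 0.
  by apply/eqP => h; move: hdet; rewrite -/al h horner0 => /eqP; rewrite eq_sym oner_eq0.
have sal : size al = D.+1 by rewrite prednK ?size_poly_gt0.
have lc : al`_D != 0 by rewrite -[al`_D]/(lead_coef al) lead_coef_eq0.
pose u w l := nm (comb Z U (mu l) 0 w).
pose c := (\sum_(k < D.+1) nm al`_k) / nm al`_D.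
have c0 : 0 <= c by rewrite divr_ge0 ?nm_ge0// sumr_ge0// => k _; exact: nm_ge0.
have lc0 : 0 < nm al`_D by rewrite nm_gt0.
have rec w l : (j <= l)%N -> u w l <= c * \sum_(1 <= k < D.+1) u w (l + k)%N.
  move=> jl.
  have h0 : \sum_(k < D.+1) al`_k * comb Z U (mu (l + D - k)%N) 0 w = 0.
    under eq_bigr do rewrite mulr_sumr.
    rewrite exchange_big big1// => k _.
    under eq_bigr do rewrite mulrA.
    rewrite -mulr_suml -sal /mu series_coef_recursion ?mul0r//.
      by apply: leq_trans (sj k) _; apply: leq_trans jl _; exact: leq_addr.
    by rewrite sal /= leq_addl.
  rewrite big_ord_recr /= addnK in h0.
  have h1 : nm al`_D * u w l <= \sum_(k < D) nm al`_k * u w (l + D - k)%N.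
    rewrite /u -nmM.
    have -> : al`_D * comb Z U (mu l) 0 w =
        - \sum_(k < D) al`_k * comb Z U (mu (l + D - k)%N) 0 w.
      by apply/eqP; rewrite eq_sym -subr_eq0 -opprD oppr_eq0 h0.
    rewrite nmN; apply: le_trans (nm_sum _ _ _) _.
    by apply: ler_sum => k _; rewrite nmM.
  have h2 (k : 'I_D) : u w (l + D - k)%N <= \sum_(1 <= k < D.+1) u w (l + k)%N.
    have kD : (D - k < D.+1)%N by rewrite ltnS leq_subr.
    have k1 : (0 < D - k)%N by rewrite subn_gt0.
    rewrite (bigD1_seq (D - k)%N) ?iota_uniq ?mem_index_iota ?k1//=.
    rewrite addnBA ?(ltnW (ltn_ord k))// lerDl sumr_ge0// => k' _.
    exact: nm_ge0.
  have h3 : \sum_(k < D) nm al`_k * u w (l + D - k)%N <=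
      (\sum_(k < D.+1) nm al`_k) * \sum_(1 <= k < D.+1) u w (l + k)%N.
    rewrite big_ord_recr /= mulrDl.
    apply: (@le_trans _ _ ((\sum_(k < D) nm al`_k) * \sum_(1 <= k < D.+1) u w (l + k)%N)).
      rewrite mulr_suml; apply: ler_sum => k _.
      by rewrite ler_wpM2l// nm_ge0.
    rewrite lerDl mulr_ge0 ?nm_ge0// sumr_ge0// => k _; exact: nm_ge0.
  by rewrite /c mulrAC ler_pdivlMr// mulrC; exact: le_trans h1 h3.
pose DK := D.+1%:R * K; have DK0 : 0 < DK by rewrite mulr_gt0.
have back w n : (forall l, (1 <= l <= D)%N -> u w (j + n + l)%N <= K) ->
    u w j <= (c + 2) ^+ n.+1 * DK.
  move=> h; apply: (@le_trans _ _ ((c + 1) ^+ n.+1 * (D%:R * K))).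
    apply: (@backward_window _ (u w) c K D j c0 (ltW K0)) => //.
    - by move=> l; exact: nm_ge0.
    - exact: rec.
  apply: ler_pM.
  - by rewrite exprn_ge0// addr_ge0.
  - by rewrite mulr_ge0// ltW.
  - by apply: lerXn2r; rewrite ?nnegrE; lra.
  - by rewrite ler_wpM2r ?(ltW K0)// ler_nat.
pose b := ln (c + 2); pose B0 := logplus ((c + 2) * DK).
have b0 : 0 <= b by rewrite /b ln_ge0//; lra.
pose A n : set T := [set w | (c + 2) ^+ n.+1 * DK < u w j].
have mu_meas l : measurable_fun setT (fun w => u w l).
  by apply: cmeas_nm; exact: comb_cmeas.
apply: (@expectation_lt_pinfty_layers _ _ _ P _ A B0 b D%:R) => //.
- by apply: logplus_measurable; exact: mu_meas.
- by move=> w; exact: logplus_ge0.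
- exact: logplus_ge0.
- by move=> n; exact: measurable_gtr.
- move=> w.
  pose q n := ~~ ((c + 2) ^+ n.+1 * DK < u w j).
  have ex : exists n, q n.
    have u0 : 0 <= u w j by exact: nm_ge0.
    have [|||n hn] := @expr_lt_eventually R (c + 2)^-1 (DK / (u w j + 1)).
    - by rewrite invr_ge0 addr_ge0.
    - by rewrite invf_lt1; lra.
    - by rewrite divr_gt0// ltr_wpDl.
    exists n; rewrite /q -leNgt.
    have cn : 0 < (c + 2) ^+ n by rewrite exprn_gt0// ltr_wpDl.
    have h1 : u w j + 1 < (c + 2) ^+ n * DK.
      move: hn; rewrite exprVn ltr_pdivlMr; last by lra.
      by rewrite mulrC ltr_pdivrMr// mulrC.
    rewrite exprS -mulrA; have : 0 <= (c + 2) ^+ n * DK by rewrite mulr_ge0// ltW.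
    by move: ((c + 2) ^+ n * DK) h1 => z; nra.
  exists (ex_minn ex).
    move=> n; case: ex_minnP => n1 _ hmin nn1.
    apply: contrapT => /negP h; have := hmin n h; by rewrite leqNgt nn1.
  case: ex_minnP => n1 + _; rewrite /q -leNgt => h1.
  apply: le_trans (logplus_le h1) _; rewrite exprSr -mulrA.
  apply: le_trans (logplusM _ _) _.
  + by rewrite exprn_ge0// addr_ge0.
  + by rewrite mulr_ge0 ?addr_ge0// ltW.
  by rewrite logplusX; [rewrite addrC mulr_natr|lra].
- move=> N.
  have mAK l : measurable [set w | K < u w l] by exact: measurable_gtr.
  have step n : pr (A n) <= \sum_(1 <= l < D.+1) pr [set w | K < u w (j + n + l)%N].
    apply: (@le_trans _ _ (pr (\big[setU/set0]_(1 <= l < D.+1) [set w | K < u w (j + n + l)%N]))).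
      apply: le_pr; [exact: measurable_gtr|exact: bigsetU_measurable|].
      move=> w; rewrite /A /= => hA; apply: contrapT => hn.
      move: hA; rewrite ltNge => /negP; apply; apply: back => l /andP[l1 lD].
      rewrite leNgt; apply/negP => hl; apply: hn.
      by rewrite -bigcup_seq; exists l => //=; rewrite mem_index_iota l1 ltnS.
    elim: (index_iota 1 D.+1) => [|l r ih]; first by rewrite !big_nil pr_set0.
    rewrite !big_cons; apply: le_trans (prU_le _ _ _) _ => //.
      exact: bigsetU_measurable.
    by rewrite lerD2l.
  apply: (@le_trans _ _ (\sum_(n < N) \sum_(1 <= l < D.+1) pr [set w | K < u w (j + n + l)%N])).
    by apply: ler_sum => n _; exact: step.
  rewrite exchange_big /=.
  apply: (@le_trans _ _ (\sum_(1 <= l < D.+1) 1)); last by rewrite sumr_const_nat subSS subn0.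
  apply: ler_sum => l _; apply: le_trans (hK (j + l + N)%N).
  rewrite big_split_ord /= -[leLHS]add0r; apply: lerD.
    by apply: sumr_ge0 => n _; exact: pr_ge0.
  by apply: ler_sum => n _; rewrite addnAC.
Qed.

End stable.

End Necessity.

(** * Taylor coefficients of the transfer function *)

Section Taylor.
Context {R : realType}.
Local Notation C := (cplx R).

Lemma mx_cvgP (m n : nat) (S : nat -> 'M[C]_(m, n)) (L : 'M[C]_(m, n)) :
  S @ \oo --> L <-> forall e : R, 0 < e -> exists N, forall k, (N <= k)%N ->
    forall i j, nm (S k i j - L i j) < e.
Proof.
split => [h e e0|h].
  have e0C : 0 < e%:C :> C by rewrite (@ltcR R).
  have /cvg_ballP/(_ _ e0C) [N _ hN] := h.
  exists N => k Nk i j; have [_ /(_ i j)] := hN k Nk.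
  by rewrite /ball /= -nm_lt nm_distC.
apply/cvg_ballP => e e0.
have er : (e : C) \is Num.real by apply: gtr0_real.
have eE : e = (complex.Re e)%:C by rewrite (RRe_real er).
have [|N hN] := h (complex.Re e); first by rewrite -(@ltcR R) -eE.
exists N => // k Nk; split => // i j.
by rewrite /ball /= eE -nm_lt nm_distC; exact: hN.
Qed.

Lemma near0_cplxP (Q : C -> Prop) :
  (\forall z \near (0 : C), Q z) <-> exists2 r : R, 0 < r & forall z, nm z < r -> Q z.
Proof.
split => [/nbhs_ballP[e /= e0 he]|[r r0 hr]].
  have er : (e : C) \is Num.real by apply: gtr0_real.
  have eE : e = (complex.Re e)%:C by rewrite (RRe_real er).
  exists (complex.Re e); first by rewrite -(@ltcR R) -eE.
  by move=> z zr; apply: he; rewrite /ball /= sub0r normrN eE -nm_lt.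
apply/nbhs_ballP; exists r%:C => /=; first by rewrite (@ltcR R).
by move=> z; rewrite /ball /= sub0r normrN -nm_lt; exact: hr.
Qed.

(** Compare the first nonzero term with the tail as the argument shrinks. *)
Lemma power_series_unique (c : nat -> C) (r : R) : 0 < r ->
  (forall z, nm z < r -> forall e : R, 0 < e -> exists N, forall n, (N <= n)%N ->
     nm (\sum_(j < n) z ^+ j * c j) < e) -> forall j, c j = 0.
Proof.
move=> r0 h; pose t := r / 2; have t0 : 0 < t by rewrite divr_gt0.
have nt : nm (t%:C : C) = t by rewrite nm_real ger0_norm// ltW.
have [B B0 hB] : exists2 B : R, 0 < B & forall j, nm (c j) * t ^+ j <= B.
  have [||N hN] := h t%:C _ 1; [by rewrite nt /t; lra|by []|].
  exists (2 + \sum_(j < N) nm (c j) * t ^+ j).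
    rewrite ltr_wpDr// sumr_ge0// => j _.
    by rewrite mulr_ge0 ?nm_ge0 ?exprn_ge0// ltW.
  have s0 : 0 <= \sum_(j < N) nm (c j) * t ^+ j.
    by apply: sumr_ge0 => j _; rewrite mulr_ge0 ?nm_ge0 ?exprn_ge0// ltW.
  move=> j; have [jN|jN] := ltnP j N.
    rewrite (bigD1 (Ordinal jN))//= addrCA lerDl addr_ge0// sumr_ge0// => i _.
    by rewrite mulr_ge0 ?nm_ge0 ?exprn_ge0// ltW.
  have a1 := hN _ jN; have a2 := hN _ (leqW jN).
  have e : t%:C ^+ j * c j = \sum_(i < j.+1) t%:C ^+ i * c i - \sum_(i < j) t%:C ^+ i * c i :> C.
    by rewrite big_ord_recr /= addrAC subrr add0r.
  have : nm (t%:C ^+ j * c j) <= 2.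
    by rewrite e; apply: le_trans (nmB _ _) _; lra.
  by rewrite nmM nmX nt mulrC; lra.
elim/ltn_ind => k ih; apply: contrapT => /eqP ck.
have ck0 : 0 < nm (c k) by rewrite nm_gt0.
(* the size of the argument for which the tail is dominated *)
pose x := Num.min (1 / 2) (nm (c k) * t ^+ k / (4 * B)).
have x0 : 0 < x.
  rewrite lt_min; apply/andP; split; first by lra.
  by rewrite divr_gt0 ?mulr_gt0 ?exprn_gt0.
have x2 : x <= 1 / 2 by rewrite ge_min lexx.
have xB : x * (4 * B) <= nm (c k) * t ^+ k.
  by rewrite -ler_pdivlMr ?mulr_gt0// /x ge_min lexx orbT.
have nz : nm ((x * t)%:C : C) = x * t by rewrite nm_real ger0_norm// mulr_ge0 ?ltW.
have [||N hN] := h (x * t)%:C _ (nm (c k) * (x * t) ^+ k / 4).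
- by rewrite nz /t; nra.
- by rewrite divr_gt0// mulr_gt0 ?exprn_gt0// mulr_gt0.
have tail n : nm (\sum_(j < n) ((x * t)%:C) ^+ (k.+1 + j)%N * c (k.+1 + j)%N) <=
    B * (x ^+ k.+1 * 2).
  apply: le_trans (nm_sum _ _ _) _.
  apply: (@le_trans _ _ (\sum_(j < n) B * x ^+ k.+1 * x ^+ j)).
    apply: ler_sum => j _; rewrite nmM nmX nz exprMn.
    apply: (@le_trans _ _ (x ^+ (k.+1 + j) * B)).
      by rewrite -mulrA ler_wpM2l ?exprn_ge0 ?(ltW x0)// mulrC; exact: hB.
    by rewrite exprD mulrC mulrA.
  rewrite -mulr_sumr -mulrA ler_wpM2l ?(ltW B0)// ler_wpM2l ?exprn_ge0 ?(ltW x0)//.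
  apply: le_trans (geometric_sum_le n _) _; first by apply/andP; split; lra.
  by rewrite -[2]invrK lef_pV2 ?posrE; lra.
have := hN (k.+1 + N)%N (leq_addl _ _).
rewrite big_split_ord /= big_ord_recr /= big1 ?add0r; last first.
  by move=> j _; rewrite ih ?mulr0.
move=> lt1; have := tail N; move: lt1.
set tl := \sum_(j < N) _; set hd := _ ^+ k * c k => lt1 lt2.
have hdE : nm hd = nm (c k) * (x * t) ^+ k by rewrite /hd nmM nmX nz mulrC.
have : nm hd <= nm (hd + tl) + nm tl by rewrite -{1}(addrK tl hd); exact: nmB.
have : B * (x ^+ k.+1 * 2) <= nm (c k) * (x * t) ^+ k / 2.
  rewrite exprMn exprS; have : 0 <= x ^+ k by rewrite exprn_ge0// ltW.
  move: (x ^+ k) (t ^+ k) xB => y z xB y0.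
  have : x * (4 * B) * y <= nm (c k) * z * y by rewrite ler_wpM2r.
  lra.
have : 0 < nm (c k) * (x * t) ^+ k by rewrite mulr_gt0 ?exprn_gt0// mulr_gt0.
rewrite hdE; lra.
Qed.

Variables (m d : nat) (Pm : 'M[{poly C}]_m) (Qm : 'M[{poly C}]_(m, d)).
Variables (a : nat -> C) (Ka rho : R).
Hypothesis Ka0 : 0 <= Ka.
Hypothesis rho01 : 0 < rho < 1.
Hypothesis ha : forall n, nm (a n) <= Ka * rho ^+ n.
Hypothesis inva : series_inverse (\det Pm) a.
Hypothesis hdet : forall z : C, nm z <= 1 -> (\det Pm).[z] != 0.

(** Cramer's rule for [invmx Pm *m Qm], with [1 / \det Pm] expanded in the
    coefficients [a]. *)
Definition transfer_coef (j : nat) : 'M[C]_(m, d) :=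
  \matrix_(i, k) series_coef a ((\adj Pm *m Qm) i k) j.

Lemma transfer_funE z i k : nm z <= 1 ->
  transfer_fun Pm Qm z i k = ((\adj Pm *m Qm) i k).[z] / (\det Pm).[z].
Proof.
move=> z1; have dz := hdet z1.
have Pu : evalmxp Pm z \in unitmx by rewrite unitmxE det_evalmxp unitfE.
have -> : transfer_fun Pm Qm z = ((\det Pm).[z])^-1 *: evalmxp (\adj Pm *m Qm) z.
  rewrite /transfer_fun; apply: (can_inj (mulKmx Pu)).
  rewrite mulmxA (mulmxV Pu) mul1mx -scalemxAr -evalmxpM mulmxA mul_mx_adj mul_scalar_mx.
  by apply/matrixP => i' k'; rewrite !mxE hornerM mulrA mulVf// mul1r.
by rewrite mxE [evalmxp _ _ _ _]mxE mulrC.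
Qed.

(** Multiplied by the determinant, the truncation at order [n] differs from the
    numerator by ['X^n] times a polynomial of bounded degree with bounded
    coefficients. *)
Lemma transfer_coef_expansion z : nm z < 1 ->
  series (fun j => z ^+ j *: transfer_coef j) @ \oo --> transfer_fun Pm Qm z.
Proof.
move=> z1; apply/mx_cvgP => e e0; have dz := hdet (ltW z1).
have key i k : exists N, forall n, (N <= n)%N ->
    nm (series (fun j => z ^+ j *: transfer_coef j) n i k - transfer_fun Pm Qm z i k) < e.
  set Nik := (\adj Pm *m Qm) i k.
  pose q n := \poly_(l < n) series_coef a Nik l.
  have sE n : series (fun j => z ^+ j *: transfer_coef j) n i k = (q n).[z].
    rewrite /series /= summxE big_mkord horner_poly; apply: eq_bigr => j _.
    by rewrite mxE [transfer_coef _ _ _]mxE mulrC.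
  have [K' K'0 hK'] := series_coef_decay Nik Ka0 rho01 ha.
  pose al := \det Pm.
  pose B := (\sum_(l < size al) nm al`_l) * (K' / 1 ^+ size al).
  have S0 : 0 <= \sum_(l < size al) nm al`_l by apply: sumr_ge0 => l _; exact: nm_ge0.
  have B0 : 0 <= B by rewrite mulr_ge0// expr1n divr1.
  have [|||M hM] := @expr_lt_eventually R (nm z) (e * nm al.[z] / ((size al)%:R * B + 1)).
  - exact: nm_ge0.
  - exact: z1.
  - by rewrite divr_gt0 ?mulr_gt0 ?nm_gt0// ltr_wpDl// mulr_ge0.
  exists (maxn (size Nik) M) => n; rewrite geq_max => /andP[nN nM].
  rewrite sE transfer_funE; last exact: ltW.
  have cE : al * q n = Nik + 'X^n * drop_poly n (al * q n).
    rewrite -{1}[al * q n](poly_take_drop n) [_ * 'X^n]mulrC; congr (_ + _).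
    apply/polyP => j; rewrite coef_take_poly; case: ltnP => jn.
      by rewrite series_coef_mul.
    by rewrite nth_default// (leq_trans nN).
  have dE : (q n).[z] - Nik.[z] / al.[z] = z ^+ n * (drop_poly n (al * q n)).[z] / al.[z].
    have h : al.[z] * (q n).[z] = Nik.[z] + z ^+ n * (drop_poly n (al * q n)).[z].
      by rewrite -hornerM {1}cE hornerD hornerM hornerXn.
    have -> : (q n).[z] = (Nik.[z] + z ^+ n * (drop_poly n (al * q n)).[z]) / al.[z].
      by rewrite -h mulrC mulKf.
    by rewrite mulrDl addrAC subrr add0r.
  have bD : nm (drop_poly n (al * q n)).[z] <= (size al)%:R * B.
    have sz : (size (drop_poly n (al * q n)) <= size al)%N.
      rewrite size_drop_poly (leq_trans (leq_sub2r _ (size_polyMleq _ _)))//.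
      have := size_poly n (series_coef a Nik); rewrite -/(q n).
      by move: (size (q n)) (size al) => x1 x2; clear; lia.
    rewrite (horner_coef_wide _ sz); apply: le_trans (nm_sum _ _ _) _.
    rewrite mulr_natl -[size al in leRHS]card_ord -sumr_const; apply: ler_sum => l _.
    rewrite nmM coef_drop_poly nmX; apply: (@le_trans _ _ (B * 1)); last by rewrite mulr1.
    apply: ler_pM; rewrite ?nm_ge0 ?exprn_ge0 ?nm_ge0//; last first.
      by rewrite exprn_ile1 ?nm_ge0// ltW.
    have h01 : 0 < (1 : R) <= 1 by rewrite ltr01 lexx.
    have hS l' : nm (series_coef a Nik l') <= K' * 1 ^+ l'.
      rewrite expr1n mulr1; apply: le_trans (hK' l') _.
      have /andP[r0 r1] := rho01.
      by rewrite ler_piMr// exprn_ile1// ltW.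
    have := coef_mul_bound al n (l + n)%N K'0 h01 hS.
    by rewrite -/B [(1 : R) ^+ (l + n)]expr1n mulr1 [_ * al]mulrC.
  rewrite dE !nmM nmX nmV ltr_pdivrMr ?nm_gt0//.
  apply: (@le_lt_trans _ _ (nm z ^+ M * ((size al)%:R * B + 1))).
    apply: ler_pM; rewrite ?nm_ge0 ?exprn_ge0 ?nm_ge0//.
      by apply: ler_wiXn2l => //; [exact: nm_ge0|exact: ltW].
    by apply: le_trans bD _; rewrite lerDl.
  by rewrite -ltr_pdivlMr// ltr_wpDl// mulr_ge0.
have /choice[N hN] : forall ik : 'I_m * 'I_d, exists N, forall n, (N <= n)%N ->
    nm (series (fun j => z ^+ j *: transfer_coef j) n ik.1 ik.2 - transfer_fun Pm Qm z ik.1 ik.2) < e.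
  by move=> [i k]; exact: key.
exists (\max_ik N ik) => n hn i k; apply: (hN (i, k)).
by apply: leq_trans hn; exact: leq_bigmax.
Qed.

Lemma transfer_coef_taylor : taylor_expansion0 (transfer_fun Pm Qm) transfer_coef.
Proof.
apply/near0_cplxP; exists 1 => // z; exact: transfer_coef_expansion.
Qed.

Lemma taylor_coef_unique (M : nat -> 'M[C]_(m, d)) :
  taylor_expansion0 (transfer_fun Pm Qm) M -> forall j, M j = transfer_coef j.
Proof.
move=> /near0_cplxP[r r0 hr] j; apply/matrixP => i k.
apply/eqP; rewrite -subr_eq0; apply/eqP.
apply: (@power_series_unique (fun j => M j i k - transfer_coef j i k) (Num.min r 1)) => //.
  by rewrite lt_min r0 ltr01.
move=> z; rewrite lt_min => /andP[zr z1] e e0.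
have e2 : 0 < e / 2 by rewrite divr_gt0.
have [N1 h1] := (mx_cvgP _ _).1 (hr z zr) _ e2.
have [N2 h2] := (mx_cvgP _ _).1 (transfer_coef_expansion z1) _ e2.
exists (maxn N1 N2) => n; rewrite geq_max => /andP[n1 n2].
have a1 := h1 n n1 i k; have a2 := h2 n n2 i k.
have sE (X : nat -> 'M[C]_(m, d)) : series (fun j => z ^+ j *: X j) n i k =
    \sum_(j < n) z ^+ j * X j i k.
  by rewrite /series /= summxE big_mkord; apply: eq_bigr => l _; rewrite mxE.
rewrite !sE in a1 a2.
have -> : \sum_(j < n) z ^+ j * (M j i k - transfer_coef j i k) =
   (\sum_(j < n) z ^+ j * M j i k - transfer_fun Pm Qm z i k) -
   (\sum_(j < n) z ^+ j * transfer_coef j i k - transfer_fun Pm Qm z i k).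
  by under eq_bigr do rewrite mulrBr; rewrite sumrB; ring.
by apply: le_lt_trans (nmB _ _) _; lra.
Qed.

End Taylor.

(** * Random power series and the causal solution *)

Section CausalSums.
Context {R : realType}.
Local Notation C := (cplx R).

(** The upper limit is defined for every sequence, so measurability in parameters
    does not require convergence. *)
Definition rlim (s : nat -> R) : R := fine (limn_esup (EFin \o s)).

Lemma rlim_rate (s g : nat -> R) :
  (forall N M, (N <= M)%N -> `|s M - s N| <= g N) -> forall N, `|s N - rlim s| <= g N.
Proof.
move=> h N.
have hi : (limn_esup (EFin \o s) <= (s N + g N)%:E)%E.
  apply: ereal_inf_le; exists (ereal_sup ((EFin \o s) @` [set M | (N <= M)%N])).
    by exists [set M | (N <= M)%N] => //; exists N.
  apply: ge_ereal_sup => _ [M /= NM <-]; rewrite lee_fin.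
  by have := h _ _ NM; rewrite ler_distl => /andP[_]; rewrite addrC.
have lo : ((s N - g N)%:E <= limn_esup (EFin \o s))%E.
  apply: le_ereal_inf_tmp => _ [A [N0 _ hA] <-].
  apply: ereal_sup_ge; exists (s (maxn N N0))%:E.
    by exists (maxn N N0) => //; apply: hA; rewrite /= leq_maxr.
  rewrite lee_fin; have := h _ _ (leq_maxl N N0).
  by rewrite ler_distl => /andP[].
have fn : limn_esup (EFin \o s) \is a fin_num.
  by rewrite fin_numElt (lt_le_trans _ lo) ?ltNyr// (le_lt_trans hi) ?ltry.
move: lo hi; rewrite -(fineK fn) !lee_fin -/(rlim s) => lo hi.
by rewrite ler_distl; apply/andP; split; lra.
Qed.

Lemma rlim_measurable d (W : measurableType d) (s : nat -> W -> R) :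
  (forall n, measurable_fun setT (s n)) -> measurable_fun setT (fun w => rlim (s^~ w)).
Proof.
move=> ms; apply: (measurableT_comp (fine_measurable (@measurableT _ (\bar R)))) => //.
apply: (measurable_fun_limn_esup (f := fun n w => (s n w)%:E)) => n.
exact/measurable_EFinP.
Qed.

(** The sum of a convergent complex series, and a junk value otherwise. *)
Definition csum (u : nat -> C) : C :=
  Complex (rlim (fun N => rep (\sum_(n < N) u n))) (rlim (fun N => imp (\sum_(n < N) u n))).

Lemma csum_cmeas d (W : measurableType d) (u : nat -> W -> C) :
  (forall n, cmeas (u n)) -> cmeas (fun w => csum (u^~ w)).
Proof.
move=> mu; have mS N := cmeas_sum (index_enum 'I_N) (fun=> true) (fun n : 'I_N => mu n).
by split; apply: rlim_measurable => N; have [] := mS N.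
Qed.

Lemma geometric_block (r : R) (N k : nat) : 0 <= r < 1 ->
  \sum_(n < k) r ^+ (N + n) <= r ^+ N / (1 - r).
Proof.
move=> r01; under eq_bigr do rewrite exprD.
have /andP[r0 _] := r01.
by rewrite -mulr_sumr ler_wpM2l ?exprn_ge0// geometric_sum_le.
Qed.

Lemma csum_rate (u : nat -> C) (B r : R) : 0 <= B -> 0 <= r < 1 ->
  (forall n, nm (u n) <= B * r ^+ n) ->
  forall N, nm (\sum_(n < N) u n - csum u) <= 2 * B / (1 - r) * r ^+ N.
Proof.
move=> B0 r01 hu N; have /andP[r0 r1] := r01.
pose S N := \sum_(n < N) u n; pose g N := B * (r ^+ N / (1 - r)).
have hS N' M : (N' <= M)%N -> nm (S M - S N') <= g N'.
  move=> /subnKC <-; rewrite /S big_split_ord /= addrAC subrr add0r.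
  apply: le_trans (nm_sum _ _ _) _.
  apply: (@le_trans _ _ (\sum_(n < M - N') B * r ^+ (N' + n))); first exact: ler_sum.
  by rewrite -mulr_sumr ler_wpM2l// geometric_block.
have h1 := @rlim_rate (rep \o S) g _ N; have h2 := @rlim_rate (imp \o S) g _ N.
apply: le_trans (nm_le_rep_imp _) _; rewrite repB impB.
have -> : 2 * B / (1 - r) * r ^+ N = g N + g N by rewrite /g; ring.
apply: lerD.
  by apply: h1 => N' M NM /=; rewrite -repB; apply: le_trans (rep_le_nm _) _; exact: hS.
by apply: h2 => N' M NM /=; rewrite -impB; apply: le_trans (imp_le_nm _) _; exact: hS.
Qed.

Lemma eventually_geometric (u : nat -> R) (B r : R) (N : nat) : 0 <= B -> 0 < r ->
  (forall n, 0 <= u n) -> (forall n, (N <= n)%N -> u n <= B * r ^+ n) ->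
  exists2 B', 0 <= B' & forall n, u n <= B' * r ^+ n.
Proof.
move=> B0 r0 u0 h; pose S := \sum_(n < N) u n / r ^+ n.
have t0 n : 0 <= u n / r ^+ n by rewrite divr_ge0// exprn_ge0// ltW.
have S0 : 0 <= S by apply: sumr_ge0.
exists (B + S); first by rewrite addr_ge0.
move=> n; have [Nn|nN] := leqP N n.
  by apply: le_trans (h n Nn) _; rewrite ler_wpM2r ?exprn_ge0 ?(ltW r0)// lerDl.
rewrite -ler_pdivrMr ?exprn_gt0//; apply: (@le_trans _ _ S); last by rewrite lerDr.
by rewrite /S (bigD1 (Ordinal nN))//= lerDl sumr_ge0.
Qed.

End CausalSums.

Section StableRecursion.
Context {R : realType}.
Local Notation C := (cplx R).
Variables (m d : nat) (Pm : 'M[{poly C}]_m) (Qm : 'M[{poly C}]_(m, d)).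
Variables (a : nat -> C) (Ka rho : R).
Hypothesis Ka0 : 0 <= Ka.
Hypothesis rho01 : 0 < rho < 1.
Hypothesis ha : forall n, nm (a n) <= Ka * rho ^+ n.
Hypothesis inva : series_inverse (\det Pm) a.

Local Notation M := (transfer_coef Pm Qm a).

(** The identity [Pm * M = Qm] of power series, coefficient by coefficient. *)
Lemma transfer_coef_equation l k N j : (j < N)%N ->
  \sum_r (Pm l r * \poly_(n < N) M n r k)`_j = (Qm l k)`_j.
Proof.
move=> jN; pose A := \poly_(n < N) a n.
have e r : (Pm l r * \poly_(n < N) M n r k)`_j = (Pm l r * (A * (\adj Pm *m Qm) r k))`_j.
  apply: coefM_low => i ij; have iN := leq_ltn_trans ij jN.
  by rewrite coef_poly iN mxE series_coefE.
under eq_bigr do rewrite e.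
rewrite -coef_sum; under eq_bigr do rewrite mulrCA.
rewrite -mulr_sumr.
have -> : \sum_r Pm l r * (\adj Pm *m Qm) r k = \det Pm * Qm l k.
  transitivity ((Pm *m (\adj Pm *m Qm)) l k); first by rewrite mxE.
  by rewrite mulmxA mul_mx_adj mul_scalar_mx mxE.
rewrite mulrCA mulrA mulrC (@coefM_low _ _ _ 1) ?mulr1// => i ij.
by rewrite inva ?coef1// (leq_ltn_trans ij jN).
Qed.

(** Multiplying by the adjugate turns the recursion into a scalar one, whose
    solutions are convolutions of the coefficients [a] with initial data. *)
Lemma stable_recursion_decay (p : nat) : exists2 K : R, 0 <= K &
  forall x : nat -> 'I_m -> C,
  (forall l n, (p <= n)%N -> \sum_r (Pm l r * \poly_(h < n.+1) x h r)`_n = 0) ->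
  forall n i, nm (x n i) <= K * rho ^+ n * \sum_(j < p) \sum_r nm (x j r).
Proof.
have /andP[r0 r1] := rho01.
have /choice[K' hK'] : forall il : 'I_m * 'I_m, exists K' : R, 0 <= K' /\
    forall j, nm (series_coef a (\adj Pm il.1 il.2) j) <= K' * rho ^+ j.
  move=> il; have [K' K'0 h] := series_coef_decay (\adj Pm il.1 il.2) Ka0 rho01 ha.
  by exists K'.
pose b l r := \sum_(h < size (Pm l r)) nm (Pm l r)`_h.
have b0 l r : 0 <= b l r by apply: sumr_ge0 => h _; exact: nm_ge0.
pose k0 i := \sum_l p%:R * (\sum_r b l r) * (K' (i, l) / rho ^+ p).
have k00 i : 0 <= k0 i.
  apply: sumr_ge0 => l _; have [K'0 _] := hK' (i, l).
  by rewrite !mulr_ge0 ?sumr_ge0// invr_ge0 exprn_ge0// ltW.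
exists (\sum_i k0 i); first exact: sumr_ge0.
move=> x hx n i; pose N := n.+1; pose A := \poly_(h < N) a h.
pose f r : {poly C} := \poly_(h < N) x h r.
pose g l := \sum_r Pm l r * f r.
set W := \sum_(j < p) _.
have W0 : 0 <= W by apply: sumr_ge0 => j _; apply: sumr_ge0 => r _; exact: nm_ge0.
have ggE l j : (j <= n)%N -> (g l)`_j = \sum_r (Pm l r * \poly_(h < j.+1) x h r)`_j.
  move=> jn; rewrite /g coef_sum; apply: eq_bigr => r _; apply: coefM_low => h hj.
  by rewrite !coef_poly ltnS hj ltnS (leq_trans hj jn).
have gp l j : (j <= n)%N -> (g l)`_j = (take_poly p (g l))`_j.
  by move=> jn; rewrite coef_take_poly; case: ltnP => // pj; rewrite ggE// hx.
have gb l j : (j < p)%N -> nm (g l)`_j <= (\sum_r b l r) * W.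
  move=> jp; rewrite /g coef_sum; apply: le_trans (nm_sum _ _ _) _.
  rewrite mulr_suml; apply: ler_sum => r _; rewrite coefM.
  apply: le_trans (nm_sum _ _ _) _.
  apply: (@le_trans _ _ (\sum_(h < j.+1) nm (Pm l r)`_h * W)).
    apply: ler_sum => h _; rewrite nmM ler_wpM2l ?nm_ge0//.
    rewrite coef_poly; case: ifP => _; last by rewrite nm0.
    have hp : (j - h < p)%N by rewrite (leq_ltn_trans _ jp)// leq_subr.
    rewrite /W (bigD1 (Ordinal hp))//= (bigD1 r)//= -addrA lerDl addr_ge0 ?sumr_ge0// => *.
      exact: nm_ge0.
    by apply: sumr_ge0 => ? _; exact: nm_ge0.
  by rewrite -mulr_suml ler_wpM2r// sum_coef_le.
have xE : x n i = \sum_l (\poly_(h < N) series_coef a (\adj Pm i l) h * take_poly p (g l))`_n.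
  have -> : x n i = (f i)`_n by rewrite coef_poly ltnSn.
  have -> : (f i)`_n = (f i * (\det Pm * A))`_n.
    rewrite (@coefM_low _ _ _ 1) ?mulr1// => h hn.
    by rewrite inva ?coef1// ltnS.
  have -> : f i * (\det Pm * A) = \sum_l g l * (A * \adj Pm i l).
    have -> : f i * (\det Pm * A) = A * \sum_r (\det Pm)%:M i r * f r.
      rewrite (bigD1 i)//= big1 ?addr0; last first.
        by move=> r ri; rewrite mxE eq_sym (negbTE ri) mul0r.
      by rewrite mxE eqxx mulr1n; ring.
    rewrite -mul_adj_mx; under eq_bigr do rewrite mxE mulr_suml.
    rewrite exchange_big /= mulr_sumr; apply: eq_bigr => l _.
    by rewrite /g mulr_suml mulr_sumr; apply: eq_bigr => r _; ring.
  rewrite coef_sum; apply: eq_bigr => l _.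
  rewrite [g l * _](mulrC); rewrite (@coefM_low _ _ _ (take_poly p (g l))); last first.
    by move=> h hn; exact: gp.
  rewrite mulrC [in RHS]mulrC; apply: coefM_low => h hn.
  by rewrite coef_poly ltnS hn series_coefE.
rewrite xE; apply: le_trans (nm_sum _ _ _) _.
apply: (@le_trans _ _ (k0 i * (rho ^+ n * W))); last first.
  rewrite -mulrA ler_wpM2r ?mulr_ge0 ?exprn_ge0 ?(ltW r0)//.
  by rewrite (bigD1 i)//= lerDl sumr_ge0.
rewrite /k0 mulr_suml; apply: ler_sum => l _.
have [K'0 hS] := hK' (i, l).
have r01 : 0 < rho <= 1 by rewrite r0 ltW.
apply: le_trans (coef_mul_bound (take_poly p (g l)) N n K'0 r01 hS) _.
rewrite [leRHS](_ : _ = p%:R * ((\sum_r b l r) * W) * (K' (i, l) / rho ^+ p) * rho ^+ n); last by ring.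
rewrite ler_wpM2r ?exprn_ge0 ?(ltW r0)//.
have szp : (size (take_poly p (g l)) <= p)%N by exact: size_take_poly.
apply: ler_pM.
- by apply: sumr_ge0 => j _; exact: nm_ge0.
- by rewrite divr_ge0// exprn_ge0// ltW.
- apply: (@le_trans _ _ (\sum_(j < p) (\sum_r b l r) * W)); last first.
    by rewrite sumr_const card_ord mulr_natl.
  rewrite (big_ord_widen p (fun j => nm (take_poly p (g l))`_j) szp) big_mkcond.
  apply: ler_sum => j _; rewrite coef_take_poly ltn_ord; case: ifP => _; first exact: gb.
  by rewrite mulr_ge0// sumr_ge0.
rewrite ler_wpM2l// lef_pV2 ?posrE ?exprn_gt0//.
by rewrite ler_wiXn2l ?(ltW r0)// ltW.
Qed.

End StableRecursion.

Section Growth.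
Context {R : realType} {disp : measure_display} {T : measurableType disp}.
Variable P : probability T R.
Local Notation C := (cplx R).
Local Notation pr := (pr P).
Variables (m d : nat) (Z : int -> {RV P >-> 'cV[C]_d}).
Hypothesis hZ : iid Z.
Variable U : 'M[C]_d.

Lemma le_expR_logplus (x y : R) : logplus x <= y -> x <= expR y.
Proof.
rewrite /logplus => h; apply: (@le_trans _ _ (Num.max 1 x)); first by rewrite le_max lexx orbT.
by rewrite -[leLHS]lnK ?ler_expR// posrE lt_max ltr01.
Qed.

(** First Borel-Cantelli lemma: the layer-cake bound makes the probabilities of
    the events [c * (n + 1) < logplus (nm (comb b (t - n)))] summable. *)
Lemma subexponential_growth (b : 'I_d -> C) (c : R) (t : int) : 0 < c ->
  ('E_P[fun w => logplus (nm (comb Z U b 0 w))] < +oo)%E ->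
  {ae P, forall w, exists N, forall n, (N <= n)%N ->
    nm (comb Z U b (t - n%:Z) w) <= expR (c * n.+1%:R)}.
Proof.
move=> c0 fin.
pose A n : set T := [set w | c * n.+1%:R < logplus (nm (comb Z U b (t - n%:Z) w))].
have mL s : measurable_fun setT (fun w => logplus (nm (comb Z U b s w))).
  by apply: logplus_measurable; apply: cmeas_nm; exact: comb_cmeas.
have mA n : measurable (A n) by exact: measurable_gtr.
have [B hB] := layers_le_expectation (mL 0) (fun=> logplus_ge0 _) c0 fin.
have pE n : pr (A n) = pr [set w | c * n.+1%:R < logplus (nm (comb Z U b 0 w))].
  apply: (iid_marginal hZ (t - n%:Z) 0
    (B := [set x | c * n.+1%:R < logplus (nm (combv U b x))])).
  apply: measurable_gtr; apply: logplus_measurable; apply: cmeas_nm.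
  exact: combv_cmeas.
have hB' N : \sum_(n < N) pr (A n) <= B.
  by rewrite (eq_bigr _ (fun (n : 'I_N) _ => pE n)); exact: hB.
have hs : (\sum_(n <oo) P (A n) < +oo)%E.
  exact: le_lt_trans (nneseries_pr_le mA hB') (ltry _).
have : P (lim_sup_set A) = 0%E := lim_sup_set_cvg0 mA hs.
move=> h0.
have mS : measurable (lim_sup_set A).
  by apply: bigcapT_measurable => n; apply: bigcup_measurable => k _.
have : P.-negligible (lim_sup_set A) by apply: pr0_negligible => //; rewrite /pr h0.
apply: negligibleS => w /= hw N _; apply: contrapT => h; apply: hw; exists N => n Nn.
apply: le_expR_logplus; rewrite leNgt; apply/negP => h1; apply: h; exists n => //.
Qed.

End Growth.

Section Solution.
Context {R : realType} {disp : measure_display} {T : measurableType disp}.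
Variable P : probability T R.
Local Notation C := (cplx R).
Local Notation pr := (pr P).
Variables (m d : nat) (Z : int -> {RV P >-> 'cV[C]_d}).
Hypothesis hZ : iid Z.
Variable U : 'M[C]_d.
Variables (Pm : 'M[{poly C}]_m) (Qm : 'M[{poly C}]_(m, d)).
Variables (a : nat -> C) (Ka rho : R).
Hypothesis Ka0 : 0 <= Ka.
Hypothesis rho01 : 0 < rho < 1.
Hypothesis ha : forall n, nm (a n) <= Ka * rho ^+ n.
Hypothesis inva : series_inverse (\det Pm) a.
Variables (p q J : nat).
Hypothesis szP : forall i j, (size (Pm i j) <= p.+1)%N.
Hypothesis szQ : forall i k, (size (Qm i k) <= q.+1)%N.
Hypothesis qJ : (q < J + p)%N.

Local Notation M := (transfer_coef Pm Qm a).
Local Notation xi n i := (comb Z U (M n i)).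

Hypothesis hmom : forall j i, (j < p)%N ->
  ('E_P[fun w => logplus (nm (xi (J + j) i 0 w))] < +oo)%E.

Lemma shifted_recursion (b : {poly C}) (mu : nat -> C) (n : nat) :
  (size b <= p.+1)%N -> (p <= n)%N ->
  (b * \poly_(h < n.+1) mu (J + h)%N)`_n = (b * \poly_(h < (J + n).+1) mu h)`_(J + n).
Proof.
move=> sb pn; rewrite !coefM.
have nJ : (n.+1 <= (J + n).+1)%N by rewrite ltnS leq_addl.
rewrite (big_ord_widen _ (fun h => b`_h * (\poly_(h < n.+1) mu (J + h)%N)`_(n - h)) nJ).
rewrite big_mkcond; apply: eq_bigr => h _; case: ltnP => hn.
  by rewrite !coef_poly !ltnS !leq_subr addnBA.
rewrite nth_default ?mul0r//; apply: leq_trans sb _.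
exact: leq_trans hn.
Qed.

(** At a fixed noise vector, the terms of the series from index [J] on satisfy
    the homogeneous recursion of [Pm]. *)
Lemma noise_series_recursion (s : int) (w : T) (l : 'I_m) (n : nat) : (p <= n)%N ->
  \sum_r (Pm l r * \poly_(h < n.+1) xi (J + h)%N r s w)`_n = 0.
Proof.
move=> pn.
have e r : (Pm l r * \poly_(h < n.+1) xi (J + h)%N r s w)`_n =
    \sum_k (Pm l r * \poly_(h < (J + n).+1) M h r k)`_(J + n) * noise Z U k s w.
  rewrite (shifted_recursion (fun h => xi h r s w) (szP l r) pn) coefM.
  under [RHS]eq_bigr do rewrite coefM mulr_suml.
  rewrite exchange_big; apply: eq_bigr => h _; rewrite coef_poly ltnS leq_subr mulr_sumr.
  by apply: eq_bigr => k _; rewrite coef_poly ltnS leq_subr mulrA.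
under eq_bigr do rewrite e.
rewrite exchange_big big1// => k _; rewrite -mulr_suml.
rewrite (transfer_coef_equation Qm inva)// nth_default ?mul0r//.
apply: leq_trans (szQ l k) _; apply: leq_trans qJ _.
by rewrite leq_add2l.
Qed.

(* any rate strictly between [rho] and 1 *)
Let r := (1 + rho) / 2.
Let r01 : 0 < r < 1. Proof. by have /andP[] := rho01; rewrite /r; lra. Qed.
(** The terms decay like [rho ^+ n] times a window of noise terms, which grows at
    most like [(r / rho) ^+ n]. *)
Lemma noise_series_bound : {ae P, forall w, forall t, exists2 B, 0 <= B &
  forall n i, nm (xi n i (t - n%:Z) w) <= B * r ^+ n}.
Proof.
have /andP[rho0 rho1] := rho01; have /andP[r0 r1] := r01.
have [K K0 hK] := stable_recursion_decay Ka0 rho01 ha inva p.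
have rhor : rho < r by rewrite /r; lra.
pose c := ln (r / rho).
have rr : 0 < r / rho by rewrite divr_gt0.
have c0 : 0 < c by rewrite ln_gt0// ltr_pdivlMr ?mul1r.
have cE : expR c = r / rho by rewrite lnK// posrE.
apply: ae_forall_int => t.
have : {ae P, forall w, forall ji : 'I_p * 'I_m, exists N, forall n, (N <= n)%N ->
    nm (xi (J + ji.1)%N ji.2 (t - n%:Z) w) <= expR (c * n.+1%:R)}.
  by apply: ae_forall_fin => ji; apply: subexponential_growth => //; exact: hmom.
apply: filterS => w /choice[N hN].
pose N0 := (J + \max_ji N ji)%N.
pose u n := \sum_i nm (xi n i (t - n%:Z) w).
have [||||B B0 hB] := @eventually_geometric R u
    (\sum_(i < m) K / rho ^+ J * (p * m)%:R * expR c) r N0.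
- apply: sumr_ge0 => i _.
  by rewrite !mulr_ge0 ?expR_ge0 ?invr_ge0 ?exprn_ge0// ltW.
- exact: r0.
- by move=> n; apply: sumr_ge0 => i _; exact: nm_ge0.
- move=> n Nn; rewrite /u mulr_suml; apply: ler_sum => i _.
  have Jn : (J <= n)%N by apply: leq_trans Nn; exact: leq_addr.
  have := hK (fun h l => xi (J + h)%N l (t - n%:Z) w)
    (fun l k => @noise_series_recursion (t - n%:Z) w l k) (n - J)%N i.
  rewrite subnKC// => h; apply: le_trans h _.
  apply: (@le_trans _ _ (K * rho ^+ (n - J) * ((p * m)%:R * expR (c * n.+1%:R)))).
    rewrite ler_wpM2l ?mulr_ge0 ?exprn_ge0 ?(ltW rho0)//.
    have -> : (p * m)%:R * expR (c * n.+1%:R) = \sum_(j < p) \sum_(i < m) expR (c * n.+1%:R).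
      by rewrite !sumr_const !card_ord -mulrnA mulr_natl mulnC.
    apply: ler_sum => j _; apply: ler_sum => l _; apply: (hN (j, l)).
    apply: leq_trans (leq_trans (leq_addl J _) Nn).
    exact: leq_bigmax.
  rewrite [c * _]mulrC expRM_natl cE exprS expr_div_n.
  have -> : rho ^+ n = rho ^+ (n - J) * rho ^+ J by rewrite -exprD subnK.
  rewrite le_eqVlt; apply/orP; left; apply/eqP; field.
  by rewrite !expf_neq0 ?gt_eqF.
exists B => // n i; apply: le_trans (hB n).
by rewrite /u (bigD1 i)//= lerDl sumr_ge0// => *; exact: nm_ge0.
Qed.

(** Defined on trajectories, in order to apply the shift invariance of the law of
    the noise. *)
Definition solution_entry (c' : 'I_m -> C) (t : int) (x : int -> 'cV[C]_d) (i : 'I_m) : C :=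
  csum (fun n => combv U (M n i) (x (t - n%:Z))) + c' i.

Lemma solution_entry_cmeas dd (W : measurableType dd) c' (t : int) (X : int -> W -> 'cV[C]_d) i :
  (forall u, (u <= t)%R -> measurable_fun setT (X u)) ->
  cmeas (fun w => solution_entry c' t (X^~ w) i).
Proof.
move=> mX; apply: cmeasD; last exact: cmeas_cst.
apply: csum_cmeas => n; apply: (cmeas_comp (combv_cmeas U _)); apply: mX.
by rewrite gerBl.
Qed.

Lemma solution_entry_shift c' (t h : int) (x : int -> 'cV[C]_d) i :
  solution_entry c' (t + h) x i = solution_entry c' t (fun u => x (u + h)) i.
Proof.
rewrite /solution_entry.
have e : (fun n : nat => combv U (M n i) (x (t + h - n%:Z))) =
    (fun n : nat => combv U (M n i) (x (t - n%:Z + h))).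
  by apply/funext => n; rewrite (_ : t + h - n%:Z = t - n%:Z + h)// addrAC.
by rewrite e.
Qed.

(** Hiding the noise before time [t - N] turns the truncated series into exact
    polynomials in the backward shift. *)
Lemma truncated_solution (z : 'I_d -> int -> C) (t : int) (l : 'I_m) (N : nat) :
  (q < N)%N ->
  \sum_i \sum_(h < size (Pm l i)) (Pm l i)`_h *
    (\sum_(n < N - h) \sum_k M n i k * z k (t - h%:Z - n%:Z)) =
  \sum_k pact (Qm l k) (z k) t.
Proof.
move=> qN.
pose z' k u : C := if (u <= t - N%:Z)%R then 0 else z k u.
pose mN i k := \poly_(n < N) M n i k.
have low (b : {poly C}) k : (size b <= N)%N -> pact b (z' k) t = pact b (z k) t.
  move=> bN; apply: eq_bigr => n _; rewrite /z'; case: ifPn => // h; exfalso.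
  have : (n < N)%N by apply: leq_trans bN; exact: ltn_ord.
  by move: h; clear; lia.
have zero (b : {poly C}) k : pact b (z' k) (t - N%:Z) = 0.
  by apply: big1 => n _; rewrite /z' gerBl mulr0.
transitivity (\sum_i pact (Pm l i) (fun u => \sum_k pact (mN i k) (z' k) u) t).
  apply: eq_bigr => i _; apply: eq_bigr => h _; congr (_ * _).
  under [RHS]eq_bigr do rewrite (@pact_wide _ N) ?size_poly//.
  rewrite [RHS]exchange_big /= (big_ord_widen N (fun n => \sum_k M n i k * z k (t - h%:Z - n%:Z))) ?leq_subr//.
  rewrite big_mkcond; apply: eq_bigr => n _.
  have -> : (n < N - h)%N = ~~ (t - h%:Z - n%:Z <= t - N%:Z)%R.
    by clear; lia.
  rewrite /z'; case: ifP => /= hn.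
    by apply: eq_bigr => k _; rewrite (negbTE hn) coef_poly ltn_ord.
  by rewrite big1// => k _; rewrite (negbFE hn) mulr0.
under eq_bigr do rewrite pact_sumr.
rewrite exchange_big; apply: eq_bigr => k _.
under eq_bigr do rewrite -pactM.
rewrite -pact_suml.
have -> : \sum_i Pm l i * mN i k = Qm l k + 'X^N * drop_poly N (\sum_i Pm l i * mN i k).
  rewrite -{1}[\sum_i _](poly_take_drop N) [_ * 'X^N]mulrC; congr (_ + _).
  apply/polyP => j; rewrite coef_take_poly; case: ltnP => jN.
    by rewrite coef_sum (transfer_coef_equation Qm inva).
  by rewrite nth_default// (leq_trans (szQ l k))// (leq_trans qN).
rewrite pactD pactM pactXn zero addr0 low//.
by rewrite (leq_trans (szQ l k)).
Qed.

(** Both sides are compared with truncations of order [N]. The truncation at time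
    [t - h] stops at order [N - h], so that all of them use the noise after time
    [t - N] only. *)
Lemma solution_entry_equation (c' : 'I_m -> C) : {ae P, forall w, forall t l,
  \sum_i pact (Pm l i) (fun u => solution_entry c' u (fun v => Z v w) i) t =
  \sum_k pact (Qm l k) (fun u => noise Z U k u w) t + \sum_i (Pm l i).[1] * c' i}.
Proof.
have /andP[r0 r1] := r01.
have r01' : 0 <= r < 1 by rewrite ltW.
apply: filterS noise_series_bound => w hw t l.
have /choice[B hB] : forall u : int, exists B : R, 0 <= B /\
    forall n i, nm (xi n i (u - n%:Z) w) <= B * r ^+ n.
  by move=> u; have [B B0 h] := hw u; exists B.
pose L u i := csum (fun n => xi n i (u - n%:Z) w).
pose S u i N := \sum_(n < N) xi n i (u - n%:Z) w.
have rate u i N : nm (S u i N - L u i) <= 2 * B u / (1 - r) * r ^+ N.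
  have [B0 hu] := hB u.
  exact: (csum_rate B0 r01' (fun n => hu n i) N).
have -> : \sum_i pact (Pm l i) (fun u => solution_entry c' u (fun v => Z v w) i) t =
   \sum_i pact (Pm l i) (L^~ i) t + \sum_i (Pm l i).[1] * c' i.
  by rewrite -big_split /=; apply: eq_bigr => i _; rewrite -(pact_cst _ _ t) -pactDr.
congr (_ + _); apply/eqP; rewrite -subr_eq0 -nm_eq0 eq_le nm_ge0 andbT.
rewrite leNgt; apply/negP => e0.
set e := nm _ in e0.
pose E := \sum_i \sum_(h < size (Pm l i)) nm (Pm l i)`_h *
  (2 * B (t - h%:Z) / (1 - r) / r ^+ h).
have E0 : 0 <= E.
  apply: sumr_ge0 => i _; apply: sumr_ge0 => h _.
  have [B0 _] := hB (t - h%:Z).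
  rewrite mulr_ge0 ?nm_ge0// divr_ge0 ?exprn_ge0 ?(ltW r0)//.
  by rewrite divr_ge0 ?mulr_ge0// subr_ge0 ltW.
have [|||N0 hN0] := @expr_lt_eventually R r (e / (E + 1)).
- exact: ltW.
- exact: r1.
- by rewrite divr_gt0// ltr_wpDl.
pose N := (N0 + q.+1 + p.+1)%N.
have := @truncated_solution (fun k u => noise Z U k u w) t l N.
have -> : (q < N)%N by rewrite /N addnAC ltn_addl.
move=> /(_ isT) hQ.
have : e <= E * r ^+ N.
  rewrite /e -hQ -sumrB; apply: le_trans (nm_sum _ _ _) _.
  rewrite /E mulr_suml; apply: ler_sum => i _.
  rewrite /pact -sumrB; apply: le_trans (nm_sum _ _ _) _.
  rewrite mulr_suml; apply: ler_sum => h _.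
  have hN : (h <= N)%N.
    have := leq_trans (ltn_ord h) (szP l i).
    rewrite ltnS => /leq_trans; apply; rewrite /N.
    by clear; lia.
  rewrite -mulrBr nmM -mulrA ler_wpM2l ?nm_ge0// nm_distC.
  apply: le_trans (rate (t - h%:Z) i (N - h)%N) _.
  have -> : r ^+ N = r ^+ (N - h) * r ^+ h by rewrite -exprD subnK.
  rewrite le_eqVlt; apply/orP; left; apply/eqP; field.
  by rewrite expf_neq0 ?gt_eqF// subr_gt0.
apply/negP; rewrite -ltNge.
apply: (@le_lt_trans _ _ ((E + 1) * r ^+ N0)).
  apply: ler_pM; rewrite ?exprn_ge0 ?(ltW r0)//; first by rewrite lerDl.
  by apply: ler_wiXn2l; rewrite ?(ltW r0) ?(ltW r1)// /N -addnA leq_addr.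
by rewrite mulrC -ltr_pdivlMr// ltr_wpDl.
Qed.

End Solution.

(** * Stationarity, causality and anticipation *)

Section Processes.
Context {R : realType} {disp : measure_display} {T : measurableType disp}.
Variable P : probability T R.
Local Notation C := (cplx R).
Local Notation pr := (pr P).
Variables (m d : nat) (Z : int -> {RV P >-> 'cV[C]_d}).
Hypothesis hZ : iid Z.

Lemma random_vector (f : T -> 'cV[C]_m) : measurable_fun setT f ->
  exists X : {RV P >-> 'cV[C]_m}, forall w, X w = f w.
Proof.
move=> mf; pose X : {RV P >-> 'cV[C]_m} := HB.pack f (isMeasurableFun.Build _ _ _ _ f mf).
by exists X.
Qed.

Definition trajectories : Type :=
  g_sigma_algebraType (\bigcup_(r in [set: int])
    preimage_set_system setT (fun x : int -> 'cV[C]_d => x r) measurable).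
HB.instance Definition _ := Measurable.on trajectories.

Lemma coordinate_measurable (u : int) :
  measurable_fun setT (fun x : trajectories => (x : int -> 'cV[C]_d) u).
Proof.
move=> _ B mB; rewrite setTI; apply: sub_sigma_algebra; exists u => //.
by exists B => //; rewrite setTI.
Qed.

(** Joint laws of [Y] are images of the law of the noise trajectory, which is
    shift invariant. *)
Lemma functional_stationary (Y : int -> {RV P >-> 'cV[C]_m})
    (F : int -> (int -> 'cV[C]_d) -> 'I_m -> C) :
  (forall t w i, Y t w i 0 = F t (fun u => Z u w) i) ->
  (forall t h x i, F (t + h) x i = F t (fun u => x (u + h)) i) ->
  (forall t i, cmeas (fun x : trajectories => F t x i)) ->
  strictly_stationary Y.
Proof.
move=> YF Fh mF n t h B mB.
pose G (x : int -> 'cV[C]_d) : 'M[C]_(m, n) := \matrix_(i, j) F (t j) x i.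
have mG : measurable_fun setT (G : trajectories -> _).
  apply: mx_measurable => i j; under [X in cmeas X]eq_fun do rewrite mxE.
  exact: mF.
have sG : sig (fun (t : int) (x : int -> 'cV[C]_d) => x t) setT (G @^-1` B).
  by have := mG measurableT _ mB; rewrite setTI.
have [m1 e1] := iid_shift hZ h sG.
have [m0 _] := iid_shift hZ 0 sG.
have E1 : joint Y (fun j => t j + h) @^-1` B = [set w | (G @^-1` B) (fun t => Z (t + h) w)].
  apply/seteqP; split => w /=; rewrite (_ : joint Y _ w = G (fun t => Z (t + h) w))//.
    by apply/matrixP => i j; rewrite !mxE YF Fh.
  by apply/matrixP => i j; rewrite !mxE YF Fh.
have E0 : joint Y t @^-1` B = [set w | (G @^-1` B) (fun t => Z t w)].
  apply/seteqP; split => w /=; rewrite (_ : joint Y _ w = G (fun t => Z t w))//.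
    by apply/matrixP => i j; rewrite !mxE YF.
  by apply/matrixP => i j; rewrite !mxE YF.
have m0' : measurable [set w | (G @^-1` B) (fun t => Z t w)].
  by move: m0; under eq_fun do under eq_fun do rewrite addr0.
by rewrite E1 E0 -(prE P m1) -(prE P m0') e1.
Qed.

Lemma past_measurable_causal (Y : int -> {RV P >-> 'cV[C]_m}) :
  (forall t i, cmeas ((fun w => Y t w i 0) : sspace Z [set r | (r <= t)%R] -> C)) ->
  causal Z Y.
Proof.
move=> mY t B mB; apply: sub_sigma_algebra; left.
have mYt : measurable_fun setT (Y t : sspace Z [set r | (r <= t)%R] -> 'cV[C]_m).
  by apply: mx_measurable => i j; rewrite ord1; exact: mY.
by have := mYt measurableT _ mB; rewrite setTI.
Qed.

(** The events that differ by a null set from an event of the past form a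
    sigma-algebra; completing the past therefore does not affect its
    independence from the future. *)
Lemma causal_non_anticipative (Y : int -> {RV P >-> 'cV[C]_m}) :
  causal Z Y -> non_anticipative Z Y.
Proof.
move=> hc t B E mB sE.
have mE := sigma_of_measurable sE.
pose J := [set r : int | (r <= t)%R].
pose Q := [set A : set T | exists2 A', sigma_of Z J A' &
  P.-negligible (A `\` A' `|` A' `\` A)].
have saJ : sigma_algebra setT (sigma_of Z J) := smallest_sigma_algebra _ _.
have saQ : sigma_algebra setT Q.
  have [s0 sC sU] := saJ.
  split.
  - by exists set0 => //; rewrite setDv setU0; exact: negligible_set0.
  - move=> A [A' sA' nA]; exists (setT `\` A'); first exact: sC.
    rewrite (_ : _ `|` _ = A `\` A' `|` A' `\` A)//.
    apply/seteqP; split => w /=.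
      by move=> [[[_ a] b]|[[_ a] b]]; [right|left]; split => //; apply: contrapT => h;
        [apply: b|apply: b].
    by move=> [[a b]|[a b]]; [right|left]; split => //; [case|case].
  - move=> A hA; have /choice[A' hA'] : forall n, exists A', sigma_of Z J A' /\
        P.-negligible (A n `\` A' `|` A' `\` A n).
      by move=> n; have [A' h1 h2] := hA n; exists A'.
    exists (\bigcup_n A' n); first by apply: sU => n; have [] := hA' n.
    apply: (negligibleS (A := \bigcup_n (A n `\` A' n `|` A' n `\` A n))).
      move=> w [[[n _ a] b]|[[n _ a] b]]; exists n => //.
        by left; split => // h; apply: b; exists n.
      by right; split => // h; apply: b; exists n.
    by apply: negligible_bigcup => n; have [] := hA' n.
have subQ : <<s sigma_of Z J `|` [set N | P.-negligible N] >> `<=` Q.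
  apply: smallest_sub => // A [sA|nA].
    by exists A => //; rewrite setDv setU0; exact: negligible_set0.
  exists set0; first by have [] := saJ.
  by rewrite setD0 set0D setU0.
have [A' sA' nA] := subQ _ (hc t B mB).
have mA' := sigma_of_measurable sA'.
have mY : measurable (Y t @^-1` B) by exact: measurable_funPTI.
have indep : pr (A' `&` E) = pr A' * pr E.
  apply: (sigma_of_indep (J1 := J) (J2 := [set r | (t < r)%R]) hZ) => //.
  by apply/seteqP; split => // r [/= h1 h2]; move: (le_lt_trans h1 h2); rewrite ltxx.
have eqA F : measurable F -> pr (Y t @^-1` B `&` F) = pr (A' `&` F).
  move=> mF; have m1 := measurableI _ _ mY mF; have m2 := measurableI _ _ mA' mF.
  apply/eqP; rewrite eq_le; apply/andP; split.
    apply: (pr_ae m1 m2 nA) => w [w1 w2].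
    by case: (pselect (A' w)) => h; [left|right; left].
  apply: (pr_ae m2 m1 nA) => w [w1 w2].
  by case: (pselect ((Y t @^-1` B) w)) => h; [left|right; right].
have e1 : pr (Y t @^-1` B) = pr A' by have := eqA _ measurableT; rewrite !setIT.
rewrite -(prE P (measurableI _ _ mY mE)) -(prE P mY) -(prE P mE) -EFinM.
by rewrite eqA// indep e1.
Qed.

End Processes.

(** * The equivalence *)

Section Moments.
Context {R : realType} {disp : measure_display} {T : measurableType disp}.
Variable P : probability T R.
Local Notation C := (cplx R).

Lemma expectation_dominated (I : finType) (L : T -> R) (Li : I -> T -> R) (c : R) :
  measurable_fun setT L -> (forall w, 0 <= L w) ->
  (forall i, measurable_fun setT (Li i)) -> (forall i w, 0 <= Li i w) -> 0 <= c ->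
  (forall i, ('E_P[Li i] < +oo)%E) -> (forall w, L w <= c + \sum_i Li i w) ->
  ('E_P[L] < +oo)%E.
Proof.
move=> mL L0 mLi Li0 c0 fin hL; rewrite unlock.
apply: (@le_lt_trans _ _ (\int[P]_w (c%:E + \sum_i (Li i w)%:E))%E).
  apply: ge0_le_integral => //.
  - by move=> w _; rewrite lee_fin.
  - exact/measurable_EFinP.
  - apply: emeasurable_funD => //.
    by apply: emeasurable_sum => i; exact/measurable_EFinP.
  - by move=> w _; rewrite sumEFin -EFinD lee_fin.
rewrite ge0_integralD//; last 2 first.
- by move=> w _; apply: sume_ge0 => i _; rewrite lee_fin.
- by apply: emeasurable_sum => i; exact/measurable_EFinP.
have -> : (\int[P]_w c%:E)%E = c%:E by have := expectation_cst P c; rewrite unlock.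
rewrite ge0_integral_sum//; last 2 first.
- by move=> i; exact/measurable_EFinP.
- by move=> i w _; rewrite lee_fin.
rewrite lte_add_pinfty ?ltry//; apply: lte_sum_pinfty => i _.
by have := fin i; rewrite unlock.
Qed.

Lemma logplus_sum (m : nat) (u : 'I_m -> R) : (forall i, 0 <= u i) ->
  logplus (\sum_i u i) <= m%:R * ln 2 + \sum_i logplus (u i).
Proof.
elim: m u => [|m ih] u u0.
  by rewrite !big_ord0 mul0r addr0 /logplus max_l// ln1.
rewrite !big_ord_recl; apply: le_trans (logplus1D _ _) _ => //; first exact: sumr_ge0.
have := ih (fun i => u (lift ord0 i)) (fun i => u0 _).
have -> : m.+1%:R = m%:R + 1 :> R by rewrite -addn1 natrD.
by rewrite mulrDl mul1r; lra.
Qed.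

Variables (m d : nat) (nrm : 'cV[C]_m -> R) (hnrm : is_norm nrm).
Variables (Z : int -> {RV P >-> 'cV[C]_d}) (U : 'M[C]_d).

Lemma mulmx_noise_entry (M : 'M[C]_(m, d)) t w i :
  (M *m U *m Z t w) i 0 = comb Z U (M i) t w.
Proof. by rewrite -mulmxA mxE. Qed.

(** All norms being equivalent, logarithmic moments can be checked entrywise. *)
Lemma log_moment_entries (M : 'M[C]_(m, d)) :
  ('E_P[fun w => logplus (nrm (M *m U *m Z 0 w))] < +oo)%E <->
  forall i, ('E_P[fun w => logplus (nm (comb Z U (M i) 0 w))] < +oo)%E.
Proof.
have mE i : measurable_fun setT (fun w => logplus (nm (comb Z U (M i) 0 w))).
  by apply: logplus_measurable; apply: cmeas_nm; exact: comb_cmeas.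
have mN : measurable_fun setT (fun w => logplus (nrm (M *m U *m Z 0 w))).
  apply: logplus_measurable; apply: (measurableT_comp (nrm_measurable hnrm)).
  apply: mx_measurable => i j; rewrite ord1.
  by under [X in cmeas X]eq_fun do rewrite mulmx_noise_entry; exact: comb_cmeas.
split => [fin i|fin].
  have [B B0 hB] := entries_le_nrm hnrm.
  apply: (@expectation_dominated 'I_1 _ (fun _ w => logplus (nrm (M *m U *m Z 0 w))) (logplus B)).
  - exact: mE.
  - by move=> w; exact: logplus_ge0.
  - by [].
  - by move=> _ w; exact: logplus_ge0.
  - exact: logplus_ge0.
  - by [].
  move=> w; rewrite big_ord1 -mulmx_noise_entry.
  apply: le_trans (logplus_le (hB _ i)) _.
  by apply: logplusM; [exact: ltW|exact: nrm_ge0].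
have [B B0 hB] := nrm_le_entries hnrm.
apply: (@expectation_dominated 'I_m _ (fun i w => logplus (nm (comb Z U (M i) 0 w)))
  (logplus B + m%:R * ln 2)) => //.
- by move=> w; exact: logplus_ge0.
- by move=> i w; exact: logplus_ge0.
- by rewrite addr_ge0 ?logplus_ge0// mulr_ge0// ln_ge0// ler1n.
move=> w; apply: le_trans (logplus_le (hB _)) _.
apply: le_trans (logplusM _ _) _ => //; first by apply: sumr_ge0 => *; exact: nm_ge0.
rewrite -addrA lerD2l; under eq_bigr do rewrite mulmx_noise_entry.
by apply: logplus_sum => i; exact: nm_ge0.
Qed.

End Moments.

Section Stable.
Context {R : realType}.
Local Notation C := (cplx R).

Lemma stable_polynomial_inverse (al : {poly C}) : al.[0] = 1 ->
  (forall z, nm z <= 1 -> al.[z] != 0) ->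
  exists (a : nat -> C) (K rho : R), [/\ 0 <= K, 0 < rho < 1,
    (forall n, nm (a n) <= K * rho ^+ n) & series_inverse al a].
Proof.
move=> al0 hal.
have aln0 : al != 0.
  by apply/eqP => h; move: al0; rewrite h horner0 => /eqP; rewrite eq_sym oner_eq0.
have [|k [ls [zs [k0 hls hzs e]]]] := root_split aln0.
  by move=> z z1; apply: hal; rewrite z1.
have zs0 : zs = [::].
  case: zs hzs e => // z zs hzs e; exfalso.
  have /hal : nm z <= 1 by apply/ltW/hzs; rewrite inE eqxx.
  by rewrite e hornerZ hornerM big_cons hornerM hornerXsubC subrr mul0r !mulr0 eqxx.
have k1 : k = 1.
  move: al0; rewrite e zs0 big_nil mulr1 hornerZ horner_prod big1 ?mulr1// => l _.
  by rewrite hornerD hornerN hornerZ hornerX mulr0 subr0 -polyC1 hornerC.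
have alE : al = \prod_(l <- ls) (1 - l *: 'X) by rewrite e zs0 k1 big_nil mulr1 scale1r.
by rewrite alE; exact: stable_inverse.
Qed.

End Stable.

Section Equivalence.
Context {R : realType} {disp : measure_display} {T : measurableType disp}.
Variable P : probability T R.
Local Notation C := (cplx R).
Variables (m d p q : nat) (hm : (0 < m)%N).
Variables (nrm : 'cV[C]_m -> R) (hnrm : is_norm nrm).
Variables (Z : int -> {RV P >-> 'cV[C]_d}) (hZ : iid Z).
Variables (Psi : nat -> 'M[C]_m) (Theta : nat -> 'M[C]_(m, d)).
Variables (K : set 'cV[C]_d) (hK : K = degenerate_directions (Z 0)).
Variables (s : nat) (U : 'M[C]_d) (hU : U \is unitarymx).
Hypothesis hUK : [set U *m v | v in K] =
  [set v : 'cV[C]_d | forall i : 'I_d, (i < s)%N -> v i 0 = 0].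

Local Notation Pz := (ar_poly p Psi).
Local Notation Qt := (reduced_ma_poly q Theta U s).
Hypothesis hcoprime : left_coprime Pz Qt.

Let J := (m * p + q - p + 1)%N.
Let JE : (J + p = m * p + q + 1)%N.
Proof.
rewrite /J; have : (p <= m * p)%N by rewrite leq_pmull.
by move: (m * p)%N; clear; lia.
Qed.

Let hconst (k : 'I_d) : (s <= k)%N ->
  exists c : C, forall t, {ae P, forall w, noise Z U k t w = c}.
Proof. exact: noise_constant hK hU hUK k. Qed.

Definition stable_condition :=
  (forall z : cplx R, `|z| <= 1 -> (\det Pz).[z] != 0) /\
  (exists2 M : nat -> 'M[cplx R]_(m, d),
    taylor_expansion0 (transfer_fun Pz Qt) M &
    forall j : nat, (m * p + q - p + 1 <= j <= m * p + q)%N ->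
      ('E_P[fun w => (logplus (nrm (M j *m U *m Z 0 w)))%R] < +oo)%E).

Lemma non_anticipative_stable (Y : int -> {RV P >-> 'cV[C]_m}) :
  arma_solution p q Psi Theta Z Y -> strictly_stationary Y -> non_anticipative Z Y ->
  stable_condition.
Proof.
move=> hsol hstat hna.
have [cst hrows] := arma_rows p q Psi Theta hU hconst.
have hEq : {ae P, forall w, forall t i,
    \sum_j pact (Pz i j) (fun t => Y t w j 0) t =
    \sum_k pact (Qt i k) (fun t => noise Z U k t w) t + cst i}.
  apply: filterS2 hrows (ae_forall_int hsol) => w h1 h2 t i.
  by apply/(h1 (fun t => Y t w) t i); rewrite h2.
have hnd := comb_nondegenerate hZ hK hU hUK.
have hQ0 i (k : 'I_d) : (s <= k)%N -> Qt i k = 0.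
  by move=> sk; rewrite reduced_ma_polyE ltnNge sk.
have hpbh z (w : 'rV[C]_m) : w != 0 -> w *m evalmxp Pz z = 0 -> w *m evalmxp Qt z != 0.
  exact: left_coprime_kernel.
have hdet := ar_poly_det0 p Psi.
have hunit := no_unit_root hZ hEq hstat hna hnd hQ0 hpbh.
have hdisc z : nm z <= 1 -> (\det Pz).[z] != 0.
  have d0 : \det Pz != 0.
    by apply/eqP => h; move: hdet; rewrite h horner0 => /eqP; rewrite eq_sym oner_eq0.
  have [k [ls [zs [k0 hls hzs e]]]] := root_split d0 hunit.
  have zs0 := no_small_root hZ hEq hstat hna hnd hQ0 hpbh k0 hls hzs e.
  rewrite le_eqVlt => /orP[/eqP/hunit//|z1].
  rewrite e zs0 big_nil mulr1 hornerZ mulf_neq0//.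
  exact: stable_factor_nonzero hls z z1.
split; first by move=> z hz; apply: hdisc; rewrite nm_le.
have [a [Ka [rho [Ka0 rho01 ha inva]]]] := stable_polynomial_inverse hdet hdisc.
exists (transfer_coef Pz Qt a).
  exact: (transfer_coef_taylor Qt Ka0 rho01 ha inva hdisc).
move=> j /andP[j1 j2]; apply/(log_moment_entries hnrm) => i.
have sz k : (size ((\adj Pz *m Qt)%R i k) <= j)%N.
  apply: leq_trans (size_adj_mul (size_ar_poly p Psi) (size_reduced_ma_poly q s Theta U) i k) _.
  by rewrite -addn1.
have := coefficient_log_moment hZ hEq hstat hna hdet Ka0 rho01 ha inva sz.
rewrite (_ : transfer_coef Pz Qt a j i = fun k => series_coef a ((\adj Pz *m Qt) i k) j)//.
by apply/funext => k; rewrite mxE.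
Qed.

(** The free constant of the solution is [invmx (Pz 1)] applied to the constant
    term of the equation. *)
Lemma stable_causal : stable_condition ->
  exists Y : int -> {RV P >-> 'cV[C]_m},
    [/\ arma_solution p q Psi Theta Z Y, strictly_stationary Y & causal Z Y].
Proof.
move=> [hz [M hM hmom]].
have hdisc z : nm z <= 1 -> (\det Pz).[z] != 0 by rewrite nm_le; exact: hz.
have hdet := ar_poly_det0 p Psi.
have [a [Ka [rho [Ka0 rho01 ha inva]]]] := stable_polynomial_inverse hdet hdisc.
have ME := taylor_coef_unique Ka0 rho01 ha inva hdisc hM.
have szP := @size_ar_poly R m p Psi.
have szQ := size_reduced_ma_poly q s Theta U.
have qJ : (q < J + p)%N by rewrite JE addn1 ltnS leq_addl.
have hmom' j i : (j < p)%N ->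
   ('E_P[fun w => logplus (nm (comb Z U (transfer_coef Pz Qt a (J + j) i) 0 w))] < +oo)%E.
  move=> jp; have Jj : (m * p + q - p + 1 <= J + j <= m * p + q)%N.
    rewrite leq_addr/= -ltnS -[X in (_ < X)%N]addn1 -JE.
    by rewrite ltn_add2l.
  have := hmom (J + j)%N Jj; rewrite ME => h.
  exact: ((log_moment_entries hnrm Z U _).1 h i).
have [cst hrows] := arma_rows p q Psi Theta hU hconst.
pose cv : 'cV[C]_m := invmx (evalmxp Pz 1) *m (\col_i cst i).
pose c' i := cv i 0.
have hc' l : \sum_i (Pz l i).[1] * c' i = cst l.
  have Pu : evalmxp Pz 1 \in unitmx.
    by rewrite unitmxE det_evalmxp unitfE hdisc// nm1.
  have : (evalmxp Pz 1 *m cv) l 0 = cst l by rewrite mulmxA mulmxV// mul1mx mxE.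
  by rewrite mxE => <-; apply: eq_bigr => i _; rewrite [evalmxp _ _ _ _]mxE.
pose F := solution_entry U Pz Qt a c'.
have /choice[Y hY] : forall t, exists Yt : {RV P >-> 'cV[C]_m},
    forall w, Yt w = \col_i F t (fun u => Z u w) i.
  move=> t; apply: random_vector; apply: mx_measurable => i j.
  under [X in cmeas X]eq_fun do rewrite mxE.
  by apply: (solution_entry_cmeas _ _ _ _ _ (X := fun u => Z u)) => u _; exact: measurable_funPT.
have YF t w i : Y t w i 0 = F t (fun u => Z u w) i by rewrite hY mxE.
exists Y; split.
- have hsol := solution_entry_equation hZ Ka0 rho01 ha inva szP szQ qJ hmom' c'.
  move=> t; apply: filterS2 hrows hsol => w h1 h2.
  apply/matrixP => i j; rewrite ord1; apply/(h1 (fun t => Y t w) t i).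
  rewrite -hc' -h2; apply: eq_bigr => l _; apply: pact_eq => u.
  exact: YF.
- apply: (functional_stationary hZ YF) => [t h x i|t i].
    exact: solution_entry_shift.
  apply: (solution_entry_cmeas _ _ _ _ _ (X := fun u (x : trajectories d) => (x : int -> 'cV[C]_d) u)) => u _.
  exact: coordinate_measurable.
apply: past_measurable_causal => t i.
under [X in cmeas X]eq_fun do rewrite YF.
apply: (solution_entry_cmeas _ _ _ _ _
  (X := fun u => (Z u : sspace Z [set v | (v <= t)%R] -> 'cV[C]_d))) => u ut.
exact: Z_measurable_in.
Qed.

End Equivalence.

Theorem theorem6p8 (R : realType) (disp : measure_display)
    (T : measurableType disp) (P : probability T R)
    (m d p q : nat) (hm : (0 < m)%N) (hd : (0 < d)%N) (hp : (0 < p)%N)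
    (nrm : 'cV[cplx R]_m -> R) (hnrm : is_norm nrm)
    (Z : int -> {RV P >-> 'cV[cplx R]_d}) (hZ : iid Z)
    (Psi : nat -> 'M[cplx R]_m) (Theta : nat -> 'M[cplx R]_(m, d))
    (K : set 'cV[cplx R]_d) (hK : K = degenerate_directions (Z 0))
    (s : nat) (hs : has_dim (orthocompl K) s)
    (U : 'M[cplx R]_d) (hU : U \is unitarymx)
    (hUKperp : [set U *m v | v in orthocompl K] =
               [set v : 'cV[cplx R]_d | forall i : 'I_d, (s <= i)%N -> v i 0 = 0])
    (hUK : [set U *m v | v in K] =
           [set v : 'cV[cplx R]_d | forall i : 'I_d, (i < s)%N -> v i 0 = 0])
    (Pz : 'M[{poly cplx R}]_m) (hPz : Pz = ar_poly p Psi)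
    (Qt : 'M[{poly cplx R}]_(m, d)) (hQt : Qt = reduced_ma_poly q Theta U s)
    (hcoprime : left_coprime Pz Qt) :
  let cond_i := exists Y : int -> {RV P >-> 'cV[cplx R]_m},
    [/\ arma_solution p q Psi Theta Z Y, strictly_stationary Y
      & non_anticipative Z Y] in
  let cond_ii := exists Y : int -> {RV P >-> 'cV[cplx R]_m},
    [/\ arma_solution p q Psi Theta Z Y, strictly_stationary Y
      & causal Z Y] in
  let cond_iii :=
    (forall z : cplx R, `|z| <= 1 -> (\det Pz).[z] != 0) /\
    (exists2 M : nat -> 'M[cplx R]_(m, d),
      taylor_expansion0 (transfer_fun Pz Qt) M &
      forall j : nat, (m * p + q - p + 1 <= j <= m * p + q)%N ->
        ('E_P[fun w => (logplus (nrm (M j *m U *m Z 0 w)))%R] < +oo)%E) in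
  (cond_i <-> cond_ii) /\ (cond_ii <-> cond_iii).
Proof.
move=> cond_i cond_ii cond_iii; rewrite {}hPz {}hQt in hcoprime cond_iii *.
have i_iii : cond_i -> cond_iii.
  move=> [Y [hsol hstat hna]].
  exact: (non_anticipative_stable hnrm hZ hK hU hUK hcoprime hsol hstat hna).
have iii_ii : cond_iii -> cond_ii by exact: (stable_causal hm hnrm hZ hK hU hUK).
have ii_i : cond_ii -> cond_i.
  move=> [Y [hsol hstat hc]]; exists Y; split => //.
  exact: causal_non_anticipative.
by split; split; tauto.
Qed.
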